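(* Let $\mathcal{H}$ be a separable Hilbert space, $T>0$. Let $F\colon[0,T]\times\mathcal{H}\rightrightarrows\mathcal{H}$ have nonempty, closed, convex values and satisfy: (F1) for each $v$, $F(\cdot,v)$ is measurable; (F2) for a.e. $t$, $F(t,\cdot)$ is upper semicontinuous from $\mathcal{H}$ into $\mathcal{H}_w$; (F3) there exist integrable $c,d\colon[0,T]\to\mathbb{R}_+$ with $\inf\{\|w\|\colon w\in F(t,v)\}\le c(t)\|v\|+d(t)$ for all $v$ and a.e. $t$; (F4) there is an integrable $k\colon[0,T]\to\mathbb{R}_+$ with $\gamma(F(t,A))\le k(t)\gamma(A)$ for a.e. $t$ and all bounded $A\subset\mathcal{H}$, where $\gamma$ is either the Kuratowski or the Hausdorff measure of non-compactness. Let $g\colon[0,T]\times[0,T]\times\mathcal{H}\to\mathcal{H}$ satisfy: (g1) for each $v$, $(t,s)\mapsto g(t,s,v)$ is measurable; (g2) for every $r>0$ there is an integrable $\mu_r\colon[0,T]\to\mathbb{R}_+$ with $\|g(t,s,x)-g(t,s,y)\|\le\mu_r(t)\|x-y\|$ for all $(t,s)\in D:=\{(t,s)\in[0,T]^2\colon s\le t\}$ and $x,y\in r\mathbb{B}$; (g3) there is a nonnegative integrable $\sigma\colon D\to\mathbb{R}$ with $\|g(t,s,x)\|\le\sigma(t,s)(1+\|x\|)$ for all $(t,s)\in D$, $x\in\mathcal{H}$. Let $C\colon[0,T]\times\mathcal{H}\rightrightarrows\mathcal{H}$ have nonempty closed values and satisfy: (C1) there exist $\zeta\in\operatorname{AC}([0,T];\mathbb{R}_+)$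 and $L\in[0,1[$ such that $|d(z,C(t,x))-d(z,C(s,y))|\le|\zeta(t)-\zeta(s)|+L\|x-y\|$ for all $s,t\in[0,T]$ and $x,y,z\in\mathcal{H}$; (C2) the family $\{C(t,x)\colon(t,x)\in[0,T]\times\mathcal{H}\}$ is equi-uniformly subsmooth; (C3) for every $t\in[0,T]$, every $r>0$ and every bounded $A\subset\mathcal{H}$, the set $C(t,A)\cap r\mathbb{B}$ is relatively compact. Let $x_0\in C(0,x_0)$. Then the problem $$\dot x(t)\in-N(C(t,x(t));x(t))+F(t,x(t))+\int_0^tg(t,s,x(s))ds\ \text{ a.e. } t\in[0,T],\qquad x(0)=x_0,$$ admits at least one solution $x\in\operatorname{AC}([0,T];\mathcal{H})$.
   Context: $\mathbb{B}$ is the closed unit ball, $\mathcal{H}_w$ is $\mathcal{H}$ with the weak topology, $d(z,S)=\inf_{y\in S}\|z-y\|$, $C(t,A)=\bigcup_{a\in A}C(t,a)$. Kuratowski measure: $\alpha(A)=\inf\{d>0\colon A$ has a finite cover by sets of diameter $\le d\}$; Hausdorff measure: $\beta(A)=\inf\{r>0\colon A$ is covered by finitely many balls of radius $r\}$. Clarke tangent cone: $h\in T(S;x)$ iff for every sequence $x_n\in S$, $x_n\to x$, and every $t_n\downarrow0$, there exist $h_n\to h$ with $x_n+t_nh_n\in S$; Clarke normal cone $N(S;x)=\{v\colon\langle v,h\rangle\le0\ \forall h\in T(S;x)\}$ for $x\in S$, and $N(S;x)=\emptyset$ if $x\notin S$. A family $(S(i))_{i\in E}$ of closed sets is equi-uniformly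 subsmooth if for every $\varepsilon>0$ there is $\delta>0$ such that $\langle x_1^*-x_2^*,x_1-x_2\rangle\ge-\varepsilon\|x_1-x_2\|$ for each $i\in E$, all $x_1,x_2\in S(i)$ with $\|x_1-x_2\|<\delta$ and all $x_j^*\in N(S(i);x_j)\cap\mathbb{B}$, $j=1,2$. *)

(* Defs.v *)
From HB Require Import structures.
From mathcomp Require Import all_boot all_order all_algebra.
From mathcomp Require Import all_classical all_reals all_analysis.
Set Implicit Arguments. Unset Strict Implicit. Unset Printing Implicit Defensive.
Import Order.TTheory GRing.Theory Num.Theory.
Import numFieldNormedType.Exports.
Local Open Scope classical_set_scope.
Local Open Scope ring_scope.

Section RealDefs.
Context {R : realType}.

Definition Icc (a b : R) : set R := [set t | a <= t <= b].

Definition triangle (T : R) : set (R * R) := [set ts : R * R | 0 <= ts.2 /\ ts.2 <= ts.1 /\ ts.1 <= T].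

(** Lebesgue measurable subsets of R (Caratheodory sets of the outer
    Lebesgue measure = completed Borel sigma-algebra) *)
Definition Lmeasurable (A : set R) : Prop :=
  (@wlength R idfun)^*%mu.-cara.-measurable A.

Definition Lintegrable (A : set R) (f : R -> R) : Prop :=
  (@completed_lebesgue_measure R).-integrable A (EFin \o f).

Definition leb2 := ((@lebesgue_measure R) \x (@lebesgue_measure R))%E.

Definition Lmeasurable2 (A : set (R * R)) : Prop :=
  exists B N : set (measurableTypeR R * measurableTypeR R),
    [/\ measurable B, measurable N, leb2 N = 0%E &
                 (A `\` B) `|` (B `\` A) `<=` N].

Definition Lintegrable2 (A : set (R * R)) (f : R * R -> R) : Prop :=
  exists f' : R * R -> R, leb2.-integrable A (EFin \o f') /\
    exists N, [/\ measurable N, leb2 N = 0%E & [set z | A z /\ f z <> f' z] `<=` N].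

Definition abs_cont {V : normedModType R} (a b : R) (f : R -> V) : Prop :=
  forall eps : R, 0 < eps -> exists2 delta : R, 0 < delta &
    forall (n : nat) (u v : nat -> R),
      (forall i, (i < n)%N -> a <= u i /\ u i <= v i /\ v i <= b) ->
      (forall i j, (i < n)%N -> (j < n)%N -> i <> j -> v i <= u j \/ v j <= u i) ->
      \sum_(i < n) (v i - u i) < delta ->
      \sum_(i < n) `|f (v i) - f (u i)| < eps.

End RealDefs.

Section HilbertDefs.
Context {R : realType} {H : normedModType R}.

Definition inner_product (ip : H -> H -> R) : Prop :=
  [/\ forall x y, ip x y = ip y x,
      forall (a : R) x y z, ip (a *: x + y) z = a * ip x z + ip y z &
      forall x, ip x x = `|x| ^+ 2].

Definition separable_space : Prop :=
  exists S : set H, countable S /\ closure S = setT.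

Definition bounded_subset (A : set H) : Prop :=
  exists M : R, forall x, A x -> `|x| <= M.

Definition rball (r : R) : set H := [set y | `|y| <= r].

Definition convex_subset (S : set H) : Prop :=
  forall a b (l : R), S a -> S b -> 0 <= l <= 1 -> S (l *: a + (1 - l) *: b).

Definition dist (z : H) (S : set H) : R := inf [set `|z - y| | y in S].

Definition mimage (G : H -> set H) (A : set H) : set H := \bigcup_(a in A) G a.

(** Kuratowski measure of non-compactness (extended real; +oo if no finite
    cover by sets of diameter <= d exists) *)
Definition kuratowski (A : set H) : \bar R :=
  ereal_inf [set d%:E | d in [set d : R | 0 < d /\
     exists (n : nat) (S : nat -> set H),
       A `<=` \bigcup_(i in `I_n) S i /\
       forall i, (i < n)%N -> forall x y, S i x -> S i y -> `|x - y| <= d]].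

Definition hausdorff_mnc (A : set H) : \bar R :=
  ereal_inf [set r%:E | r in [set r : R | 0 < r /\
     exists (n : nat) (c : nat -> H), A `<=` \bigcup_(i in `I_n) ball (c i) r]].

Variable ip : H -> H -> R.

Definition weakly_open (W : set H) : Prop :=
  forall w, W w -> exists (s : seq H) (eps : R), 0 < eps /\
    [set y | forall e, e \in s -> `|ip (y - w) e| < eps] `<=` W.

Definition usc_weak (G : H -> set H) : Prop :=
  forall x (W : set H), weakly_open W -> G x `<=` W ->
    exists2 delta : R, 0 < delta & forall y, `|y - x| < delta -> G y `<=` W.

Definition clarke_tangent (S : set H) (x : H) : set H :=
  [set h | forall (xn : nat -> H) (tn : nat -> R),
     (forall n, S (xn n)) -> xn @ \oo --> x ->
     (forall n, 0 < tn n) -> tn @ \oo --> 0 ->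
     exists hn : nat -> H, hn @ \oo --> h /\ forall n, S (xn n + tn n *: hn n)].

Definition clarke_normal (S : set H) (x : H) : set H :=
  [set v | S x /\ forall h, clarke_tangent S x h -> ip v h <= 0].

Definition equi_uniformly_subsmooth {I : Type} (E : set I) (S : I -> set H) : Prop :=
  forall eps : R, 0 < eps -> exists2 delta : R, 0 < delta &
    forall i x1 x2 v1 v2, E i -> S i x1 -> S i x2 -> `|x1 - x2| < delta ->
      clarke_normal (S i) x1 v1 -> `|v1| <= 1 ->
      clarke_normal (S i) x2 v2 -> `|v2| <= 1 ->
      - (eps * `|x1 - x2|) <= ip (v1 - v2) (x1 - x2).

Definition Hmeasurable (A : set R) (f : R -> H) : Prop :=
  forall U : set H, open U -> Lmeasurable (A `&` f @^-1` U).

Definition Hmeasurable2 (A : set (R * R)) (f : R * R -> H) : Prop :=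
  forall U : set H, open U -> Lmeasurable2 (A `&` f @^-1` U).

Definition mf_measurable (A : set R) (G : R -> set H) : Prop :=
  forall U : set H, open U -> Lmeasurable [set t | A t /\ G t `&` U !=set0].

(** I is the Bochner integral of f over A: f is (strongly) measurable and
    norm-integrable, and I is characterized by <I, e> = int_A <f s, e> ds *)
Definition bochner_integral (A : set R) (f : R -> H) (I : H) : Prop :=
  [/\ Hmeasurable A f,
      (@completed_lebesgue_measure R).-integrable A (fun s => (`|f s|)%:E) &
      forall e, ip I e = Rintegral (@completed_lebesgue_measure R) A (fun s => ip (f s) e)].

End HilbertDefs.

(* Main.v *)
(** Catching-up algorithm. With [w = 1 + 2 (c + S) + z], where [c] bounds a minimal-norm
    selection of [F], [S] the Volterra term and [z] the speed of [C] in time, use the clock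
    [psi t = \int_0^t w] to cut [0, T] into cells of equal [psi]-length and project
    [X_j] plus the forcing over the cell onto [C (tau_(j+1), X_j)]. Since the state argument of
    [C] is frozen and [L < 1], the iterates stay bounded and are Lipschitz in the clock; (C3)
    and an ultrafilter give a uniform limit [x] along a subsequence. The velocities are
    [w a_n] and [w b_n] with [a_n], [b_n] bounded, and each requirement on the limit pair (a
    support-function inequality for [F], a subsmooth normality inequality for [C], the integral
    equation) is stable under midpoints. Choosing nearly norm-minimal pairs among those
    satisfying it with tolerance [1/m], the parallelogram law gives strong L^2 convergence,
    hence almost everywhere convergence along a fast subsequence; this replaces weak compactness and
    Mazur's lemma. *)

Require Import Defs.
From HB Require Import structures.
From mathcomp Require Import all_boot all_order all_algebra.
From mathcomp Require Import all_classical all_reals all_analysis.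
From mathcomp Require Import measurable_realfun ring lra.
Set Implicit Arguments.
Unset Strict Implicit.
Unset Printing Implicit Defensive.
Import Order.TTheory GRing.Theory Num.Theory.
Import numFieldNormedType.Exports.
Local Open Scope classical_set_scope.
Local Open Scope ring_scope.

(** The data [c], [S], [z] are only integrable in time, so uniform estimates exist only in clock
    time: there each step moves by at most a constant times the mesh. The summand 1 in [w] makes the
    clock strictly increasing; the factor 2 appears because a projection step is bounded by twice
    the forcing plus the distance to the moved set. That distance inherits [L] times the previous
    displacement, and the estimate closes with [kap = (1 - L)^-1], the fixed point of [k = 1 + L k].
    Limits are needed at uncountably many times at once, which is what the ultrafilter provides. The
    velocities of the scheme are merely bounded and need not converge; the limit pair is therefore
    selected among all pairs satisfying the relaxed conditions, and the scheme only shows that such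
    pairs exist for every tolerance. Growth bounds known almost everywhere are made to hold
    everywhere by setting the selections of [F] and the kernel to zero on null sets; the original
    data return only at the end. *)

Section Clip.
Context {R : realType}.
Variable T : R.
Implicit Types s t : R.

(** Freezing time outside [[0, T]] makes the variation function, the clock and the limit curve
    total, so that monotonicity, continuity and bounds hold on the whole line. *)
Definition clip t := Num.max 0 (Num.min t T).

Lemma clipP (T0 : 0 < T) t : 0 <= clip t <= T.
Proof. by rewrite /clip le_max lexx ge_max (ltW T0) ge_min lexx orbT. Qed.

Lemma clip_id t : 0 <= t <= T -> clip t = t.
Proof. by rewrite /clip => /andP[t0 tT]; rewrite (min_idPl tT) (max_idPr t0). Qed.

Lemma clip_nd s t : s <= t -> clip s <= clip t.
Proof.
by move=> st; rewrite /clip ge_max !le_max lexx /= le_min !ge_min st lexx !orbT.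
Qed.

Lemma clip_lip s t : s <= t -> clip t - clip s <= t - s.
Proof. by rewrite /clip /Num.max /Num.min; do !case: ifP => //; move=> *; lra. Qed.

End Clip.

(** * Hilbert space *)

(* Abstract parallelogram argument: [D a b] plays the role of [|a - b|^2]. It serves both for
   projections and for nearly minimal pairs of velocities. *)
Lemma near_minimal_cauchy (R : realType) (V : Type) (E : nat -> set V)
    (Q : V -> R) (mid : V -> V -> V) (D : V -> V -> R) (M : R) :
  (forall m, E m !=set0) ->
  (forall m k, (m <= k)%N -> E k `<=` E m) ->
  (forall m a b, E m a -> E m b -> E m (mid a b)) ->
  (forall a, E 0%N a -> 0 <= Q a <= M) ->
  (forall a b, E 0%N a -> E 0%N b -> D a b <= 2 * Q a + 2 * Q b - 4 * Q (mid a b)) ->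
  exists a : nat -> V, [/\ forall m, E m (a m),
    forall m b, E m b -> Q (a m) <= Q b + m.+1%:R^-1 &
    forall eps, 0 < eps -> exists N, forall m k, (N <= m)%N -> (N <= k)%N ->
      D (a m) (a k) <= eps].
Proof.
move=> En0 Edec Emid QM DQ.
have E0 m a : E m a -> E 0%N a by apply: Edec.
pose d m := inf (Q @` E m).
have hi m : has_inf (Q @` E m).
  split; first by have [a Ea] := En0 m; exists (Q a), a.
  by exists 0 => _ [a /E0 /QM /andP[a0 _] <-].
have dle m b : E m b -> d m <= Q b.
  by move=> Eb; apply: ge_inf; [exact: (hi m).2|exists b].
have /choice[a aP] : forall m, exists a, E m a /\ Q a < d m + m.+1%:R^-1.
  move=> m; have [//|_ [a Ea <-] aQ] := @inf_adherent _ (Q @` E m) m.+1%:R^-1 _ (hi m).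
  by exists a.
have dnd m k : (m <= k)%N -> d m <= d k.
  move=> mk; apply: lb_le_inf; first exact: (hi k).1.
  by move=> _ [b /(Edec _ _ mk) Eb <-]; exact: dle.
have hs : has_sup (range d).
  split; first by exists (d 0%N), 0%N.
  exists M => _ [m _ <-]; have [b Eb] := En0 m.
  by apply: (le_trans (dle _ _ Eb)); case/andP: (QM _ (E0 _ _ Eb)).
have dsup m : d m <= sup (range d) by apply: sup_upper_bound => //; exists m.
exists a; split => [m|m b Eb|eps e0].
- exact: (aP m).1.
- by apply: (le_trans (ltW (aP m).2)); rewrite lerD2r dle.
(* Both values of [Q] will be at most [sup + eps / 8], and the midpoint has [Q] at least
   [sup - eps / 8]; with the factors 2, 2, 4 the bound on [D] is exactly [eps]. *)
have e8 : 0 < eps / 8 by lra.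
have [_ [N1 _ <-] N1P] := @sup_adherent _ (range d) (eps / 8) e8 hs.
have [N2 N2P] : exists N2 : nat, N2.+1%:R^-1 < eps / 8.
  exists (Num.bound (eps / 8)^-1).
  rewrite invf_plt ?posrE//; have := archi_boundP (ltW _ : 0 <= (eps/8)^-1).
  rewrite invr_gt0 => /(_ e8) /lt_trans; apply; by rewrite ltr_nat.
exists (maxn N1 N2) => m k mN kN.
have aux j : (maxn N1 N2 <= j)%N ->
    E N1 (a j) /\ Q (a j) <= sup (range d) + eps / 8.
  rewrite geq_max => /andP[j1 j2]; split; first exact: (Edec _ _ j1 _ (aP j).1).
  apply: (le_trans (ltW (aP j).2)); apply: lerD => //.
  by apply: ltW; apply: le_lt_trans N2P; rewrite lef_pV2 ?posrE// ler_nat.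
have [Em Qm] := aux _ mN; have [Ek Qk] := aux _ kN.
have := dle _ _ (Emid _ _ _ Em Ek).
have := DQ _ _ (E0 _ _ Em) (E0 _ _ Ek).
lra.
Qed.

Lemma cvgn_le (R : realType) (u : nat -> R) (l M : R) :
  u @ \oo --> l -> (forall n, u n <= M) -> l <= M.
Proof.
by move=> ul uM; apply: (closed_cvg (fun y => y <= M) (@closed_le R M) _ l ul); exact: nearW.
Qed.

Lemma cvgn_ge (R : realType) (u : nat -> R) (l M : R) :
  u @ \oo --> l -> (forall n, M <= u n) -> M <= l.
Proof.
by move=> ul uM; apply: (closed_cvg (fun y => M <= y) (@closed_ge R M) _ l ul); exact: nearW.
Qed.

Section Hilbert.
Context {R : realType} {H : completeNormedModType R}.
Variable ip : H -> H -> R.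
Hypothesis hip : inner_product ip.

Lemma ipC x y : ip x y = ip y x. Proof. by case: hip. Qed.
Lemma ipxx x : ip x x = `|x| ^+ 2. Proof. by case: hip. Qed.
Lemma ip0l x : ip 0 x = 0.
Proof.
case: hip => _ l _; have := l (-1) 0 0 x; rewrite scaler0 addr0 mulN1r.
by move=> h; rewrite h addNr.
Qed.
Lemma ipDl x y z : ip (x + y) z = ip x z + ip y z.
Proof. by case: hip => _ l _; have := l 1 x y z; rewrite scale1r mul1r. Qed.
Lemma ipZl a x z : ip (a *: x) z = a * ip x z.
Proof. by case: hip => _ l _; have := l a x 0 z; rewrite addr0 ip0l addr0. Qed.
Lemma ipNl x z : ip (- x) z = - ip x z.
Proof. by rewrite -scaleN1r ipZl mulN1r. Qed.
Lemma ipBl x y z : ip (x - y) z = ip x z - ip y z.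
Proof. by rewrite ipDl ipNl. Qed.
Lemma ip0r x : ip x 0 = 0. Proof. by rewrite ipC ip0l. Qed.
Lemma ipDr x y z : ip z (x + y) = ip z x + ip z y.
Proof. by rewrite !(ipC z) ipDl. Qed.
Lemma ipZr a x z : ip z (a *: x) = a * ip z x.
Proof. by rewrite !(ipC z) ipZl. Qed.
Lemma ipNr x z : ip z (- x) = - ip z x.
Proof. by rewrite !(ipC z) ipNl. Qed.
Lemma ipBr x y z : ip z (x - y) = ip z x - ip z y.
Proof. by rewrite !(ipC z) ipBl. Qed.

Lemma normsqB x y : `|x - y| ^+ 2 = `|x| ^+ 2 - 2 * ip x y + `|y| ^+ 2.
Proof. rewrite -!ipxx ipBl !ipBr (ipC y x); ring. Qed.
Lemma ip_le_norm x y : ip x y <= `|x| * `|y|.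
Proof.
have [->|x0] := eqVneq x 0; first by rewrite ip0l normr0 mul0r.
have [->|y0] := eqVneq y 0; first by rewrite ip0r normr0 mulr0.
have nx : 0 < `|x| by rewrite normr_gt0.
have ny : 0 < `|y| by rewrite normr_gt0.
have := sqr_ge0 (`| `|y| *: x - `|x| *: y |).
rewrite normsqB ipZl ipZr !normrZ !normr_id !exprMn.
have -> : `|y| ^+ 2 * `|x| ^+ 2 - 2 * (`|y| * (`|x| * ip x y)) + `|x| ^+ 2 * `|y| ^+ 2
  = (2 * (`|x| * `|y|)) * (`|x| * `|y| - ip x y) by ring.
by rewrite pmulr_rge0 ?subr_ge0//; apply: mulr_gt0 => //; apply: mulr_gt0.
Qed.

Lemma normr_ip_le x y : `|ip x y| <= `|x| * `|y|.
Proof.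
by rewrite ler_norml ip_le_norm andbT lerNl -ipNl (le_trans (ip_le_norm _ _))// normrN.
Qed.

Lemma ip_eq0 x : (forall e, ip x e = 0) -> x = 0.
Proof. by move=> /(_ x); rewrite ipxx => /eqP; rewrite sqrf_eq0 normr_eq0 => /eqP. Qed.

Lemma ip_inj x y : (forall e, ip x e = ip y e) -> x = y.
Proof.
move=> h; apply/eqP; rewrite -subr_eq0; apply/eqP/ip_eq0 => e.
by rewrite ipBl h subrr.
Qed.

(** Integrals of vectors are known only through their inner products; testing against the vector
    itself turns that into norm bounds. *)
Lemma norm_le_ip x (M : R) : 0 <= M -> ip x x <= M * `|x| -> `|x| <= M.
Proof.
move=> M0; rewrite ipxx; have [->|x0] := eqVneq x 0; first by rewrite normr0.
by rewrite expr2 ler_pM2r ?normr_gt0.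
Qed.

Lemma midpoint_normsq (a b z : H) :
  `|a - b| ^+ 2 = 2 * `|z - a| ^+ 2 + 2 * `|z - b| ^+ 2
    - 4 * `|z - 2^-1 *: (a + b)| ^+ 2.
Proof.
rewrite !normsqB -!ipxx ipZr ipZl ipZr !ipDr !ipDl (ipC b a); by field.
Qed.

Lemma cauchy_seq_cvg (u : nat -> H) :
  (forall eps, 0 < eps -> exists N, forall m k, (N <= m)%N -> (N <= k)%N ->
     `|u m - u k| <= eps) -> cvgn u.
Proof.
move=> uc; apply: cauchy_cvg; apply: cauchy_exP => e e0.
have [|N NP] := uc (e / 2); first by rewrite divr_gt0.
exists (u N); exists N => // n /= Nn; rewrite -ball_normE /=.
rewrite (le_lt_trans (NP _ _ (leqnn N) Nn))//.
by rewrite ltr_pdivrMr// ltr_pMr// ltr1n.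
Qed.

Lemma closed_seq_lim (S : set H) (u : nat -> H) l :
  closed S -> (forall n, S (u n)) -> u @ \oo --> l -> S l.
Proof. by move=> cS Su ul; apply: (closed_cvg S cS _ l ul); exact: nearW. Qed.

Lemma cvg_normB (u : nat -> H) l z : u @ \oo --> l ->
  `|z - u n| @[n --> \oo] --> `|z - l|.
Proof. by move=> ul; apply: cvg_norm; apply: cvgB => //; exact: cvg_cst. Qed.

(** Near minimisers of the distance to [z] form a Cauchy sequence by the parallelogram law; the
    obtuse angle comes from moving slightly from [p] towards [y]. *)
Lemma proj_closed_convex (S : set H) z :
  S !=set0 -> closed S -> convex_subset S ->
  exists2 p, S p & forall y, S y -> ip (z - p) (y - p) <= 0.
Proof.
move=> S0 cS vS; have [s0 Ss0] := S0.
have half a b : S a -> S b -> S (2^-1 *: (a + b)).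
  move=> Sa Sb; have := vS a b 2^-1 Sa Sb.
  rewrite (_ : 1 - 2^-1 = 2^-1 :> R); last by field.
  by rewrite scalerDr; apply; apply/andP; split; lra.
(* The truncation provides the upper bound on [Q] that [near_minimal_cauchy] asks for; points
   outside it are farther from [z] than [p] anyway. *)
pose S' : set H := S `&` [set y | `|z - y| <= `|z - s0| + 1].
have half' a b : S' a -> S' b -> S' (2^-1 *: (a + b)).
  move=> [Sa a1] [Sb b1]; split; first exact: half.
  rewrite /=; have -> : z - 2^-1 *: (a + b) = 2^-1 *: (z - a) + 2^-1 *: (z - b).
    rewrite !scalerBr scalerDr addrACA -scalerDl.
    rewrite (_ : 2^-1 + 2^-1 = 1 :> R); last by field.
    by rewrite scale1r opprD.
  rewrite (le_trans (ler_normD _ _))// !normrZ ger0_norm; last by lra.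
  move: a1 b1 => /=; lra.
have [] := near_minimal_cauchy (E := fun=> S') (Q := fun y => `|z - y| ^+ 2)
  (mid := fun a b => 2^-1 *: (a + b)) (D := fun a b => `|a - b| ^+ 2)
  (M := (`|z - s0| + 1) ^+ 2).
- by move=> _; exists s0; split => //=; rewrite lerDl.
- by move=> m k _ y.
- by move=> _; exact: half'.
- move=> a [Sa a1]; by rewrite sqr_ge0/= ler_sqr ?nnegrE ?addr_ge0.
- by move=> a b _ _; rewrite (midpoint_normsq a b z).
move=> u [uS uQ uD].
have cu : cvgn u.
  apply: cauchy_seq_cvg => e e0.
  have [|N NP] := uD (e ^+ 2); first by rewrite exprn_gt0.
  exists N => m k mN kN; have := NP m k mN kN.
  by rewrite ler_sqr ?nnegrE// ltW.
pose p := lim (u @ \oo).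
have up : u @ \oo --> p by [].
have Sp : S p by apply: closed_seq_lim up => // n; case: (uS n).
have pmin y : S y -> `|z - p| ^+ 2 <= `|z - y| ^+ 2.
  move=> Sy; have [yz|yz] := leP `|z - y| (`|z - s0| + 1); last first.
    have : `|z - p| <= `|z - s0| + 1.
      by apply: (cvgn_le (cvg_normB (z := z) up)) => n; case: (uS n).
    move=> h; rewrite ler_sqr ?nnegrE//; apply: (le_trans h); exact: ltW.
  have l1 : `|z - u n| ^+ 2 @[n --> \oo] --> `|z - p| ^+ 2.
    have hl := cvg_normB (z := z) up.
    by rewrite expr2; under eq_fun do rewrite expr2; exact: (cvgM hl hl).
  have l2 : `|z - y| ^+ 2 + n.+1%:R^-1 @[n --> \oo] --> `|z - y| ^+ 2 + 0.
    by apply: cvgD; [exact: cvg_cst|exact: cvg_harmonic].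
  rewrite -[leRHS]addr0 -subr_ge0; apply: (cvgn_ge (cvgB l2 l1)) => n.
  by rewrite /= subr_ge0; exact: uQ.
exists p => // y Sy.
apply/ler_addgt0Pr => e e0; rewrite add0r.
have [->|yp] := eqVneq y p; first by rewrite subrr ip0r ltW.
have nyp : 0 < `|y - p| ^+ 2 by rewrite exprn_gt0// normr_gt0 subr_eq0.
(* Minimality at [p + l (y - p)] bounds twice the inner product by [l |y - p|^2], which this [l]
   keeps below [e]. *)
pose l : R := Num.min 1 (e / `|y - p| ^+ 2).
have l0 : 0 < l by rewrite lt_min ltr01 divr_gt0.
have l1 : l <= 1 by rewrite ge_min lexx.
have le2 : l * `|y - p| ^+ 2 <= e.
  by rewrite -ler_pdivlMr// ge_min lexx orbT.
have Sl : S (p + l *: (y - p)).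
  have := vS y p l Sy Sp; rewrite (ltW l0) l1 => /(_ isT).
  by rewrite scalerBl scale1r scalerBr addrCA.
have := pmin _ Sl; rewrite opprD addrA (normsqB (z - p)) ipZr normrZ (gtr0_norm l0) exprMn.
have -> : `|z - p| ^+ 2 - 2 * (l * ip (z - p) (y - p)) + l ^+ 2 * `|y - p| ^+ 2
  = `|z - p| ^+ 2 + l * (l * `|y - p| ^+ 2 - 2 * ip (z - p) (y - p)) by ring.
rewrite lerDl pmulr_rge0// subr_ge0; lra.
Qed.

(** The point [p] of least norm in the hyperplane [phi = 1] is orthogonal to the kernel, because the
    obtuse angle inequality can be tested along both [z] and [-z]; it then only needs rescaling. *)
Lemma riesz (phi : H -> R) (M : R) :
  (forall a x y, phi (a *: x + y) = a * phi x + phi y) ->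
  (forall x, `|phi x| <= M * `|x|) ->
  exists p, forall e, ip p e = phi e.
Proof.
move=> lphi bphi.
have phi0 : phi 0 = 0.
  by have := lphi (-1) 0 0; rewrite scaler0 addr0 mulN1r addNr.
have phiZ a x : phi (a *: x) = a * phi x.
  by have := lphi a x 0; rewrite !addr0 phi0 addr0.
have phiD x y : phi (x + y) = phi x + phi y.
  by have := lphi 1 x y; rewrite scale1r mul1r.
have phiN x : phi (- x) = - phi x by rewrite -scaleN1r phiZ mulN1r.
have [phiz|] := pselect (forall e, phi e = 0).
  by exists 0 => e; rewrite ip0l phiz.
move=> /existsNP[e /eqP e0].
pose S : set H := [set y | phi y = 1].
have S0 : S !=set0 by exists ((phi e)^-1 *: e); rewrite /S /= phiZ mulVf.
have cphi : continuous phi.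
  move=> x; apply/cvgrPdist_lt => eps eps0.
  have M1 : 0 < `|M| + 1 by rewrite ltr_pwDr.
  apply/nbhs_ballP; exists (eps / (`|M| + 1)) => /=; first by rewrite divr_gt0.
  move=> y; rewrite -ball_normE /= ltr_pdivlMr//.
  rewrite -phiN -phiD; apply: le_lt_trans; apply: (le_trans (bphi _)).
  rewrite mulrC ler_wpM2l//; apply: (le_trans (ler_norm _)); by rewrite lerDl.
have cS : closed S.
  have -> : S = phi @^-1` [set 1] by [].
  by apply: preimage_closed; [move=> x _; exact: cphi|exact: closed_eq].
have vS : convex_subset S.
  by move=> a b l Sa Sb _; rewrite /S /= phiD !phiZ Sa Sb; ring.
have [p Sp pP] := proj_closed_convex 0 S0 cS vS.
have pker z : phi z = 0 -> ip p z = 0.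
  move=> z0.
  have Sz (c : R) : S (p + c *: z) by rewrite /S /= phiD phiZ z0 Sp; ring.
  have := pP _ (Sz 1); have := pP _ (Sz (-1)).
  rewrite !(addrC p) !addrK !sub0r !ipNl !ipZr; lra.
have p0 : p != 0.
  by apply/eqP => p0; move: Sp; rewrite /S /= p0 phi0 => /eqP; rewrite eq_sym oner_eq0.
have ipp0 : ip p p != 0 by rewrite ipxx sqrf_eq0 normr_eq0.
exists ((ip p p)^-1 *: p) => z.
have : ip p (z - phi z *: p) = 0.
  by apply: pker; rewrite phiD phiN phiZ Sp; ring.
rewrite ipBr ipZr => /eqP; rewrite subr_eq0 => /eqP h.
by rewrite ipZl h mulrCA mulVf// mulr1.
Qed.

(** The constant sequence [x] with steps [1/(n+1)] is allowed in the definition of a tangent vector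
    [h]; the points [x + t_n h_n] lie in [S], and dividing the Fréchet inequality by [t_n] leaves an
    estimate on [ip v h]. *)
Lemma frechet_clarke_normal (S : set H) x v : S x ->
  (forall eps, 0 < eps -> exists2 delta, 0 < delta &
     forall y, S y -> `|y - x| < delta -> ip v (y - x) <= eps * `|y - x|) ->
  clarke_normal ip S x v.
Proof.
move=> Sx hv; split => // h /(_ (fun=> x) (fun n => n.+1%:R^-1)) [] //.
- exact: cvg_cst.
- exact: cvg_harmonic.
move=> hn [hnh Shn].
apply/ler_addgt0Pr => e e0; rewrite add0r.
have N1 : 0 < `|h| + 1 by rewrite ltr_pwDr.
have N2 : 0 < `|v| + 1 by rewrite ltr_pwDr.
have [|d d0 dP] := hv (e / 2 / (`|h| + 1)); first by rewrite !divr_gt0.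
have [n []] : exists n : nat, `|h - hn n| < Num.min 1 (e / 2 / (`|v| + 1)) /\
   n.+1%:R^-1 < d / (`|h| + 1).
  near \oo => n; exists n; split; near: n.
    by move/cvgrPdist_lt : hnh; apply; rewrite lt_min ltr01 !divr_gt0.
  exact: (near_infty_natSinv_lt (PosNum (divr_gt0 d0 N1))).
rewrite lt_min => /andP[hn1 hn2] nd.
have hnn : `|hn n| <= `|h| + 1.
  rewrite -[hn n](subrKC h) (le_trans (ler_normD _ _))// lerD2l distrC.
  exact: ltW.
have n0 : 0 < n.+1%:R^-1 :> R by [].
have := dP _ (Shn n); rewrite addrC addKr => h1.
rewrite normrZ gtr0_norm// in h1.
have /h1 : n.+1%:R^-1 * `|hn n| < d.
  rewrite ltr_pdivlMr// in nd; apply: le_lt_trans nd.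
  by rewrite ler_pM2l.
rewrite ipZr mulrCA ler_pM2l// => h2.
have -> : ip v h = ip v (hn n) + ip v (h - hn n) by rewrite ipBr; ring.
rewrite (_ : e = e / 2 + e / 2); last by field.
apply: lerD.
  by apply: (le_trans h2); rewrite mulrAC ler_pdivrMr// ler_pM2l// divr_gt0.
apply: (le_trans (ip_le_norm _ _)).
rewrite ltr_pdivlMr// in hn2; apply: le_trans (ltW hn2).
by rewrite mulrC ler_wpM2l// lerDl.
Unshelve. all: by end_near. Qed.

(** Expanding the squared distances gives [2 ip (z - p) (y - p) <= |y - p|^2], which is of smaller
    order than [|y - p|]. *)
Lemma nearest_clarke_normal (S : set H) z p : S p ->
  (forall y, S y -> `|z - p| <= `|z - y|) -> clarke_normal ip S p (z - p).
Proof.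
move=> Sp pP; apply: frechet_clarke_normal => // e e0; exists e => // y Sy ye.
have := pP y Sy; rewrite -ler_sqr ?nnegrE//.
have -> : z - y = (z - p) - (y - p) by rewrite opprB addrA subrK.
rewrite (normsqB (z - p)) => h.
have h2 : `|y - p| ^+ 2 <= e * `|y - p| by rewrite expr2 ler_wpM2r// ltW.
have := sqr_ge0 `|y - p|; lra.
Qed.

End Hilbert.

(** * Density of the variation of an absolutely continuous function *)

Section AbsCont.
Context {R : realType}.
Variables (T : R) (zeta : R -> R).
Hypothesis T0 : 0 < T.
Hypothesis acz : abs_cont 0 T zeta.

Definition nonoverlapping (p q : R * R) := (p.2 <= q.1) || (q.2 <= p.1).

(** Lists replace the numbered families of [abs_cont], so that an interval can be replaced by its
    pieces with a mere cons. *)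
Definition itv_family (P : seq (R * R)) :=
  all (fun p => [&& 0 <= p.1, p.1 <= p.2 & p.2 <= T]) P && pairwise nonoverlapping P.

Lemma abs_cont_family (eps : R) : 0 < eps -> exists2 delta : R, 0 < delta &
  forall P, itv_family P -> \sum_(p <- P) (p.2 - p.1) < delta ->
    \sum_(p <- P) `|zeta p.2 - zeta p.1| < eps.
Proof.
move=> e0; have [d d0 dP] := acz e0; exists d => // P /andP[/allP aP /pairwiseP pP].
rewrite !(big_nth (0, 0)) !big_mkord => sP.
apply: (dP (size P) (fun i => (nth (0, 0) P i).1) (fun i => (nth (0, 0) P i).2)) => //.
- by move=> i iP; have /and3P[] := aP _ (mem_nth (0, 0) iP).
- move=> i j iP jP ij.
  have h k l : (k < size P)%N -> (l < size P)%N -> (k < l)%N ->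
     nonoverlapping (nth (0, 0) P k) (nth (0, 0) P l).
    by move=> kP lP kl; apply: (pP (0, 0)).
  case: (ltngtP i j) => // ij'.
  + by have /orP[] := h _ _ iP jP ij'; [left|right].
  + by have /orP[] := h _ _ jP iP ij'; [right|left].
Qed.

Lemma family_split (a x b : R) (P : seq (R * R)) : a <= x -> x <= b ->
  itv_family ((a, b) :: P) -> itv_family ((x, b) :: (a, x) :: P).
Proof.
move=> ax xb; rewrite /itv_family /= => /andP[/andP[/and3P[a0 ab bT] aP] /andP[nP pP]].
rewrite a0 ax xb bT (le_trans a0 ax) (le_trans xb bT) aP pP /= andbT.
rewrite /nonoverlapping /= lexx orbT /=; apply/andP; split; apply/allP => q qP;
  have /orP[/= h|/= h] := allP nP q qP.
- by rewrite h.
- by rewrite (le_trans h ax) orbT.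
- by rewrite (le_trans xb h).
- by rewrite h orbT.
Qed.

Lemma family_behead p P : itv_family (p :: P) -> itv_family P.
Proof. by rewrite /itv_family /= => /andP[/andP[_ ->] /andP[_ ->]]. Qed.

(** Peels the partition [s] of [[a, b]] point by point and moves each piece to [P]. Cutting does not
    change the total length, so the hypothesis stays available. In the application [K] is the sum of
    the total variations over [Q]. *)
Lemma variation_family (K : \bar R) (delta : R) (Q : seq (R * R)) (eps : \bar R) :
  (forall P, itv_family (P ++ Q) -> \sum_(p <- P ++ Q) (p.2 - p.1) < delta ->
     ((\sum_(p <- P) `|zeta p.2 - zeta p.1|)%:E + K <= eps)%E) ->
  forall s a b P, itv_partition a b s -> itv_family ((a, b) :: P ++ Q) ->
    \sum_(p <- (a, b) :: P ++ Q) (p.2 - p.1) < delta ->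
    ((variation a b zeta s + \sum_(p <- P) `|zeta p.2 - zeta p.1|)%:E + K <= eps)%E.
Proof.
move=> h; elim=> [|x s IH] a b P.
  move=> /itv_partition_nil <- /family_behead fP; rewrite big_cons subrr add0r => sP.
  by rewrite variation_nil add0r; exact: h.
move=> ps; have ax : a < x by case: ps => /= /andP[].
have pxs := itv_partition_cons ps; have xb := itv_partition_le pxs.
move=> /(family_split (ltW ax) xb) fP sP.
have -> : variation a b zeta (x :: s) = `|zeta x - zeta a| + variation x b zeta s.
  rewrite (@variation_cat _ x a b zeta [:: x] s) ?(ltW ax)//; last exact: itv_partition1.
  by rewrite /variation /= big_nat1.
have := IH x b ((a, x) :: P) pxs fP; rewrite !big_cons /= => IH'.
rewrite -[X in X%:E]addrA addrCA; apply: IH'.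
by move: sP; rewrite !big_cons /=; lra.
Qed.

(** The [delta] of absolute continuity still works when increments become total variations: the
    suprema over subdivisions are taken one interval after the other, by induction on [Q], with [P]
    collecting the intervals already cut. *)
Lemma abs_cont_total_variation (eps : R) : 0 < eps -> exists2 delta : R, 0 < delta &
  forall Q, itv_family Q -> \sum_(p <- Q) (p.2 - p.1) < delta ->
    (\sum_(p <- Q) total_variation p.1 p.2 zeta <= eps%:E)%E.
Proof.
move=> /abs_cont_family[d d0 dP]; exists d => // Q fQ sQ.
suff : forall P, itv_family (P ++ Q) -> \sum_(p <- P ++ Q) (p.2 - p.1) < d ->
   ((\sum_(p <- P) `|zeta p.2 - zeta p.1|)%:E +
     \sum_(p <- Q) total_variation p.1 p.2 zeta <= eps%:E)%E.
  by move=> /(_ [::] fQ sQ); rewrite big_nil add0e.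
elim: Q {fQ sQ} => [|[a b] Q IH] P.
  by rewrite cats0 => fP sP; rewrite big_nil adde0 lee_fin ltW// dP.
rewrite big_cons /= => fP sP.
have pfP : perm_eq (P ++ (a, b) :: Q) ((a, b) :: P ++ Q).
  by rewrite -cat1s perm_catCA.
have fPQ : itv_family ((a, b) :: P ++ Q).
  move: fP; rewrite /itv_family /= !all_cat /= !pairwise_cat /= allrel_consr.
  move=> /andP[/and3P[-> -> ->] /and3P[/andP[/allP h1 ->] -> /andP[-> ->]]].
  by rewrite !andbT; apply/allP => q /h1; rewrite /nonoverlapping orbC.
have ab : a <= b.
  by have := fPQ; rewrite /itv_family /= => /andP[/andP[/and3P[]]].
set S := (\sum_(p <- Q) _)%E in IH *.
have Sge0 : (0 <= S)%E.
  rewrite /S big_seq; apply: sume_ge0 => p pQ; apply: total_variation_ge0.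
  by have := fP; rewrite /itv_family all_cat /= => /andP[/and3P[_ _ /allP /(_ _ pQ) /and3P[]]].
have sPQ : \sum_(p <- (a, b) :: P ++ Q) (p.2 - p.1) < d by rewrite -(perm_big _ pfP).
(* Finiteness, read off the induction hypothesis, allows [S] to be subtracted before the supremum
   over partitions is taken. *)
have Sfin : S \is a fin_num.
  rewrite ge0_fin_numE//; apply: (@le_lt_trans _ _ eps%:E); last exact: ltry.
  apply: le_trans (IH P (family_behead fPQ) _); first by rewrite leeDr// lee_fin sumr_ge0.
  by move: sPQ; rewrite big_cons /=; lra.
rewrite addeCA -leeBrDr; last by rewrite fin_numD Sfin.
apply: ge_ereal_sup => _ [_ [s ps <-] <-].
rewrite leeBrDr; last by rewrite fin_numD Sfin.
rewrite addeA -EFinD.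
exact: (@variation_family S d Q).
Qed.

End AbsCont.

(** * Dyadic cells exhausting an open set *)

Section DyadicCells.
Context {R : realType}.
Variable T : R.
Hypothesis T0 : 0 < T.

Definition dyadic (n k : nat) : R := T * k%:R / (2 ^ n)%:R.
(** Open on the left and closed on the right: the cells of one level tile []0, T]], and a Stieltjes
    measure is explicit on them. *)
Definition cell (n k : nat) : set R := `]dyadic n k, dyadic n k.+1]%classic.

Let p2 n : (0 : R) < (2 ^ n)%:R. Proof. by rewrite ltr0n expn_gt0. Qed.

Lemma dyadic_le n k l : (k <= l)%N -> dyadic n k <= dyadic n l.
Proof.
by move=> kl; rewrite /dyadic ler_pM2r ?invr_gt0// ler_pM2l// ler_nat.
Qed.

Lemma dyadic0 n : dyadic n 0 = 0. Proof. by rewrite /dyadic mulr0 mul0r. Qed.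
Lemma dyadic_end n : dyadic n (2 ^ n) = T.
Proof. by rewrite /dyadic mulfK// gt_eqF. Qed.
Lemma dyadic_ge0 n k : 0 <= dyadic n k. Proof. by rewrite -(dyadic0 n) dyadic_le. Qed.
Lemma dyadicS n k : dyadic n.+1 k.*2 = dyadic n k.
Proof.
rewrite /dyadic expnS natrM -muln2 natrM; field.
by have := p2 n; rewrite gt_eqF.
Qed.

Lemma cell_refine n k x : (k < 2 ^ n)%N -> cell n k x ->
  exists l, [/\ (l < 2 ^ n.+1)%N, cell n.+1 l x & cell n.+1 l `<=` cell n k].
Proof.
rewrite /cell /= !in_itv /= => kn /andP[h1 h2].
have d1 : dyadic n.+1 k.*2 = dyadic n k by exact: dyadicS.
have d2 : dyadic n.+1 k.*2.+2 = dyadic n k.+1 by rewrite -doubleS dyadicS.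
have [xm|xm] := leP x (dyadic n.+1 k.*2.+1).
- exists k.*2; split.
  + by rewrite expnS mul2n ltn_double.
  + by rewrite /= in_itv /= d1 h1.
  + move=> y; rewrite /= !in_itv /= d1 => /andP[-> y2] /=.
    by apply: (le_trans y2); rewrite -d2 dyadic_le.
- exists k.*2.+1; split.
  + by rewrite expnS mul2n ltn_Sdouble.
  + by rewrite /= in_itv /= d2 xm.
  + move=> y; rewrite /= !in_itv /= d2 => /andP[y1 ->]; rewrite andbT.
    by apply: le_lt_trans y1; rewrite -d1 dyadic_le.
Qed.

Lemma cell_exists n x : 0 < x <= T -> exists2 k, (k < 2 ^ n)%N & cell n k x.
Proof.
move=> x0T; elim: n => [|n [k kn kx]].
  exists 0%N => //; rewrite /cell /= in_itv /= dyadic0.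
  by have := dyadic_end 0; rewrite expn0 => ->.
by have [l [ln lx _]] := cell_refine kn kx; exists l.
Qed.

Lemma cell_small (r : R) : 0 < r -> exists n, forall k, dyadic n k.+1 - dyadic n k < r.
Proof.
move=> r0; exists (Num.bound (T / r)) => k; set n := Num.bound _.
have -> : dyadic n k.+1 - dyadic n k = T / (2 ^ n)%:R.
  by rewrite /dyadic -addn1 natrD; field; have := p2 n; rewrite gt_eqF.
rewrite ltr_pdivrMr// mulrC -ltr_pdivrMr//.
apply: (lt_trans (archi_boundP _)); first by rewrite divr_ge0// ltW.
by rewrite ltr_nat ltn_expl.
Qed.

Definition cells_in (U : set R) (n : nat) : seq nat :=
  [seq k <- iota 0 (2 ^ n) | `[< cell n k `<=` U >]].

Definition cells_union (U : set R) (n : nat) : set R :=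
  \big[setU/set0]_(k <- cells_in U n) cell n k.

Lemma cells_unionP U n x : cells_union U n x <->
  exists k, [/\ (k < 2 ^ n)%N, cell n k x & cell n k `<=` U].
Proof.
rewrite /cells_union -bigcup_seq; split.
  move=> [k /=]; rewrite mem_filter mem_iota /= add0n => /andP[/asboolP ? ?] ?.
  by exists k.
move=> [k [kn kx kU]]; exists k => //=.
by rewrite mem_filter mem_iota /= add0n kn andbT; apply/asboolP.
Qed.

Lemma cells_union_nd U : nondecreasing_seq (cells_union U).
Proof.
apply/nondecreasing_seqP => n; apply/subsetPset => x /cells_unionP[k [kn kx kU]].
have [l [ln lx lk]] := cell_refine kn kx.
by apply/cells_unionP; exists l; split => //; exact: subset_trans kU.
Qed.

(** Around a point of [U] lies a ball inside [U], and at a fine enough level the cell of that point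
    is shorter than its radius. *)
Lemma cells_union_open U : open U -> U `&` `]0, T]%classic `<=` \bigcup_n cells_union U n.
Proof.
move=> oU x [Ux]; rewrite /= in_itv /= => x0T.
have /nbhs_ballP[r /= r0 rU] : nbhs x U by exact: open_nbhs_nbhs.
have [n nr] := cell_small r0; exists n => //; apply/cells_unionP.
have [k kn kx] := cell_exists n x0T; exists k; split => // y.
move: kx; rewrite /cell /= !in_itv /= => /andP[x1 x2] /andP[y1 y2]; apply: rU.
rewrite -ball_normE /= ltr_norml; have := nr k; lra.
Qed.

Lemma measurable_cell n k : measurable (cell n k : set (measurableTypeR R)).
Proof. exact: measurable_itv. Qed.

Lemma measurable_cells_union U n : measurable (cells_union U n : set (measurableTypeR R)).
Proof. by rewrite /cells_union; apply: bigsetU_measurable => k _; exact: measurable_cell. Qed.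

Lemma cells_sorted U n : pairwise ltn (cells_in U n).
Proof.
rewrite -(sorted_pairwise ltn_trans); apply: (sorted_filter ltn_trans).
exact: iota_ltn_sorted.
Qed.

Lemma cells_family U n : itv_family T [seq (dyadic n k, dyadic n k.+1) | k <- cells_in U n].
Proof.
rewrite /itv_family all_map pairwise_map; apply/andP; split.
  apply/allP => k; rewrite mem_filter mem_iota /= add0n => /andP[_ kn].
  by rewrite dyadic_ge0 dyadic_le//= -(dyadic_end n) dyadic_le.
apply: sub_pairwise (cells_sorted U n) => k l /= kl.
by rewrite /nonoverlapping /= dyadic_le.
Qed.

Lemma lebesgue_cell n k :
  lebesgue_measure (cell n k : set (measurableTypeR R)) = (dyadic n k.+1 - dyadic n k)%:E.
Proof.
rewrite /cell lebesgue_measure_itv /= lte_fin ifT ?EFinB//.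
by rewrite /dyadic ltr_pM2r ?invr_gt0// ltr_pM2l// ltr_nat.
Qed.

Lemma cells_length (U : set (measurableTypeR R)) n : measurable U ->
  ((\sum_(k <- cells_in U n) (dyadic n k.+1 - dyadic n k))%:E <= lebesgue_measure U)%E.
Proof.
move=> mU.
suff -> : (\sum_(k <- cells_in U n) (dyadic n k.+1 - dyadic n k))%:E =
    lebesgue_measure (cells_union U n : set (measurableTypeR R)).
  apply: le_measure; rewrite ?inE//; first exact: measurable_cells_union.
  by move=> x /cells_unionP[k [_ kx]]; apply.
rewrite /cells_union; have := cells_sorted U n.
elim: (cells_in U n) => [|k L IH] /=; first by rewrite !big_nil measure0.
move=> /andP[kL pL]; rewrite !big_cons EFinD (IH pL) measureU//.
- by rewrite -lebesgue_cell.
- exact: measurable_cell.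
- by apply: bigsetU_measurable => j _; exact: measurable_cell.
- rewrite -bigcup_seq; apply/seteqP; split => // x [kx [l lL lx]].
  have kl := allP kL _ lL.
  move: kx lx; rewrite /cell /= !in_itv /= => /andP[_ x2] /andP[x3 _].
  by have := lt_le_trans x3 x2; rewrite ltNge dyadic_le.
Qed.

End DyadicCells.

(** * Radon-Nikodym density of the variation *)

Section VariationDensity.
Context {R : realType}.
Variables (T : R) (zeta : R -> R).
Hypothesis T0 : 0 < T.
Hypothesis acz : abs_cont 0 T zeta.
Local Notation clip := (clip T).

Local Notation mu := (@lebesgue_measure R).
Local Notation TV a b := (total_variation a b zeta).

Lemma abs_cont_variation_itv (eps : R) : 0 < eps -> exists2 delta : R, 0 < delta &
  forall a b, 0 <= a -> a <= b -> b <= T -> b - a < delta -> (TV a b <= eps%:E)%E.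
Proof.
move=> /(abs_cont_total_variation acz)[d d0 dP]; exists d => // a b a0 ab bT abd.
have := dP [:: (a, b)]; rewrite !big_cons !big_nil /= addr0 adde0; apply => //.
by rewrite /itv_family /= a0 ab bT.
Qed.

(** Induction on the number of steps of length [d / 2]; each is strictly shorter than [d], so it
    adds at most 1 to the variation. *)
Lemma abs_cont_variation_lty t : 0 <= t <= T -> (TV 0 t < +oo)%E.
Proof.
have [d d0 dP] := abs_cont_variation_itv ltr01.
move=> tT; have [n nt] : exists n : nat, t <= n%:R * (d / 2).
  exists (Num.bound (t / (d / 2))); rewrite -ler_pdivrMr ?divr_gt0//.
  by apply/ltW/archi_boundP; rewrite divr_ge0 ?divr_ge0 ?(ltW d0)//; case/andP: tT.
elim: n t tT nt => [|n IH] t /andP[t0 tT] nt.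
  have -> : t = 0 by apply/eqP; rewrite eq_le t0 andbT (le_trans nt)// mul0r.
  by rewrite total_variationxx.
have [tn|tn] := leP t (n%:R * (d / 2)); first by apply: IH => //; rewrite t0.
have n0 : 0 <= n%:R * (d / 2) by rewrite mulr_ge0// divr_ge0// ltW.
rewrite (total_variationD zeta n0 (ltW tn)); apply: lte_add_pinfty.
  by apply: IH => //; rewrite n0 (le_trans (ltW tn)).
apply: (@le_lt_trans _ _ 1%:E); last exact: ltry.
apply: dP => //; first exact: ltW.
move: nt; rewrite -natr1 mulrDl mul1r => nt.
by apply: (@le_lt_trans _ _ (d / 2)); [rewrite lerBlDl|rewrite ltr_pdivrMr// ltr_pMr// ltr1n].
Qed.

Definition variation_fun t := fine (TV 0 (clip t)).

Let TVfin t : TV 0 (clip t) \is a fin_num.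
Proof.
have /andP[t0 tT] := clipP T0 t.
rewrite ge0_fin_numE ?total_variation_ge0//.
by apply: abs_cont_variation_lty; rewrite t0.
Qed.

Lemma variation_funB s t : s <= t ->
  (TV (clip s) (clip t) = (variation_fun t - variation_fun s)%:E)%E.
Proof.
move=> st; have /andP[s0 sT] := clipP T0 s.
rewrite EFinB /variation_fun !fineK// (total_variationD zeta s0 (clip_nd T st)).
by rewrite addeAC subee// add0e.
Qed.

Lemma variation_fun_nd : nondecreasing variation_fun.
Proof.
move=> s t st; rewrite -subr_ge0 -lee_fin -variation_funB//.
exact/total_variation_ge0/clip_nd.
Qed.

Lemma variation_fun_continuous : continuous variation_fun.
Proof.
move=> x; apply/cvgrPdist_le => e e0.
have [d d0 dP] := abs_cont_variation_itv e0.
have aux s t : s <= t -> t - s < d -> `|variation_fun t - variation_fun s| <= e.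
  move=> st std; rewrite ger0_norm ?subr_ge0; last exact: variation_fun_nd.
  rewrite -lee_fin -variation_funB//; apply: dP.
  - by case/andP: (clipP T0 s).
  - exact: clip_nd.
  - by case/andP: (clipP T0 t).
  - exact: le_lt_trans (clip_lip T st) std.
apply/nbhs_ballP; exists d => // y; rewrite /ball_ /= ltr_norml => /andP[h1 h2].
have [xy|xy] := leP x y; last by apply: aux; lra.
by rewrite distrC; apply: aux => //; lra.
Qed.

(** The density is that of the Stieltjes measure of the variation function with respect to Lebesgue
    measure; an increment of [zeta] is at most its variation, which is the integral of the
    density. *)
Lemma abs_cont_density : exists z : R -> R,
  [/\ forall t, 0 <= z t, mu.-integrable setT (EFin \o z) &
   forall s t, 0 <= s -> s <= t -> t <= T ->
     `|zeta t - zeta s| <= (\int[mu]_(r in `[s, t]) z r)%R].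
Proof.
pose V : cumulative R R := HB.pack_for (cumulative R R) variation_fun
  (isCumulative.Build R _ R variation_fun variation_fun_nd
     (right_continuousW variation_fun_continuous)).
pose nu := lebesgue_stieltjes_measure V.
have nuE a b : a <= b -> nu `]a, b]%classic = (variation_fun b - variation_fun a)%:E.
  move=> ab; rewrite /nu /lebesgue_stieltjes_measure /measure_extension.
  by rewrite measurable_mu_extE /= ?wlength_itv_bnd//; exact: is_ocitv.
have mD : measurable (`]0, T]%classic : set (measurableTypeR R)) by exact: measurable_itv.
have nuD : (nu `]0%R, T]%classic < +oo)%E by rewrite nuE ?ltry// ltW.
(* Restriction to []0, T]] gives a finite measure, so that the density is integrable over the whole
   line. *)
pose nu' := mfrestr mD nuD.
(* A null set is enclosed in an open [U] of measure below [d]. Finitely many dyadic cells inside [U]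
   have total length below [d], hence total variation at most [e], and increasing unions of such
   cells fill [U] within []0, T]]. *)
have nu_mu : nu' `<< mu.
  apply/null_content_dominatesP => A mA A0; rewrite /nu' /mfrestr /mrestr.
  apply/eqP; rewrite eq_le measure_ge0 andbT; apply/lee_addgt0Pr => e e0; rewrite add0e.
  have [d d0 dP] := abs_cont_total_variation acz e0.
  have muA : (mu A < +oo)%E by rewrite [mu A]A0.
  have [U [oU AU UA]] := lebesgue_regularity_outer mA muA d0.
  have mU : measurable (U : set (measurableTypeR R)) by exact: measurable_realfun.open_measurable.
  have muU : (mu U < d%:E)%E.
    have UAm : measurable (U `\` A : set (measurableTypeR R)) by exact: measurableD.
    apply: le_lt_trans UA; rewrite -[leRHS]adde0 -[X in (_ + X)%E]A0.
    apply: le_trans (measureU2 _ UAm mA); apply: le_measure; rewrite ?inE//.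
      exact: measurableU.
    by move=> x Ux; have [Ax|Ax] := pselect (A x); [right|left].
  apply: (@le_trans _ _ (nu (\bigcup_n cells_union T U n))).
    apply: le_measure; rewrite ?inE//; first exact: measurableI.
      by apply: bigcupT_measurable => n; exact: measurable_cells_union.
    move=> x [Ax Dx]; apply: (cells_union_open T0 oU); split => //; exact: AU.
  have := @nondecreasing_cvg_mu _ _ _ nu (cells_union T U) _ _ (cells_union_nd T0 U).
  move=> /(_ (measurable_cells_union T U)) /(_ (bigcupT_measurable _ (measurable_cells_union T U))).
  move=> nu_cvg; apply: (cvge_to_le nu_cvg).
  apply: nearW => n /=.
  apply: le_trans (dP _ (cells_family T0 U n) _); last first.
    rewrite big_map /= -lte_fin; exact: le_lt_trans (cells_length T0 n mU) muU.
  rewrite big_map /cells_union /=.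
  have : {subset cells_in T U n <= iota 0 (2 ^ n)} by exact: mem_subseq (filter_subseq _ _).
  elim: (cells_in T U n) => [_|k L IH kL]; first by rewrite !big_nil measure0.
  rewrite !big_cons; apply: (le_trans (measureU2 _ _ _)).
  - exact: measurable_cell.
  - by apply: bigsetU_measurable => j _; exact: measurable_cell.
  apply: leeD; last by apply: IH => j jL; apply: kL; rewrite inE jL orbT.
  have kn : (k < 2 ^ n)%N by have := kL k; rewrite inE eqxx mem_iota => /(_ isT).
  have dk := dyadic_le T0 n (leqnSn k).
  have dT l : (l <= 2 ^ n)%N -> 0 <= dyadic T n l <= T.
    by move=> ln; rewrite dyadic_ge0//= -[leRHS](dyadic_end T n) dyadic_le.
  by rewrite [leLHS](nuE _ _ dk) -variation_funB// !clip_id ?dT//; exact: ltnW.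
have [f [f0 ffin fi nuf]] := radon_nikodym_sigma_finite nu_mu.
exists (fine \o f); split.
- by move=> t; exact: fine_ge0.
- by apply: eq_integrable fi => // x _ /=; rewrite fineK.
move=> s t s0 st tT.
have e1 : (mu.-integrable `]s, t] f)%E by apply: integrableS fi.
rewrite -lee_fin /Rintegral fineK; last first.
  by apply: integrable_fin_num => //; apply: eq_integrable (integrableS _ _ _ fi) => // x _ /=; rewrite fineK.
under eq_integral do rewrite fineK//.
rewrite -integral_itv_obnd_cbnd; last exact: (measurable_int mu e1).
have -> : (\int[mu]_(x in `]s, t]) f x)%E = nu (`]s, t]%classic `&` `]0, T]%classic).
  by rewrite -nuf//; exact: measurable_itv.
rewrite setIidl; last first.
  by move=> x; rewrite /= !in_itv /= => /andP[h1 h2]; rewrite (le_lt_trans s0 h1) (le_trans h2).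
rewrite nuE// -variation_funB// !clip_id ?s0 ?tT ?(le_trans s0)//; last exact: le_trans tT.
exact: total_variation_ge.
Qed.

End VariationDensity.

(** * Measurability by countable case distinction *)

Lemma measurable_fun_gt d (T : measurableType d) (R : realType) (f : T -> R) :
  (forall y, measurable [set t | y < f t]) -> measurable_fun setT f.
Proof.
move=> h; apply: (measurability _ (RGenOInfty.measurableE R)) => //.
move=> _ [_ [y ->] <-]; rewrite setTI; move: (h y); congr measurable.
by apply/seteqP; split => t /=; rewrite in_itv /= andbT.
Qed.

Lemma measurable_lt_fun d (T : measurableType d) (R : realType) (f g : T -> R) :
  measurable_fun setT f -> measurable_fun setT g -> measurable [set t | f t < g t].
Proof.
move=> mf mg; have /(_ measurableT [set true]) := measurable_fun_ltr mf mg.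
by rewrite setTI; apply.
Qed.

Lemma measurable_le_fun d (T : measurableType d) (R : realType) (f g : T -> R) :
  measurable_fun setT f -> measurable_fun setT g -> measurable [set t | f t <= g t].
Proof.
move=> mf mg; have /(_ measurableT [set true]) := measurable_fun_ler mf mg.
by rewrite setTI; apply.
Qed.

Lemma measurable_glue d (T : measurableType d) d' (U : measurableType d')
    (idx : T -> nat) (f : nat -> T -> U) :
  (forall i, measurable [set t | idx t = i]) ->
  (forall i, measurable_fun setT (f i)) ->
  measurable_fun setT (fun t => f (idx t) t).
Proof.
move=> midx mf _ A mA; rewrite setTI.
have -> : (fun t => f (idx t) t) @^-1` A =
    \bigcup_i ([set t | idx t = i] `&` (f i @^-1` A)).
  apply/seteqP; split => t /=; first by exists (idx t).
  by move=> [i _ [/= <-]].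
apply: bigcupT_measurable => i; apply: measurableI => //.
by have := mf i measurableT A mA; rewrite setTI.
Qed.

(** Taking the least index that works makes the choice measurable: its level sets are Boolean
    combinations of the sets [P n]. *)
Definition first_index (T : Type) (P : nat -> set T) (t : T) : nat :=
  xget 0%N [set n | P n t /\ forall k, (k < n)%N -> ~ P k t].

Lemma first_indexP (T : Type) (P : nat -> set T) (t : T) :
  (exists n, P n t) ->
  P (first_index P t) t /\ forall k, (k < first_index P t)%N -> ~ P k t.
Proof.
move=> [n Pn]; rewrite /first_index; case: xgetP => [m -> //|].
have ex : exists n, `[< P n t >] by exists n; apply/asboolP.
move=> /(_ (ex_minn ex)) []; case: ex_minnP => m /asboolP Pm mP; split => // k km Pk.
by have := mP k (asboolT Pk); rewrite leqNgt km.
Qed.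

Lemma measurable_first_index d (T : measurableType d) (P : nat -> set T) i :
  (forall n, measurable (P n)) -> (forall t, exists n, P n t) ->
  measurable [set t | first_index P t = i].
Proof.
move=> mP exP.
have -> : [set t | first_index P t = i] =
    P i `&` \bigcap_(k in [set k | (k < i)%N]) ~` P k.
  apply/seteqP; split => t /=.
    by move=> <-; have [h1 h2] := first_indexP (exP t); split => // k /=; exact: h2.
  move=> [Pi hi]; have [h1 h2] := first_indexP (exP t).
  case: (ltngtP (first_index P t) i) => // h; first by have := hi _ h.
  by have := h2 _ h Pi.
apply: measurableI => //; rewrite bigcap_mkcond; apply: bigcapT_measurable => k.
by case: ifP => _; [exact: measurableC|exact: measurableT].
Qed.

Definition dense_seq (R : realType) (H : normedModType R) (q : nat -> H) :=
  forall x (e : R), 0 < e -> exists n, `|x - q n| < e.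

Lemma separable_dense_seq (R : realType) (H : normedModType R) :
  separable_space (H := H) -> exists q : nat -> H, dense_seq q.
Proof.
move=> [S [/countable_injP[f fi] clS]].
(* Numbers outside the range of the injection [f] receive the value 0; density only asks that every
   point of [S] be reached. *)
exists (fun n => xget 0 [set x | S x /\ f x = n]) => x e e0.
have : closure S x by rewrite clS.
move=> /(_ (ball x e) (nbhsx_ballx x e e0)) [y [Sy]]; rewrite -ball_normE /= => xy.
exists (f y); have [|Sz fz] := @xgetPex _ 0 [set x | S x /\ f x = f y]; first by exists y.
by rewrite (fi _ y _ _ fz) ?inE.
Qed.

(** * Measurability and integration of vector functions *)

Section VectorMeasurability.
Context {R : realType} {H : completeNormedModType R}.
Variable ip : H -> H -> R.
Hypothesis hip : inner_product ip.

(** Weak measurability passes directly through linear operations, gluing and limits; separability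
    recovers norms ([wmeas_norm]) and preimages of open sets ([wmeas_Hmeasurable]). *)
Definition wmeas d (T : measurableType d) (u : T -> H) :=
  forall e, measurable_fun setT (fun t => ip (u t) e).

Section Closure.
Context d (T : measurableType d).
Implicit Types u v : T -> H.

Lemma wmeas_cst (x : H) : wmeas (fun _ : T => x).
Proof. by move=> e; exact: measurable_cst. Qed.

Lemma wmeasD u v : wmeas u -> wmeas v -> wmeas (fun t => u t + v t).
Proof.
move=> mu mv e; under eq_fun do rewrite (ipDl hip); exact: measurable_funD.
Qed.

Lemma wmeasZ (f : T -> R) u : measurable_fun setT f -> wmeas u ->
  wmeas (fun t => f t *: u t).
Proof.
move=> mf mu e; under eq_fun do rewrite (ipZl hip); exact: measurable_funM.
Qed.

Lemma wmeasN u : wmeas u -> wmeas (fun t => - u t).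
Proof.
move=> mu; have := wmeasZ (measurable_cst (-1 : R)) mu.
by under eq_fun do rewrite scaleN1r.
Qed.

Lemma wmeasB u v : wmeas u -> wmeas v -> wmeas (fun t => u t - v t).
Proof. by move=> mu mv; apply: wmeasD => //; exact: wmeasN. Qed.

Lemma wmeas_glue (idx : T -> nat) (u : nat -> T -> H) :
  (forall i, measurable [set t | idx t = i]) -> (forall i, wmeas (u i)) ->
  wmeas (fun t => u (idx t) t).
Proof.
by move=> midx mu e; apply: (measurable_glue (f := fun i t => ip (u i t) e)) => // i; exact: mu.
Qed.

Lemma cvg_ip (x : nat -> H) l e : x @ \oo --> l -> ip (x n) e @[n --> \oo] --> ip l e.
Proof.
move=> xl; apply/cvgrPdist_lt => eps eps0.
have e1 : 0 < `|e| + 1 by rewrite ltr_pwDr.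
have /cvgrPdist_lt/(_ (eps / (`|e| + 1))) := xl; rewrite divr_gt0// => /(_ isT).
apply: filterS => n; rewrite ltr_pdivlMr// => h.
rewrite -(ipBl hip); apply: (le_lt_trans (normr_ip_le hip _ _)); apply: le_lt_trans h.
by rewrite ler_wpM2l// lerDl.
Qed.

Lemma wmeas_cvg (u : nat -> T -> H) v : (forall n, wmeas (u n)) ->
  (forall t, u n t @[n --> \oo] --> v t) -> wmeas v.
Proof.
move=> mu uv e; apply: (measurable_fun_cvg (h := fun n t => ip (u n t) e)) => [n|t _].
  exact: mu.
exact: cvg_ip.
Qed.

(** [|u|^2] is the supremum over [n] of [2 ip u (q n) - |q n|^2], since the defect is [|u - q n|^2];
    this is a countable supremum of measurable functions. *)
Lemma wmeas_norm (q : nat -> H) u : dense_seq q -> wmeas u ->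
  measurable_fun setT (fun t => `|u t|).
Proof.
move=> dq mu; apply: measurable_fun_gt => y.
have [y0|y0] := ltP y 0.
  have -> : [set t | y < `|u t|] = setT; last exact: measurableT.
  by apply/seteqP; split => // t _ /=; exact: lt_le_trans y0 _.
have -> : [set t | y < `|u t|] =
    \bigcup_n [set t | y ^+ 2 < 2 * ip (u t) (q n) - `|q n| ^+ 2].
  apply/seteqP; split => t /=.
    move=> yu; have d0 : 0 < `|u t| ^+ 2 - y ^+ 2.
      by rewrite subr_gt0 ltr_sqr ?nnegrE.
    (* The cap at 1 gives [m^2 <= m], so [|u t - q n| < m] already bounds the square by [m]. *)
    pose m := Num.min 1 (`|u t| ^+ 2 - y ^+ 2).
    have m0 : 0 < m by rewrite lt_min ltr01.
    have [n nq] := dq (u t) m m0; exists n => //=.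
    have := normsqB hip (u t) (q n).
    have m1 : m <= 1 by rewrite ge_min lexx.
    have : `|u t - q n| ^+ 2 < m.
      by rewrite expr2 (lt_le_trans (ltr_pM _ _ nq nq))// -[leRHS]mulr1 ler_pM2l.
    have : m <= `|u t| ^+ 2 - y ^+ 2 by rewrite ge_min lexx orbT.
    lra.
  move=> [n _ /= h]; rewrite -ltr_sqr ?nnegrE//.
  have := sqr_ge0 `|u t - q n|; rewrite (normsqB hip); lra.
apply: bigcupT_measurable => n; apply: measurable_lt_fun; first exact: measurable_cst.
by apply: measurable_funB; [apply: measurable_funM|].
Qed.

End Closure.

Lemma wmeas_comp d (T : measurableType d) d' (T' : measurableType d')
    (u : T' -> H) (f : T -> T') :
  measurable_fun setT f -> wmeas u -> wmeas (u \o f).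
Proof. by move=> mf mu e; exact: (measurableT_comp (mu e)). Qed.

Section VectorIntegral.
Context d (T : measurableType d) (mu : {measure set T -> \bar R}).
Variable q : nat -> H.
Hypothesis dq : dense_seq q.
Implicit Types (A : set T) (u v : T -> H).

Definition bint A u := mu.-integrable A (fun t => (`|u t|)%:E).

(* Weak integral; 0 when no such vector exists. *)
Definition vint A u : H :=
  xget 0 [set p | forall e, ip p e = Rintegral mu A (fun t => ip (u t) e)].

Lemma integrable_le A (f g : T -> R) : measurable A -> measurable_fun setT f ->
  (forall t, A t -> `|f t| <= g t) -> mu.-integrable A (EFin \o g) ->
  mu.-integrable A (EFin \o f).
Proof.
move=> mA mf fg; apply: le_integrable => //.
  by apply/measurable_EFinP; exact: measurable_funS mf.
by move=> t At /=; rewrite lee_fin (le_trans (fg _ At))// ler_norm.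
Qed.

Lemma bint_ip A u e : measurable A -> wmeas u -> bint A u ->
  mu.-integrable A (EFin \o (fun t => ip (u t) e)).
Proof.
move=> mA wu iu; apply: (@integrable_le A _ (fun t => `|e| * `|u t|)) => //.
  by move=> t _; rewrite mulrC; exact: normr_ip_le.
by have := integrableZl mA `|e| iu; apply: eq_integrable.
Qed.

(** Riesz representation of [e -> \int <u, e>], a linear form bounded by the integral of the norm of
    [u]. *)
Lemma vint_ex A u : measurable A -> wmeas u -> bint A u ->
  exists p, forall e, ip p e = Rintegral mu A (fun t => ip (u t) e).
Proof.
move=> mA wu iu.
apply: (riesz hip (phi := fun e => Rintegral mu A (fun t => ip (u t) e))
  (M := Rintegral mu A (fun t => `|u t|))).
  move=> a x y.
  under eq_Rintegral do rewrite (ipDr hip) (ipZr hip).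
  have i1 := bint_ip x mA wu iu.
  have i2 : mu.-integrable A (EFin \o (fun t => a * ip (u t) x)).
    by have := integrableZl mA a i1; apply: eq_integrable.
  by rewrite RintegralD//; [rewrite RintegralZl|exact: bint_ip].
move=> x; apply: (le_trans (le_normr_Rintegral _ _)) => //; first exact: bint_ip.
rewrite -RintegralZr//; apply: le_Rintegral => //.
- exact: (integrable_norm (bint_ip x mA wu iu)).
- by have := integrableZr mA `|x| iu; apply: eq_integrable.
- by move=> t _; exact: normr_ip_le.
Qed.

Lemma vintP A u : measurable A -> wmeas u -> bint A u ->
  forall e, ip (vint A u) e = Rintegral mu A (fun t => ip (u t) e).
Proof.
move=> mA wu iu; have [p pP] := vint_ex mA wu iu.
by rewrite /vint; case: xgetP => [y -> //|/(_ p)].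
Qed.

Lemma ler_norm_vint A u : measurable A -> wmeas u -> bint A u ->
  `|vint A u| <= Rintegral mu A (fun t => `|u t|).
Proof.
move=> mA wu iu; apply: (norm_le_ip hip).
  by apply: Rintegral_ge0.
rewrite vintP// -RintegralZr//; apply: le_Rintegral => //; first exact: bint_ip.
  by have := integrableZr mA `|vint A u| iu; apply: eq_integrable.
by move=> t _; apply: (le_trans _ (normr_ip_le hip _ _)); exact: ler_norm.
Qed.

Lemma bint_le A u (g : T -> R) : measurable A -> wmeas u ->
  (forall t, A t -> `|u t| <= g t) -> mu.-integrable A (EFin \o g) -> bint A u.
Proof.
move=> mA wu ug; apply: integrable_le => //; first exact: wmeas_norm dq wu.
by move=> t At; rewrite normr_id; exact: ug.
Qed.

End VectorIntegral.

End VectorMeasurability.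

(** * Almost everywhere statements *)

Section AlmostEverywhere.
Context d (T : measurableType d) (R : realType) (mu : {measure set T -> \bar R}).
Implicit Types P Q S : T -> Prop.

Lemma ae_imp P Q : (forall t, P t -> Q t) ->
  {ae mu, forall t, P t} -> {ae mu, forall t, Q t}.
Proof. by move=> PQ; apply: (@filterS _ _ (ae_filter_ringOfSetsType mu)). Qed.

Lemma ae_imp2 P Q S : (forall t, P t -> Q t -> S t) ->
  {ae mu, forall t, P t} -> {ae mu, forall t, Q t} -> {ae mu, forall t, S t}.
Proof. by move=> PQS; apply: (@filterS2 _ _ (ae_filter_ringOfSetsType mu)). Qed.

Lemma ae_all (P : nat -> T -> Prop) : (forall n, {ae mu, forall t, P n t}) ->
  {ae mu, forall t, forall n, P n t}.
Proof.
move=> h; have : mu.-negligible (\bigcup_n (~` [set t | P n t])).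
  by apply: negligible_bigcup => n; exact: h.
apply: negligibleS => t /= /existsNP[n Pn]; exists n => //.
Qed.

End AlmostEverywhere.

(** * Integrals over half-open intervals *)

Section IntervalIntegrals.
Context {R : realType}.
Local Notation mu := (@lebesgue_measure R).
Implicit Types (f g w : R -> R) (a b c : R).

(** With the left end excluded, adjacent intervals are disjoint and integrals add up exactly over
    the cells of a mesh. *)
Definition itg a b f : R := Rintegral mu `]a, b]%classic f.
Definition intb a b f := mu.-integrable `]a, b]%classic (EFin \o f).

Lemma measurable_oc a b : measurable (`]a, b]%classic : set (measurableTypeR R)).
Proof. exact: measurable_itv. Qed.
Hint Resolve measurable_oc : core.

Lemma intb_sub a b c d f : a <= c -> d <= b -> intb a b f -> intb c d f.
Proof.
move=> ac db; apply: integrableS => //.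
by move=> x /=; rewrite !in_itv /= => /andP[h1 h2]; rewrite (le_lt_trans ac)//= (le_trans h2).
Qed.

Lemma itg_chasles b a c f : a <= b -> b <= c -> intb a c f ->
  itg a c f = itg a b f + itg b c f.
Proof.
move=> ab bc ifc; rewrite /itg.
have e : `]a, c]%classic = `]a, b]%classic `|` `]b, c]%classic :> set R.
  apply/seteqP; split => x /=; rewrite !in_itv /=.
    by move=> /andP[h1 h2]; have [xb|xb] := leP x b; [left; rewrite h1|right].
  move=> [/andP[h1 h2]|/andP[h1 h2]]; first by rewrite h1 (le_trans h2).
  by rewrite h2 (le_lt_trans ab).
rewrite e Rintegral_setU//; first by rewrite -e.
apply/disj_setPS => x /=; rewrite !in_itv /= => -[/andP[_ h1] /andP[h2 _]].
by have := lt_le_trans h2 h1; rewrite ltxx.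
Qed.

Lemma itg_xx a f : itg a a f = 0.
Proof. by rewrite /itg set_itvoc0 Rintegral_set0. Qed.

Lemma intb_const a b (k : R) : intb a b (fun=> k).
Proof.
apply: measurable_bounded_integrable => //.
  rewrite /= lebesgue_measure_itv /=; case: ifP => _; last by rewrite ltry.
  by rewrite -EFinD ltry.
by exists `|k|; split => // M kM x _; exact: ltW.
Qed.

Lemma itg_const a b k : a <= b -> itg a b (fun=> k) = k * (b - a).
Proof.
move=> ab; rewrite /itg Rintegral_cst// /= lebesgue_measure_itv /= lte_fin.
by move: ab; rewrite le_eqVlt => /orP[/eqP ->|->]; rewrite ?ltxx ?subrr//=.
Qed.

Lemma intbD a b f g : intb a b f -> intb a b g -> intb a b (fun t => f t + g t).
Proof. by move=> h1 h2; have := integrableD (measurable_oc a b) h1 h2; apply: eq_integrable. Qed.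

Lemma intbB a b f g : intb a b f -> intb a b g -> intb a b (fun t => f t - g t).
Proof. by move=> h1 h2; have := integrableB (measurable_oc a b) h1 h2; apply: eq_integrable. Qed.

Lemma intbZ a b k f : intb a b f -> intb a b (fun t => k * f t).
Proof. by move=> h1; have := integrableZl (measurable_oc a b) k h1; apply: eq_integrable. Qed.

Lemma itgD a b f g : intb a b f -> intb a b g ->
  itg a b (fun t => f t + g t) = itg a b f + itg a b g.
Proof. by move=> h1 h2; rewrite /itg RintegralD. Qed.

Lemma itgB a b f g : intb a b f -> intb a b g ->
  itg a b (fun t => f t - g t) = itg a b f - itg a b g.
Proof. by move=> h1 h2; rewrite /itg RintegralB. Qed.

Lemma itgZ a b k f : intb a b f -> itg a b (fun t => k * f t) = k * itg a b f.
Proof. by move=> h1; rewrite /itg RintegralZl. Qed.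

Lemma itg_le a b f g : intb a b f -> intb a b g ->
  (forall t, a < t <= b -> f t <= g t) -> itg a b f <= itg a b g.
Proof.
by move=> h1 h2 fg; apply: le_Rintegral => // t; rewrite /= in_itv /=; exact: fg.
Qed.

Lemma eq_itg a b f g : (forall t, a < t <= b -> f t = g t) -> itg a b f = itg a b g.
Proof.
by move=> fg; apply: eq_Rintegral => t; rewrite inE /= in_itv /=; exact: fg.
Qed.

Lemma itg_ge0 a b f : (forall t, a < t <= b -> 0 <= f t) -> 0 <= itg a b f.
Proof. by move=> f0; apply: Rintegral_ge0 => t; rewrite /= in_itv /=; exact: f0. Qed.

Lemma ler_norm_itg a b f : intb a b f -> `|itg a b f| <= itg a b (fun t => `|f t|).
Proof. by move=> h; apply: le_normr_Rintegral. Qed.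

Lemma intb_norm a b f : intb a b f -> intb a b (fun t => `|f t|).
Proof. exact: integrable_norm. Qed.

Lemma intb_le a b f g : measurable_fun setT f ->
  (forall t, a < t <= b -> `|f t| <= g t) -> intb a b g -> intb a b f.
Proof.
move=> mf fg ig.
by apply: (@integrable_le _ _ _ mu `]a, b]%classic f g _ mf _ ig).
Qed.

Lemma itg_dominated_cvg a b (f : nat -> R -> R) (g w : R -> R) :
  (forall n, measurable_fun setT (f n)) -> measurable_fun setT g -> intb a b w ->
  {ae mu, forall t, a < t <= b -> f n t @[n --> \oo] --> g t} ->
  {ae mu, forall t, a < t <= b -> forall n, `|f n t| <= w t} ->
  intb a b g /\ itg a b (f n) @[n --> \oo] --> itg a b g.
Proof.
move=> mf mg iw fg fw.
have := @dominated_convergence _ _ R mu `]a, b]%classic (measurable_oc a b)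
  (fun n => EFin \o f n) (EFin \o g) (EFin \o w) _ _ _ iw _.
case.
- by move=> n; apply/measurable_EFinP; exact: measurable_funS (mf n).
- by apply/measurable_EFinP; exact: measurable_funS mg.
- apply: ae_imp fg => t h; rewrite /= in_itv /= => /h ft.
  by apply: cvg_EFin => //; exact: nearW.
- apply: ae_imp fw => t h n; rewrite /= in_itv /= => /h; rewrite lee_fin; apply.
move=> ig _ cvi; split => //; rewrite /itg /Rintegral.
by apply: fine_cvg; rewrite fineK//; exact: integrable_fin_num.
Qed.

(** Absolute continuity of the integral, applied to the union [U] of the intervals: up to their ends
    they are disjoint, so both the measure of [U] and the integral over [U] are sums. *)
Lemma itg_family_small T w (eps : R) : (forall t, 0 <= w t) -> intb 0 T w -> 0 < eps ->
  exists2 delta : R, 0 < delta & forall n (u v : nat -> R),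
    (forall i, (i < n)%N -> 0 <= u i /\ u i <= v i /\ v i <= T) ->
    (forall i j, (i < n)%N -> (j < n)%N -> i <> j -> v i <= u j \/ v j <= u i) ->
    \sum_(i < n) (v i - u i) < delta -> \sum_(i < n) itg (u i) (v i) w < eps.
Proof.
move=> w0 iw e0.
have iwr : mu.-integrable setT (EFin \o (w \_ `]0, T]%classic)).
  by have /integrable_mkcond := iw; rewrite restrict_EFin; apply.
have [d [d0 dP]] := integral_normr_continuous iwr e0.
exists d => // n u v uvT disj sd.
pose U := \big[setU/set0]_(i < n) (`]u i, v i]%classic : set (measurableTypeR R)).
have [muU intU UT] : [/\ mu U = (\sum_(i < n) (v i - u i))%:E,
    Rintegral mu U w = \sum_(i < n) itg (u i) (v i) w & U `<=` `]0, T]%classic].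
  rewrite /U {sd U}; elim: n uvT disj => [|n IH] uvT disj.
    by rewrite !big_ord0 measure0 Rintegral_set0; split => // x [].
  have [|i j iN jN ij|m1 m2 m3] := IH; first by move=> i iN; apply: uvT; exact: ltnW.
    by apply: disj => //; exact: ltnW.
  have [u0 [uv vT]] := uvT n (ltnSn n).
  rewrite !big_ord_recr /=; set B := \big[setU/set0]_(i < n) _ in m1 m2 m3 *.
  have mB : measurable (B : set (measurableTypeR R)) by apply: bigsetU_measurable.
  have BD : B `&` `]u n, v n]%classic = set0.
    apply/seteqP; split => // x [].
    have -> : B = \bigcup_(i < n) `]u i, v i]%classic by rewrite bigcup_mkord.
    move=> [i /= iN]; rewrite !in_itv /= => /andP[h1 h2] /andP[h3 h4].
    have : i <> n by move=> e; move: iN; rewrite e ltnn.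
    case/(disj i n (ltnW iN) (ltnSn n)) => h.
    - by have := lt_le_trans h3 (le_trans h2 h); rewrite ltxx.
    - by have := lt_le_trans h1 (le_trans h4 h); rewrite ltxx.
  have BT : B `|` `]u n, v n]%classic `<=` `]0, T]%classic.
    move=> x [/m3//|]; rewrite /= !in_itv /= => /andP[h1 h2].
    by rewrite (le_lt_trans u0)//= (le_trans h2).
  split => //.
  - rewrite measureU// EFinD -m1; congr (_ + _)%E.
    have -> : (v n - u n)%:E = lebesgue_measure (`]u n, v n]%classic : set (measurableTypeR R)).
      rewrite lebesgue_measure_itv /= lte_fin -EFinB.
      by move: uv; rewrite le_eqVlt => /orP[/eqP ->|->]; rewrite ?ltxx ?subrr.
    by [].
  - rewrite -m2 -Rintegral_setU//.
      by apply: integrableS iw => //; exact: measurableU.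
    by apply/disj_setPS; rewrite BD.
have mU : measurable (U : set (measurableTypeR R)) by apply: bigsetU_measurable.
have muUd : (mu U < d%:E)%E by rewrite muU lte_fin.
apply: le_lt_trans (dP _ mU muUd).
rewrite -intU le_eqVlt; apply/orP; left; apply/eqP.
apply: eq_Rintegral => x; rewrite inE => /UT xT.
by rewrite patchE mem_set// ger0_norm.
Qed.

End IntervalIntegrals.
#[global] Hint Resolve measurable_oc : core.

(** * Almost everywhere differentiability of vector primitives *)

Section VectorPrimitive.
Context {R : realType} {H : completeNormedModType R}.
Variable ip : H -> H -> R.
Hypothesis hip : inner_product ip.
Variable q : nat -> H.
Hypothesis dq : dense_seq q.
Local Notation mu := (@lebesgue_measure R).

Variables (T : R) (u x : R -> H).
Hypothesis T0 : 0 < T.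
Hypothesis wu : wmeas ip u.
Hypothesis iu : intb 0 T (fun t => `|u t|).
Hypothesis xu : forall s t e, 0 <= s -> s <= t -> t <= T ->
  ip (x t - x s) e = itg s t (fun r => ip (u r) e).

Let mnorm v : measurable_fun setT (fun t => `|u t - v|).
Proof.
by apply: (wmeas_norm hip dq); apply: wmeasB => //; exact: wmeas_cst.
Qed.

Let inorm v : intb 0 T (fun t => `|u t - v|).
Proof.
apply: (@intb_le _ _ _ _ (fun t => `|u t| + `|v|)) => //.
  by move=> t _; rewrite normr_id ler_normB.
by apply: intbD => //; exact: intb_const.
Qed.

Lemma primitive_increment_le v s t : 0 <= s -> s <= t -> t <= T ->
  `|x t - x s - (t - s) *: v| <= itg s t (fun r => `|u r - v|).
Proof.
move=> s0 st tT.
have iuv := intb_sub s0 tT (inorm v).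
have iue e : intb s t (fun r => ip (u r) e).
  have := bint_ip hip (mu := mu) e (measurable_oc s t) wu; apply.
  exact: intb_sub iu.
have iuve e : intb s t (fun r => ip (u r - v) e).
  have := intbB (iue e) (intb_const s t (ip v e)); apply: eq_integrable => // r _.
  by rewrite /= (ipBl hip).
have ie e : ip (x t - x s - (t - s) *: v) e = itg s t (fun r => ip (u r - v) e).
  rewrite (ipBl hip) (xu e s0 st tT) (ipZl hip) mulrC -itg_const// -itgB//; last exact: intb_const.
  by apply: eq_itg => r _; rewrite (ipBl hip).
apply: (norm_le_ip hip); first by apply: itg_ge0.
rewrite ie mulrC -itgZ//; apply: itg_le => //; first exact: intbZ.
by move=> r _; rewrite mulrC; exact: ip_le_norm.
Qed.

(** Scalar differentiation applies to the primitives [F n] of [|u - q n|] for all [n] at once off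
    one null set. At such a [t], the difference quotient of [x] is compared with a [q n] close to
    [u t], and its deviation from [q n] is controlled by the quotient of [F n]. *)
Lemma vector_primitive_derivable :
  {ae mu, forall t, 0 < t < T -> h^-1 *: (x (h + t) - x t) @[h --> 0^'] --> u t}.
Proof.
pose phi n := (fun t => `|u t - q n|) \_ `]0, T]%classic.
pose F n y := Rintegral mu [set` Interval (BRight 0) (BRight y)] (phi n).
have iphi n : mu.-integrable setT (EFin \o phi n).
  by have /integrable_mkcond := inorm (q n); rewrite restrict_EFin; apply.
have Fsub n s t : 0 <= s -> s <= t -> t <= T ->
    F n t - F n s = itg s t (fun r => `|u r - q n|).
  move=> s0 st tT; rewrite /F -/(itg 0 t (phi n)) -/(itg 0 s (phi n)).
  rewrite (@itg_chasles _ s)//; last by apply: integrableS (iphi n).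
  rewrite addrC addKr; apply: eq_itg => r /andP[r1 r2].
  by rewrite /phi patchE mem_set//= in_itv /= (le_lt_trans s0 r1) (le_trans r2).
have : {ae mu, forall t, forall n, 0 < t < T ->
    h^-1 * (F n (h + t) - F n t) @[h --> 0^'] --> `|u t - q n|}.
  apply: ae_all => n.
  have := @FTC1 R (phi n) (BRight 0) _ _.
  case.
  - by move=> y; apply: integrableS (iphi n).
  - by apply: open_integrable_locally => //; exact: openT.
  move=> N [mN N0 NP]; exists N; split => // t /= ht; apply: NP => /= hF; apply: ht.
  move=> /andP[t0 tT].
  have [|dF Ft] := hF; first by rewrite lte_fin.
  have -> : `|u t - q n| = phi n t.
    by rewrite /phi patchE mem_set//= in_itv /= t0 ltW.
  rewrite -Ft derive1E.
  have : h^-1 *: (F n (h *: 1 + t) - F n t) @[h --> 0^'] --> 'D_1 (F n) t by exact: dF.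
  by under eq_fun do rewrite [_ *: 1]mulr1.
apply: ae_imp => t hF /andP[t0 tT].
apply/cvgrPdist_le => eps eps0.
(* One third of [eps] goes to [|u t - q n|]; the quotient of [F n] tends to that same norm, so it is
   eventually below two thirds. *)
have [n un] := dq (u t) (divr_gt0 eps0 (ltr0n R 3)).
have {}hF : \forall h \near 0^', h^-1 * (F n (h + t) - F n t) < 2 * (eps / 3).
  have := hF n; rewrite t0 tT => /(_ isT) /cvgr_lt; apply; lra.
have hF' : \forall h \near (0 : R)^', `|h| < Num.min t (T - t) /\ h != 0.
  near=> h; split.
    near: h; apply: dnbhs0_lt; rewrite lt_min t0 subr_gt0//.
  by near: h; exact: nbhs_dnbhs_neq.
near=> h.
have [hlt h0] : `|h| < Num.min t (T - t) /\ h != 0 by near: h.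
have Fh : h^-1 * (F n (h + t) - F n t) < 2 * (eps / 3) by near: h.
move: hlt; rewrite lt_min !ltr_norml => /andP[/andP[h1 h2] /andP[h3 h4]].
(* For negative [h] the increment is read on [[h + t, t]]; the sign cancels against that of
   [h^-1]. *)
have key : `|x (h + t) - x t - h *: q n| <= `|h| * (h^-1 * (F n (h + t) - F n t)).
  have [hp|hn] := ltP 0 h.
    rewrite (gtr0_norm hp) mulrA mulfV// mul1r Fsub; [|lra..].
    by have := @primitive_increment_le (q n) t (h + t); rewrite addrK; apply; lra.
  have hn' : h < 0 by rewrite lt_neqAle h0.
  rewrite (ltr0_norm hn') mulNr mulrA mulfV// mul1r opprB Fsub; [|lra..].
  have := @primitive_increment_le (q n) (h + t) t.
  rewrite opprD addrCA subrr addr0 scaleNr opprK => hh.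
  rewrite -normrN; apply: le_trans (hh _ _ _); [|lra..].
  by rewrite !opprB addrC.
have -> : u t - h^-1 *: (x (h + t) - x t) =
   (u t - q n) - h^-1 *: (x (h + t) - x t - h *: q n).
  by rewrite [in RHS]scalerBr scalerA mulVf// scale1r opprB addrA addrNK.
apply: (le_trans (ler_normB _ _)); rewrite normrZ.
have hb : `|h^-1| * `|x (h + t) - x t - h *: q n| <= h^-1 * (F n (h + t) - F n t).
  rewrite normfV mulrC ler_pdivrMr ?normr_gt0// mulrC; exact: key.
lra.
Unshelve. all: by end_near. Qed.

End VectorPrimitive.

(** * Distance functions, clock and nodes *)

Section DistanceToSet.
Context {R : realType} {H : completeNormedModType R}.
Implicit Types (S : set H) (x y z : H).

Lemma dist_has_inf z S : S !=set0 -> has_inf [set `|z - y| | y in S].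
Proof.
by move=> [y Sy]; split; [exists `|z - y|, y|exists 0 => _ [x _ <-]].
Qed.

Lemma dist_le z S y : S y -> dist z S <= `|z - y|.
Proof.
by move=> Sy; apply: ge_inf; [apply: (dist_has_inf z _).2; exists y|exists y].
Qed.

Lemma dist_ge0 z S : S !=set0 -> 0 <= dist z S.
Proof.
move=> S0; apply: lb_le_inf; first exact: (dist_has_inf z S0).1.
by move=> _ [y _ <-].
Qed.

Lemma dist_mem z S : S z -> dist z S = 0.
Proof.
move=> Sz; apply/eqP; rewrite eq_le dist_ge0 ?andbT; last by exists z.
by have := dist_le z Sz; rewrite subrr normr0.
Qed.

Lemma dist_adherent z S (e : R) : S !=set0 -> 0 < e ->
  exists2 y, S y & `|z - y| < dist z S + e.
Proof.
move=> S0 e0; have [_ [y Sy <-] h] := inf_adherent e0 (dist_has_inf z S0).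
by exists y.
Qed.

Lemma dist0_closed z S : S !=set0 -> closed S -> dist z S <= 0 -> S z.
Proof.
move=> S0 cS d0; apply: cS => B /nbhs_ballP[e /= e0 eB].
have [y Sy zy] := dist_adherent z S0 e0; exists y; split => //; apply: eB.
by rewrite -ball_normE /=; lra.
Qed.

Lemma dist_lip x y S : S !=set0 -> `|dist x S - dist y S| <= `|x - y|.
Proof.
move=> S0; have aux u v : dist u S <= dist v S + `|u - v|.
  apply/ler_addgt0Pr => e e0; have [p Sp pd] := dist_adherent v S0 e0.
  apply: (le_trans (dist_le u Sp)); have := ler_normD (u - v) (v - p).
  rewrite addrA subrK; lra.
have := aux x y; have := aux y x; rewrite distrC ler_norml; lra.
Qed.

(** [S] need not be convex: existence comes from compactness of its bounded parts. *)
Lemma nearest_exists S z : S !=set0 -> closed S ->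
  (forall r : R, 0 < r -> compact (closure (S `&` rball r))) ->
  exists2 p, S p & forall y, S y -> `|z - p| <= `|z - y|.
Proof.
move=> [y0 Sy0] cS kS.
(* A point of norm above [r] is at distance more than [|z| + |y0|] from [z], hence farther than
   [y0]. *)
pose r := 2 * `|z| + `|y0| + 1.
have r0 : 0 < r by rewrite /r ltr_pwDr// addr_ge0// mulr_ge0.
pose A := closure (S `&` rball r).
have AS : A `<=` S by move=> x Ax; apply: cS; apply: closureS Ax => ? [].
have SA x : S x -> `|x| <= r -> A x by move=> Sx xr; apply: subset_closure.
have Ay0 : A y0 by apply: SA => //; rewrite /r -addrA ler_wpDl ?mulr_ge0// lerDl.
have cf : {within A, continuous (fun y => `|z - y|)}.
  apply: continuous_subspaceT => y.
  by apply: cvg_norm; apply: cvgB; [exact: cvg_cst|exact: cvg_id].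
have [p Ap pmin] : exists2 c, c \in A & forall t, t \in A -> `|z - c| <= `|z - t|.
  by apply: compact_EVT_min => //; [exists y0|exact: kS].
exists p; first by apply: AS; rewrite inE in Ap.
move=> y Sy; have [yr|yr] := leP `|y| r; first by apply: pmin; rewrite inE; exact: SA.
apply: (le_trans (pmin y0 _)); first by rewrite inE.
have := ler_normB z y0; have := lerB_normD y (- z).
rewrite normrN (distrC y); move: yr; rewrite /r.
have := normr_ge0 z; have := normr_ge0 y0; lra.
Qed.

End DistanceToSet.

Section Psi.
Context {R : realType}.
Local Notation mu := (@lebesgue_measure R).
Variables (T : R) (w : R -> R).
Hypothesis T0 : 0 < T.
Hypothesis w1 : forall t, 1 <= w t.
Hypothesis iw : intb 0 T w.
Local Notation clip := (clip T).

Definition psi t := itg 0 (clip t) w.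

Lemma psi0 : psi 0 = 0.
Proof. by rewrite /psi clip_id ?itg_xx// lexx ltW. Qed.

Lemma psiB s t : s <= t -> psi t - psi s = itg (clip s) (clip t) w.
Proof.
move=> st; have /andP[s0 _] := clipP T0 s; have /andP[_ tT] := clipP T0 t.
rewrite /psi (@itg_chasles _ (clip s))//; first by rewrite addrC addKr.
  exact: clip_nd.
exact: intb_sub iw.
Qed.

Lemma psiB_in s t : 0 <= s -> s <= t -> t <= T -> psi t - psi s = itg s t w.
Proof.
by move=> s0 st tT; rewrite psiB// !clip_id// ?s0 ?tT ?(le_trans s0)// (le_trans st).
Qed.

Lemma itg_w_ge s t : 0 <= s -> s <= t -> t <= T -> t - s <= itg s t w.
Proof.
move=> s0 st tT; have iws : intb s t w by exact: intb_sub iw.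
by rewrite -[leLHS]mul1r -itg_const//; apply: itg_le => //; exact: intb_const.
Qed.

Lemma psi_ge_len s t : 0 <= s -> s <= t -> t <= T -> t - s <= psi t - psi s.
Proof. by move=> s0 st tT; rewrite psiB_in// itg_w_ge. Qed.

Lemma psi_nd : nondecreasing psi.
Proof.
move=> s t st; rewrite -subr_ge0 psiB//; apply: itg_ge0 => r _.
exact: le_trans ler01 _.
Qed.

Lemma psi_modulus (eps : R) : 0 < eps -> exists2 delta : R, 0 < delta &
  forall s t, s <= t -> t - s < delta -> psi t - psi s < eps.
Proof.
move=> e0; have w0 t : 0 <= w t by exact: le_trans ler01 _.
have [d d0 dP] := itg_family_small w0 iw e0.
exists d => // s t st std; rewrite psiB//.
have := dP 1%N (fun=> clip s) (fun=> clip t); rewrite !big_ord1; apply.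
- by move=> _ _; rewrite clip_nd//; have /andP[-> _] := clipP T0 s; have /andP[_ ->] := clipP T0 t.
- by move=> [|//] [].
- exact: le_lt_trans (clip_lip T st) std.
Qed.

Lemma psi_continuous : continuous psi.
Proof.
move=> x; apply/cvgrPdist_lt => e e0; have [d d0 dP] := psi_modulus e0.
apply/nbhs_ballP; exists d => // y; rewrite /ball_ /= ltr_norml => /andP[h1 h2].
have [xy|yx] := leP x y.
- by rewrite distrC ger0_norm ?subr_ge0 ?psi_nd// dP//; lra.
- by rewrite ger0_norm ?subr_ge0 ?psi_nd ?(ltW yx)// dP ?(ltW yx)//; lra.
Qed.

Lemma measurable_psi : measurable_fun setT psi.
Proof. exact: continuous_measurable_fun psi_continuous. Qed.

Lemma psi_surj y : 0 <= y <= psi T -> exists t, 0 <= t <= T /\ psi t = y.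
Proof.
move=> /andP[y0 yT].
have [||t tT ty] := @IVT _ psi 0 T y (ltW T0).
- exact: continuous_subspaceT psi_continuous.
- by rewrite psi0 ge_min y0 le_max yT orbT.
by exists t; split => //; move: tT; rewrite in_itv.
Qed.

Lemma psiT_gt0 : 0 < psi T.
Proof.
apply: (lt_le_trans T0).
by have := psi_ge_len (lexx 0) (ltW T0) (lexx T); rewrite psi0 !subr0.
Qed.

Lemma psi_lt_inj s t : 0 <= s <= T -> 0 <= t <= T -> psi s < psi t -> s < t.
Proof.
by move=> /andP[s0 sT] /andP[t0 tT] h; rewrite ltNge; apply/negP => /psi_nd; rewrite leNgt h.
Qed.

Lemma psi_inj s t : 0 <= s <= T -> 0 <= t <= T -> psi s = psi t -> s = t.
Proof.
move=> /andP[s0 sT] /andP[t0 tT] h; case: (ltgtP s t) => // st.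
- have := psi_ge_len s0 (ltW st) tT; rewrite h; lra.
- have := psi_ge_len t0 (ltW st) sT; rewrite h; lra.
Qed.

Section Nodes.
Variable n : nat.

Definition mesh : R := psi T / n.+1%:R.

Lemma mesh_gt0 : 0 < mesh. Proof. by rewrite divr_gt0 ?psiT_gt0. Qed.

Lemma meshE : mesh * n.+1%:R = psi T. Proof. by rewrite /mesh divfK. Qed.

(** The minimum with [psi T] makes [node] total: past index [n.+1] the node stays at [T]. *)
Lemma node_ex i : exists t, 0 <= t <= T /\ psi t = Num.min (i%:R * mesh) (psi T).
Proof.
apply: psi_surj; rewrite le_min mulr_ge0 ?(ltW mesh_gt0)//= (ltW psiT_gt0)/=.
by rewrite ge_min lexx orbT.
Qed.

Definition node i : R := projT1 (cid (node_ex i)).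

Lemma nodeP i : 0 <= node i <= T.
Proof. by rewrite /node; case: cid => t []. Qed.

Lemma psi_node i : (i <= n.+1)%N -> psi (node i) = i%:R * mesh.
Proof.
rewrite /node; case: cid => t [/= _ ->] ih; apply: min_l.
by rewrite -meshE mulrC ler_pM2l ?mesh_gt0// ler_nat.
Qed.

Lemma node0 : node 0 = 0.
Proof.
by apply: psi_inj; rewrite ?nodeP ?lexx ?(ltW T0)// psi_node// mul0r psi0.
Qed.

Lemma node_lt i j : (i < j)%N -> (j <= n.+1)%N -> node i < node j.
Proof.
move=> ij jn; apply: psi_lt_inj; rewrite ?nodeP// !psi_node ?(leq_trans (ltnW ij))//.
by rewrite ltr_pM2r ?mesh_gt0// ltr_nat.
Qed.

Lemma itg_node i : (i <= n)%N -> itg (node i) (node i.+1) w = mesh.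
Proof.
move=> ih; have /andP[i0 _] := nodeP i; have /andP[_ iT] := nodeP i.+1.
rewrite -psiB_in//; last by apply/ltW/node_lt.
by rewrite !psi_node ?ltnS ?(leqW ih)// -natr1; ring.
Qed.

(** The cell number is defined through the clock, which makes it measurable; the large inequality
    assigns a node to the cell that it ends, so [idx] equals [i] on []node i, node i.+1]]. *)
Definition idx : R -> nat := first_index (fun i => [set t | psi t <= i.+1%:R * mesh]).

Lemma idx_ex t : exists i, psi t <= i.+1%:R * mesh.
Proof.
exists (Num.bound (psi t / mesh)); rewrite -ler_pdivrMr ?mesh_gt0//.
apply: ltW; apply: (lt_trans (archi_boundP _)); last by rewrite ltr_nat.
rewrite divr_ge0 ?(ltW mesh_gt0)//; have [t0|t0] := leP 0 t.
  by rewrite -psi0 psi_nd.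
have c0 s : s <= 0 -> clip s = 0 by move=> s0; rewrite /clip max_l// ge_min s0.
by rewrite -psi0 /psi !c0// ltW.
Qed.

Lemma idx_first t : psi t <= (idx t).+1%:R * mesh /\
  forall k, (k < idx t)%N -> ~ (psi t <= k.+1%:R * mesh).
Proof.
exact: (@first_indexP _ (fun i => [set t | psi t <= i.+1%:R * mesh]) t (idx_ex t)).
Qed.

Lemma measurable_idx i : measurable [set t | idx t = i].
Proof.
apply: measurable_first_index => [k|]; last exact: idx_ex.
by apply: measurable_le_fun; [exact: measurable_psi|exact: measurable_cst].
Qed.

Lemma idx_node t i : (i <= n)%N -> node i < t <= node i.+1 -> idx t = i.
Proof.
move=> ih /andP[t1 t2].
have /andP[i0 _] := nodeP i; have /andP[_ iT] := nodeP i.+1.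
have p1 : i%:R * mesh < psi t.
  rewrite -psi_node ?(leqW ih)// ltNge; apply/negP => h.
  have := psi_ge_len i0 (ltW t1) (le_trans t2 iT); lra.
have p2 : psi t <= i.+1%:R * mesh by rewrite -psi_node// psi_nd.
have [h1 h2] := idx_first t; case: (ltngtP (idx t) i) => // h.
- have hm : (idx t).+1%:R * mesh <= i%:R * mesh by rewrite ler_pM2r ?mesh_gt0// ler_nat.
  by have := lt_le_trans p1 (le_trans h1 hm); rewrite ltxx.
- by have := h2 i h.
Qed.

Lemma idxP t : 0 < t <= T -> (idx t <= n)%N /\ node (idx t) < t <= node (idx t).+1.
Proof.
move=> /andP[t0 tT]; have [h1 h2] := idx_first t.
have idn : (idx t <= n)%N.
  rewrite leqNgt; apply/negP => h; apply: (h2 n h).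
  by rewrite /= mulrC meshE psi_nd.
split => //; apply/andP; split.
- case: (idx t) h2 idn => [|i] h2 idn; first by rewrite node0.
  have := h2 i (ltnSn i); move=> /negP; rewrite -ltNge => h.
  by apply: psi_lt_inj; rewrite ?nodeP ?(ltW t0)// psi_node// (leqW idn).
- rewrite leNgt; apply/negP => h; have /andP[i0 _] := nodeP (idx t).+1.
  have := psi_ge_len i0 (ltW h) tT; rewrite psi_node//.
  move: h1; set a := (idx t).+1%:R * mesh => h1; lra.
Qed.

End Nodes.

End Psi.

(** * Pointwise limits of fast Cauchy sequences *)

Section FastLimit.
Context {R : realType} {H : completeNormedModType R}.
Variable ip : H -> H -> R.
Hypothesis hip : inner_product ip.
Local Notation mu := (@lebesgue_measure R).

Lemma geometric_increments_cvg (u : nat -> H) (c : R) :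
  (forall j, `|u j.+1 - u j| <= c * 2^-1 ^+ j) -> cvgn u.
Proof.
move=> uc; apply: cauchy_seq_cvg => e e0.
have c0 : 0 <= c by have := le_trans (normr_ge0 _) (uc 0%N); rewrite expr0 mulr1.
have tail k i : `|u (k + i)%N - u k| <= c * 2 * 2^-1 ^+ k - c * 2 * 2^-1 ^+ (k + i).
  elim: i => [|i IH]; first by rewrite addn0 !subrr normr0.
  rewrite addnS -(subrKA (u (k + i)%N)); apply: (le_trans (ler_normD _ _)).
  apply: le_trans (lerD (uc _) IH) _; rewrite exprS; lra.
have tail' k m : (k <= m)%N -> `|u m - u k| <= c * 2 * 2^-1 ^+ k.
  move=> km; rewrite -(subnKC km); apply: (le_trans (tail _ _)).
  by rewrite lerBlDr lerDl !mulr_ge0// exprn_ge0.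
have [N NP] : exists N, c * 2 * 2^-1 ^+ N <= e / 2.
  have : (c * 2 * 2^-1 ^+ n) @[n --> \oo] --> c * 2 * 0.
    by apply: cvgMr; apply: cvg_expr; rewrite ger0_norm ?invr_ge0// invf_lt1// ltr1n.
  rewrite mulr0 => /cvgr_le /(_ (e / 2)); rewrite divr_gt0// => /(_ isT) [N _ NP].
  by exists N; apply: NP => /=.
exists N => m k mN kN; rewrite -(subrKA (u N)); apply: (le_trans (ler_normD _ _)).
rewrite [e]splitr; apply: lerD; first exact: le_trans (tail' _ _ mN) NP.
by rewrite distrC; exact: le_trans (tail' _ _ kN) NP.
Qed.

(** By monotone convergence the sum of the series has integral at most 2, so it is finite almost
    everywhere and dominates each of its terms. *)
Lemma bounded_terms_ae (T : R) (f : nat -> R -> R) :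
  (forall j t, 0 <= f j t) -> (forall j, measurable_fun setT (f j)) ->
  (forall j, intb 0 T (f j)) -> (forall j, itg 0 T (f j) <= 2^-1 ^+ j) ->
  {ae mu, forall t, 0 < t <= T -> exists M : nat, forall j, f j t <= M%:R}.
Proof.
move=> f0 mf iff fle.
pose g t := (\sum_(j <oo) (f j t)%:E)%E.
have mfE j : measurable_fun `]0, T]%classic (fun t => (f j t)%:E).
  by apply/measurable_EFinP; exact: measurable_funS (mf j).
have intg : (\int[mu]_(t in `]0%R, T]) g t <= 2%:E)%E.
  rewrite integral_nneseries//; last by move=> j t _; rewrite lee_fin.
  apply: le_trans (_ : \sum_(j <oo) (2^-1 ^+ j)%:E <= _)%E.
    apply: lee_nneseries => [j _ _|j _]; first by apply: integral_ge0 => t _; rewrite lee_fin.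
    move: (fle j); rewrite -lee_fin /itg /Rintegral fineK//.
    exact: (integrable_fin_num (measurable_oc 0 T) (iff j)).
  apply: lime_le; first by apply: is_cvg_nneseries => j _ _; rewrite lee_fin exprn_ge0.
  apply: nearW => k; rewrite big_mkord sumEFin lee_fin.
  suff -> : \sum_(j < k) 2^-1 ^+ j = 2 - 2 * 2^-1 ^+ k :> R.
    by rewrite lerBlDr lerDl mulr_ge0// exprn_ge0.
  elim: k => [|k IH]; first by rewrite big_ord0 expr0 mulr1 subrr.
  by rewrite big_ord_recr /= IH exprS; field.
have mg : measurable_fun `]0, T]%classic g.
  by apply: ge0_emeasurable_sum => [j t _ _|j _]; [rewrite lee_fin|exact: mfE].
have ig : mu.-integrable `]0, T]%classic g.
  apply/integrableP; split => //.
  have -> : (\int[mu]_(t in `]0%R, T]) `|g t| = \int[mu]_(t in `]0%R, T]) g t)%E.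
    apply: eq_integral => t _; rewrite gee0_abs//.
    by apply: nneseries_ge0 => j _ _; rewrite lee_fin.
  by apply: le_lt_trans intg _; rewrite ltry.
apply: ae_imp (integrable_ae (measurable_oc 0 T) ig) => t h t0T.
have gfin : g t \is a fin_num by apply: h; rewrite /= in_itv.
exists (Num.bound (fine (g t))) => j.
have g0 : (0 <= g t)%E by apply: nneseries_ge0 => k _ _; rewrite lee_fin.
apply: (@le_trans _ _ (fine (g t))); last exact/ltW/archi_boundP/fine_ge0.
rewrite -lee_fin fineK//.
apply: le_trans (nneseries_lim_ge j.+1 _); last by move=> k _ _; rewrite lee_fin.
rewrite big_mkord big_ord_recr /= leeDr// sume_ge0// => k _; by rewrite lee_fin.
Qed.

(** Multiplied by [4^j], the squared increments have integrals at most [2^-j], hence are bounded in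
    [j] at almost every time; the increments themselves are then [O(2^-j)]. *)
Lemma fast_cauchy_limit (q : nat -> H) (T : R) (u : nat -> R -> H) : dense_seq q ->
  (forall j, wmeas ip (u j)) ->
  (forall j, intb 0 T (fun t => `|u j.+1 t - u j t| ^+ 2)) ->
  (forall j, itg 0 T (fun t => `|u j.+1 t - u j t| ^+ 2) <= 8^-1 ^+ j) ->
  exists v, [/\ wmeas ip v, {ae mu, forall t, 0 < t <= T -> u j t @[j --> \oo] --> v t} &
    forall K, 0 <= K -> (forall j t, `|u j t| <= K) -> forall t, `|v t| <= K].
Proof.
move=> dq mu_ iu itgu.
pose d j t := `|u j.+1 t - u j t|.
have md j : measurable_fun setT (d j) by apply: (wmeas_norm hip dq); exact: (wmeasB hip).
pose f j t := 4 ^+ j * d j t ^+ 2.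
have mf j : measurable_fun setT (f j).
  by apply: measurable_funM; [exact: measurable_cst|exact: measurable_funX].
have f0 j t : 0 <= f j t by rewrite mulr_ge0 ?sqr_ge0 ?exprn_ge0.
have iff j : intb 0 T (f j) by exact: (intbZ (4 ^+ j) (iu j)).
have fle j : itg 0 T (f j) <= 2^-1 ^+ j.
  rewrite /f (itgZ _ (iu j)); apply: (@le_trans _ _ (4 ^+ j * 8^-1 ^+ j)).
    by rewrite ler_wpM2l ?exprn_ge0.
  by rewrite -exprMn (_ : 4 * 8^-1 = 2^-1)//; field.
pose G := [set t | exists M : nat, forall j, f j t <= M%:R].
have mG : measurable G.
  have -> : G = \bigcup_M \bigcap_j [set t | f j t <= M%:R].
    apply/seteqP; split => t /=; first by move=> [M hM]; exists M => // j _; exact: hM.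
    by move=> [M _ hM]; exists M => j; exact: (hM j I).
  apply: bigcupT_measurable => M; apply: bigcapT_measurable => j.
  by apply: measurable_le_fun => //; exact: measurable_cst.
(* Cutting off outside [G] makes the sequence converge at every time, so the limit is measurable and
   bounded everywhere. *)
pose uG j t := \1_G t *: u j t.
have cG t : cvgn (uG ^~ t).
  have [[M fM]|nG] := pselect (G t); last first.
    have -> : uG ^~ t = fun=> 0.
      by apply/funext => j; rewrite /uG indicE memNset// scale0r.
    exact: is_cvg_cst.
  have -> : uG ^~ t = u ^~ t.
    by apply/funext => j; rewrite /uG indicE mem_set ?scale1r//; exists M.
  (* The factor [M + 1] replaces the square root of [M], as [M <= (M + 1)^2]. *)
  apply: (@geometric_increments_cvg _ (M%:R + 1)) => j; rewrite -/(d j t).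
  have fj := fM j; rewrite /f in fj.
  have dj : 0 <= d j t by exact: normr_ge0.
  rewrite -ler_sqr ?nnegrE ?mulr_ge0 ?addr_ge0 ?exprn_ge0//.
  have e4 : (2^-1 ^+ j) ^+ 2 = (4 ^+ j)^-1 :> R.
    by rewrite -exprM mulnC exprM -[RHS]exprVn; congr (_ ^+ _); rewrite expr2; field.
  rewrite exprMn e4 ler_pdivlMr ?exprn_gt0// mulrC; apply: (le_trans fj).
  by have M0 : (0 : R) <= M%:R by []; move: (M%:R : R) M0 => m m0; nra.
exists (fun t => limn (uG ^~ t)); split.
- by apply: (wmeas_cvg hip (u := uG)) => // j; apply: (wmeasZ hip); [exact: measurable_indic|exact: mu_].
- apply: ae_imp (bounded_terms_ae f0 mf iff fle) => t h tT.
  have -> : u ^~ t = uG ^~ t; last exact: cG.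
  by apply/funext => j; rewrite /uG indicE mem_set ?scale1r//; exact: h.
- move=> K K0 uK t; have hl : `|uG j t| @[j --> \oo] --> `|limn (uG ^~ t)|.
    by apply: cvg_norm; exact: cG.
  apply: (cvgn_le hl) => j; rewrite /uG normrZ indicE.
  by case: (t \in G); rewrite ?normr1 ?mul1r// normr0 mul0r.
Qed.

End FastLimit.

(** * The catching-up scheme *)

Lemma three_eps_le (R : realFieldType) (a b k m p n1 n2 e : R) :
  a < e / 3 -> b < e / 3 -> k < e / 3 -> m <= p + k -> n1 <= a + m -> n2 <= n1 + b ->
  n2 <= p + e.
Proof. lra. Qed.

Lemma radius_le_half (R : realFieldType) (r d e h k eps : R) : 0 < e -> r < d + e -> d <= h + e ->
  e <= eps / 8 -> k <= eps / 8 -> h <= k -> r <= eps / 2.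
Proof. lra. Qed.

Lemma sum_eighths_le_half (R : realFieldType) (e k eps : R) : 0 < e -> e <= eps / 8 -> k <= eps / 8 ->
  e + k <= eps / 2.
Proof. lra. Qed.

Lemma lt_of_half_margin (R : realFieldType) (r s eps d : R) :
  r <= s + eps -> s < d / 2 -> 2 * eps <= d -> r < d.
Proof. lra. Qed.

Lemma residual_le (R : realFieldType) (A B D E G eps f : R) : A = B + D ->
  `|A - E| <= eps / 8 * f -> `|D| <= 3 * (eps / 8) * f -> `|G| <= eps / 8 * f ->
  0 <= eps * f -> `|B - G - E| <= eps * f.
Proof.
move=> AE; rewrite !ler_norml => /andP[a1 a2] /andP[d1 d2] /andP[g1 g2] e0.
apply/andP; split; lra.
Qed.

Lemma distance_budget_le (R : realFieldType) (a b c Lv d1 d2 h k e : R) :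
  `|b - c| <= Lv -> `|a - b| <= d1 -> Lv <= d1 + d2 -> d1 <= e / 4 -> d2 <= k -> c <= h ->
  h <= k -> k <= e / 4 -> a <= e.
Proof. by rewrite !ler_norml => /andP[_ p1] /andP[_ p2] *; lra. Qed.

Lemma norm_midpoint_le (R : realFieldType) (X A B e : R) : `|X - B| <= e -> `|X - A| <= e ->
  `|X - 2^-1 * (A + B)| <= e.
Proof. by rewrite !ler_norml => /andP[? ?] /andP[? ?]; apply/andP; split; lra. Qed.

Section Scheme.
Context {R : realType} {H : completeNormedModType R}.
Variable ip : H -> H -> R.
Hypothesis hip : inner_product ip.
Variable q : nat -> H.
Hypothesis dq : dense_seq q.
Local Notation mu := (@lebesgue_measure R).

Variables (T : R) (C : R -> H -> set H) (x0 : H) (z c0 S : R -> R) (L : R).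
Hypothesis T0 : 0 < T.
Hypothesis Cval : forall t x, Icc 0 T t -> C t x !=set0 /\ closed (C t x).
Hypothesis CLip : forall s t x y v, 0 <= s -> s <= t -> t <= T ->
  `|dist v (C t x) - dist v (C s y)| <= itg s t z + L * `|x - y|.
Hypothesis Ccomp : forall t (r : R) (A : set H), Icc 0 T t -> 0 < r ->
  bounded_subset A -> compact (closure (mimage (C t) A `&` rball r)).
Hypothesis Cx0 : C 0 x0 x0.
Hypotheses (L0 : 0 <= L) (L1 : L < 1).
Hypotheses (z0 : forall t, 0 <= z t) (mz : measurable_fun setT z) (iz : intb 0 T z).
Hypotheses (c00 : forall t, 0 <= c0 t) (mc0 : measurable_fun setT c0) (ic0 : intb 0 T c0).
Hypotheses (S0 : forall t, 0 <= S t) (mS : measurable_fun setT S) (iS : intb 0 T S).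

Variable fs : H -> R -> H.
Hypothesis mfs : forall v, wmeas ip (fs v).
Hypothesis fs_le : forall v t, `|fs v t| <= c0 t * (1 + `|v|).

(* [Hop y t] stands for [\int_0^t g (t, s, y s) ds]. *)
Variable Hop : (R -> H) -> R -> H.
Hypothesis mHop : forall y, wmeas ip y -> wmeas ip (Hop y).
Hypothesis Hop_causal : forall y y' t, 0 < t <= T ->
  (forall s, 0 < s <= t -> y s = y' s) -> Hop y t = Hop y' t.
Hypothesis Hop_le : forall y t r, 0 < t <= T -> wmeas ip y -> 0 <= r ->
  (forall s, 0 < s <= t -> `|y s| <= r) -> `|Hop y t| <= S t * (1 + r).

(** Over one cell the clock advance [h] dominates twice the integral of [c0 + S] plus that of [z],
    which is what one projection step costs. *)
Definition weight t := 1 + 2 * (c0 t + S t) + z t.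

Lemma weight_ge1 t : 1 <= weight t.
Proof. by rewrite /weight -addrA lerDl addr_ge0// mulr_ge0// addr_ge0. Qed.

Lemma measurable_weight : measurable_fun setT weight.
Proof.
apply: measurable_funD => //; apply: measurable_funD; first exact: measurable_cst.
by apply: measurable_funM; [exact: measurable_cst|exact: measurable_funD].
Qed.

Lemma intb_weight : intb 0 T weight.
Proof.
apply: intbD => //; apply: intbD; first exact: intb_const.
by apply: intbZ; exact: intbD.
Qed.

Local Notation w := weight.
Local Notation w1 := weight_ge1.
Local Notation iw := intb_weight.
Local Notation psi := (psi T w).

(** A displacement is at most a new contribution plus [L] times the previous one; [kapE] says that
    [kap] absorbs the geometric series. *)
Definition kap := (1 - L)^-1.

Lemma kap_ge1 : 1 <= kap. Proof. by rewrite /kap invf_ge1 ?subr_gt0// lerBlDr lerDl. Qed.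
Lemma kapE : 1 + L * kap = kap.
Proof. by rewrite /kap; field; rewrite subr_eq0 gt_eqF. Qed.

Section FixedMesh.
Variable n : nat.
Local Notation h := (mesh T w n).
Local Notation tau := (node T0 w1 iw n).
Local Notation idx := (idx T w n).

Definition step_fun (X : nat -> H) (t : R) : H := X (idx t).

(* Truncation at [j] makes the recursion explicit: by causality the later [X i] are irrelevant. *)
Definition drift (X : nat -> H) (j : nat) (s : R) : H :=
  fs (X j) s + Hop (fun r => X (minn (idx r) j)) s.

Definition forcing (X : nat -> H) (j : nat) : H :=
  vint ip mu `]tau j, tau j.+1]%classic (drift X j).

(** Projection expressed by minimality, since a nearest point of a nonconvex set need not be
    unique. *)
Definition catching_up (X : nat -> H) (j : nat) :=
  C (tau j.+1) (X j) (X j.+1) /\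
  forall y, C (tau j.+1) (X j) y -> `|X j + forcing X j - X j.+1| <= `|X j + forcing X j - y|.

Lemma nodeI j : Icc 0 T (tau j). Proof. exact: nodeP. Qed.

Lemma wmeas_trunc (X : nat -> H) j : wmeas ip (fun r => X (minn (idx r) j)).
Proof.
apply: (wmeas_glue (u := fun i _ => X (minn i j)) (idx := idx)).
  by move=> i; exact: measurable_idx T0 w1 iw n i.
by move=> i; exact: wmeas_cst.
Qed.

Lemma wmeas_step (X : nat -> H) : wmeas ip (step_fun X).
Proof.
apply: (wmeas_glue (u := fun i _ => X i) (idx := idx)).
  by move=> i; exact: measurable_idx T0 w1 iw n i.
by move=> i; exact: wmeas_cst.
Qed.

Lemma scheme_exists i : exists X, X 0%N = x0 /\ forall j, (j < i)%N -> catching_up X j.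
Proof.
elim: i => [|i [X [X0 XP]]]; first by exists (fun=> x0).
have [Cn0 Cc] := Cval (X i) (nodeI i.+1).
have [p Cp pmin] : exists2 p, C (tau i.+1) (X i) p &
    forall y, C (tau i.+1) (X i) y -> `|X i + forcing X i - p| <= `|X i + forcing X i - y|.
  apply: nearest_exists => // r r0.
  have := @Ccomp (tau i.+1) r [set X i] (nodeI i.+1) r0.
  rewrite /mimage bigcup_set1; apply.
  by exists `|X i| => x ->.
(* Only the value at [i.+1] is new; forcings up to step [i] depend on values up to [i] alone, so the
   earlier steps remain valid. *)
pose X' k := if (k <= i)%N then X k else p.
have X'E k : (k <= i)%N -> X' k = X k by rewrite /X' => ->.
have forcingE j : (j <= i)%N -> forcing X' j = forcing X j.
  move=> ji; rewrite /forcing; congr (vint _ _ _ _); apply/funext => s.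
  rewrite /drift X'E//; congr (_ + Hop _ _); apply/funext => r.
  by rewrite X'E// (leq_trans _ ji)// geq_minr.
exists X'; split; first by rewrite X'E.
move=> j; rewrite ltnS leq_eqVlt => /orP[/eqP ->|ji].
  have eS : X' i.+1 = p by rewrite /X' ltnn.
  by split; rewrite ?eS X'E// => y Cy; rewrite forcingE//; exact: pmin.
have := XP j ji; rewrite /catching_up !X'E ?(ltnW ji)//.
by rewrite forcingE// ltnW.
Qed.

(** The discrete Gronwall majorant of [1 + |X j|]: each step multiplies it by [1 + kap h]. *)
Definition growth j := (1 + `|x0|) * (1 + kap * h) ^+ j.

Lemma h_gt0 : 0 < h. Proof. exact: mesh_gt0 T0 w1 iw n. Qed.

Lemma kaph_ge0 : 0 <= kap * h.
Proof. by rewrite mulr_ge0 ?(ltW h_gt0)// (le_trans ler01 kap_ge1). Qed.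

Lemma growth_ge1 j : 1 <= growth j.
Proof.
rewrite /growth -[leLHS]mulr1 ler_pM//; first by rewrite lerDl.
by apply: exprn_ege1; rewrite lerDl kaph_ge0.
Qed.

Lemma growthS j : growth j.+1 = growth j + growth j * kap * h.
Proof. by rewrite /growth exprSr; ring. Qed.

Lemma growth_nd i j : (i <= j)%N -> growth i <= growth j.
Proof.
move=> ij; rewrite /growth ler_pM2l ?ltr_pwDl//.
by apply: ler_weXn2l => //; rewrite lerDl kaph_ge0.
Qed.

Definition growth_max := (1 + `|x0|) * expR (kap * psi T).

(** From [1 + a <= exp a] and [(n + 1) h = psi T]: the bound no longer depends on the mesh. *)
Lemma growth_le j : (j <= n.+1)%N -> growth j <= growth_max.
Proof.
move=> /growth_nd /le_trans; apply; rewrite /growth /growth_max ler_pM2l ?ltr_pwDl//.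
rewrite -(@meshE R T w n) [X in expR X]mulrA [X in expR X]mulrC expRM_natl.
by apply: lerXn2r; rewrite ?nnegrE ?expR_ge0 ?addr_ge0 ?kaph_ge0// expR_ge1Dx.
Qed.

Section Bounds.
Variable X : nat -> H.
Hypothesis X0 : X 0%N = x0.
Hypothesis XP : forall j, (j <= n)%N -> catching_up X j.

Lemma tau_facts j : (j <= n)%N -> [/\ 0 <= tau j, tau j <= tau j.+1 & tau j.+1 <= T].
Proof.
move=> jn; have /andP[h1 _] := nodeP T0 w1 iw n j.
have /andP[_ h2] := nodeP T0 w1 iw n j.+1.
by split => //; apply/ltW/node_lt.
Qed.

Lemma wmeas_drift j : wmeas ip (drift X j).
Proof. by apply: (wmeasD hip) => //; apply: mHop; exact: wmeas_trunc. Qed.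

Lemma drift_le j : (j <= n)%N -> (forall k, (k <= j)%N -> 1 + `|X k| <= growth j) ->
  forall s, tau j < s <= tau j.+1 -> `|drift X j s| <= growth j * (c0 s + S s).
Proof.
move=> jn Xj s /andP[s1 s2]; have [t1 t2 t3] := tau_facts jn.
apply: (le_trans (ler_normD _ _)); rewrite mulrDr; apply: lerD.
  apply: (le_trans (fs_le _ _)); rewrite mulrC ler_wpM2r//; exact: Xj.
(* The radius [growth j - 1] makes the factor [1 + r] equal to [growth j]. *)
have := @Hop_le (fun r => X (minn (idx r) j)) s (growth j - 1).
rewrite subrKC mulrC; apply => //.
- by rewrite (le_lt_trans t1 s1) (le_trans s2).
- exact: wmeas_trunc.
- by rewrite subr_ge0 growth_ge1.
- by move=> r _; rewrite lerBrDl Xj// geq_minr.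
Qed.

Lemma forcing_spec j : (j <= n)%N -> (forall k, (k <= j)%N -> 1 + `|X k| <= growth j) ->
  [/\ intb (tau j) (tau j.+1) (fun s => `|drift X j s|),
      `|forcing X j| <= growth j * itg (tau j) (tau j.+1) (fun s => c0 s + S s) &
      forall e, ip (forcing X j) e = itg (tau j) (tau j.+1) (fun s => ip (drift X j s) e)].
Proof.
move=> jn Xj; have [t1 t2 t3] := tau_facts jn.
have icS : intb (tau j) (tau j.+1) (fun s => c0 s + S s).
  by apply: (intb_sub t1 t3); exact: intbD.
have i2 := intbZ (growth j) icS.
have dl := drift_le jn Xj.
have i1 : intb (tau j) (tau j.+1) (fun s => `|drift X j s|).
  apply: (@intb_le _ _ _ _ (fun s => growth j * (c0 s + S s))) => //.
    by apply: (wmeas_norm hip dq); exact: wmeas_drift.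
  by move=> s; rewrite normr_id; exact: dl.
split => //.
- have hf : `|forcing X j| <= itg (tau j) (tau j.+1) (fun s => `|drift X j s|).
    exact: (ler_norm_vint hip (measurable_oc _ _) (wmeas_drift j) i1).
  by apply: (le_trans hf); rewrite -itgZ//; exact: itg_le.
- by move=> e; rewrite /forcing vintP//; exact: wmeas_drift.
Qed.

(** Size and displacement need each other, hence the joint induction. Since [X j] lies in
    [C (tau j) (X j.-1)] for [j > 0], its distance to the next set is at most the integral of [z]
    plus [L] times the last displacement; adding twice the forcing gives
    [growth j * (1 + L kap) * h], that is [growth j * kap * h]. *)
Lemma scheme_bounds j : (j <= n.+1)%N ->
  (forall k, (k <= j)%N -> 1 + `|X k| <= growth k) /\
  forall i, (i < j)%N -> `|X i.+1 - X i| <= growth i * kap * h.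
Proof.
elim: j => [_|j IH jn].
  split => // k; rewrite leqn0 => /eqP ->.
  by rewrite X0 /growth expr0 mulr1.
have [Xk Xd] := IH (ltnW jn); rewrite ltnS in jn.
have Xkj k : (k <= j)%N -> 1 + `|X k| <= growth j.
  by move=> kj; apply: (le_trans (Xk k kj)); exact: growth_nd.
have [t1 t2 t3] := tau_facts jn.
have [_ fle _] := forcing_spec jn Xkj.
have [Cj Cmin] := XP jn.
have [Cn0 _] := Cval (X j) (nodeI j.+1).
have icS : intb (tau j) (tau j.+1) (fun s => c0 s + S s).
  by apply: (intb_sub t1 t3); exact: intbD.
have izj : intb (tau j) (tau j.+1) z by apply: (intb_sub t1 t3).
have g1 := growth_ge1 j.
have dle : dist (X j) (C (tau j.+1) (X j)) <=
    itg (tau j) (tau j.+1) z + L * (growth j * kap * h).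
  have jn' := jn.
  (* At [j = 0] there is no previous step; [x0] belonging to [C 0 x0] plays its part. *)
  case: j {IH jn Xkj fle icS Cmin} jn' Xk Xd t1 t2 t3 Cj Cn0 izj g1 => [|j] jn' Xk Xd t1 t2 t3 Cj Cn0 izj g1.
    have := CLip (X 0%N) (X 0%N) (X 0%N) t1 t2 t3.
    rewrite subrr normr0 mulr0 addr0.
    have -> : dist (X 0%N) (C (tau 0) (X 0%N)) = 0 by rewrite node0 X0 dist_mem.
    rewrite subr0 => /(le_trans (ler_norm _)) /le_trans; apply.
    by rewrite lerDl mulr_ge0// -mulrA mulr_ge0 ?kaph_ge0// (le_trans ler01 g1).
  have := CLip (X j.+1) (X j) (X j.+1) t1 t2 t3.
  have -> : dist (X j.+1) (C (tau j.+1) (X j)) = 0.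
    by apply: dist_mem; have [] := XP (ltnW jn').
  rewrite subr0 => /(le_trans (ler_norm _)) /le_trans; apply; rewrite lerD2l ler_wpM2l//.
  apply: (le_trans (Xd j (ltnSn j))).
  by rewrite -2!mulrA; apply: ler_wpM2r; [exact: kaph_ge0|exact: growth_nd].
have inc : `|X j.+1 - X j| <= growth j * kap * h.
  (* Near minimisers of the distance from [X j] compete with the projection, which yields the
     forcing a first time; [d2] yields it a second time. *)
  have d1 : `|X j + forcing X j - X j.+1| <= `|forcing X j| + dist (X j) (C (tau j.+1) (X j)).
    apply/ler_addgt0Pr => e e0; have [y Cy yd] := dist_adherent (X j) Cn0 e0.
    apply: (le_trans (Cmin y Cy)).
    rewrite addrAC addrC -addrA; apply: (le_trans (ler_normD _ _)); rewrite lerD2l.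
    exact: ltW.
  have d2 : `|X j.+1 - X j| <= `|forcing X j| + `|X j + forcing X j - X j.+1|.
    have -> : X j.+1 - X j = forcing X j - (X j + forcing X j - X j.+1).
      by rewrite opprB addrCA opprD addrA [X in _ = _ + X]addrC addrA addrK addrC.
    exact: ler_normB.
  have iw' := itg_node T0 w1 iw jn.
  have hw : itg (tau j) (tau j.+1) w >=
      2 * itg (tau j) (tau j.+1) (fun s => c0 s + S s) + itg (tau j) (tau j.+1) z.
    rewrite -itgZ// -itgD//; last exact: intbZ.
    apply: itg_le; [apply: intbD => //; exact: intbZ|apply: intb_sub iw => //|].
    by move=> t _; rewrite /weight -addrA lerDr.
  rewrite iw' in hw.
  have zg : itg (tau j) (tau j.+1) z <= growth j * itg (tau j) (tau j.+1) z.
    by rewrite ler_peMl// itg_ge0.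
  have gw : growth j * (2 * itg (tau j) (tau j.+1) (fun s => c0 s + S s)
      + itg (tau j) (tau j.+1) z) <= growth j * h.
    by rewrite ler_wpM2l// (le_trans ler01 g1).
  have -> : growth j * kap * h = growth j * h + L * (growth j * kap * h).
    by rewrite -{1}kapE; ring.
  move: gw; rewrite mulrDr; lra.
split.
- move=> k; rewrite leq_eqVlt => /orP[/eqP ->|]; last by rewrite ltnS; exact: Xk.
  rewrite growthS -(subrK (X j) (X j.+1)) addrC.
  have := ler_normD (X j.+1 - X j) (X j); have := Xk j (leqnn j); move: inc; lra.
- by move=> i; rewrite ltnS leq_eqVlt => /orP[/eqP ->|/Xd].
Qed.

Lemma growth_max_ge1 : 1 <= growth_max.
Proof. exact: le_trans (growth_ge1 0) (growth_le (leq0n _)). Qed.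

Lemma scheme_le k : (k <= n.+1)%N -> `|X k| <= growth_max.
Proof.
move=> kn; have [+ _] := scheme_bounds (leqnn n.+1).
move=> /(_ k kn) /le_trans /(_ (growth_le kn)); apply: le_trans.
by rewrite lerDr.
Qed.

Lemma scheme_increment_le j : (j <= n)%N ->
  `|X j.+1 - X j| <= growth_max * (1 + kap) * h.
Proof.
move=> jn; have [_ +] := scheme_bounds (leqnn n.+1).
move=> /(_ j jn) /le_trans; apply.
have gj := growth_le (leqW jn); have g1 := growth_ge1 j.
rewrite ler_pM2r ?h_gt0//; apply: ler_pM => //.
- exact: le_trans ler01 g1.
- exact: le_trans ler01 kap_ge1.
- by rewrite lerDr.
Qed.

Lemma scheme_forcing j : (j <= n)%N ->
  [/\ `|X j + forcing X j - X j.+1| <= growth_max * (1 + kap) * h,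
   forall e, ip (forcing X j) e = itg (tau j) (tau j.+1) (fun s => ip (drift X j s) e) &
   intb (tau j) (tau j.+1) (fun s => `|drift X j s|)].
Proof.
move=> jn; have [Xk Xd] := scheme_bounds (leqnn n.+1).
have Xkj k : (k <= j)%N -> 1 + `|X k| <= growth j.
  move=> kj; apply: (le_trans (Xk k _)); last exact: growth_nd.
  by rewrite (leq_trans kj)// (leqW jn).
have [i1 fle fE] := forcing_spec jn Xkj; split => //.
have [t1 t2 t3] := tau_facts jn.
have icS : intb (tau j) (tau j.+1) (fun s => c0 s + S s).
  by apply: (intb_sub t1 t3); exact: intbD.
have hw : itg (tau j) (tau j.+1) (fun s => c0 s + S s) <= h.
  rewrite -(itg_node T0 w1 iw jn); apply: itg_le => //; first exact: intb_sub iw.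
  move=> t _; have := c00 t; have := S0 t; have := z0 t; rewrite /weight; lra.
have gj := growth_le (leqW jn); have g1 := growth_ge1 j.
have -> : X j + forcing X j - X j.+1 = forcing X j - (X j.+1 - X j).
  by rewrite opprB addrA [X j + _]addrC.
apply: (le_trans (ler_normB _ _)); rewrite mulrDr mulr1 mulrDl; apply: lerD.
  apply: (le_trans fle); apply: ler_pM => //; first exact: le_trans ler01 g1.
  by apply: itg_ge0 => t _; rewrite addr_ge0.
apply: (le_trans (Xd j jn)); rewrite ler_pM2r ?h_gt0// ler_pM2r//.
exact: lt_le_trans ltr01 kap_ge1.
Qed.

Lemma scheme_normal j : (j <= n)%N ->
  clarke_normal ip (C (tau j.+1) (X j)) (X j.+1) (X j + forcing X j - X j.+1).
Proof. by move=> jn; have [h1 h2] := XP jn; exact: nearest_clarke_normal. Qed.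

(** Up to a time of cell [j] the cell number never exceeds [j], so the truncation is invisible to a
    causal operator. *)
Lemma drift_step j s : (j <= n)%N -> tau j < s <= tau j.+1 ->
  drift X j s = fs (X j) s + Hop (step_fun X) s.
Proof.
move=> jn /andP[s1 s2]; rewrite /drift; congr (_ + _).
have [t1 t2 t3] := tau_facts jn.
apply: Hop_causal; first by rewrite (le_lt_trans t1 s1) (le_trans s2).
move=> r /andP[r0 rs].
have hr : 0 < r <= T by rewrite r0 (le_trans rs)// (le_trans s2).
have [rn /andP[r1 r2]] := idxP T0 w1 iw n hr.
rewrite /step_fun (minn_idPl _)// leqNgt; apply/negP => jr.
have : tau j.+1 <= tau (idx r).
  move: jr; rewrite leq_eqVlt => /orP[/eqP <-|jr]; first exact: lexx.
  by apply/ltW/node_lt => //; exact: leqW.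
move=> /le_lt_trans /(_ r1); rewrite ltNge => /negP; apply.
exact: le_trans s2.
Qed.

End Bounds.
End FixedMesh.

Lemma scheme_family : exists X : nat -> nat -> H,
  forall n, X n 0%N = x0 /\ forall j, (j <= n)%N -> catching_up n (X n) j.
Proof.
have /choice[X XP] n : exists X : nat -> H,
    X 0%N = x0 /\ forall j, (j < n.+1)%N -> catching_up n X j by exact: scheme_exists.
by exists X.
Qed.

Variable X : nat -> nat -> H.
Hypothesis XP : forall n, X n 0%N = x0 /\ forall j, (j <= n)%N -> catching_up n (X n) j.

Local Notation Mx := growth_max.
Local Notation h := (mesh T w).
Local Notation tau := (node T0 w1 iw).
Local Notation idx := (idx T w).

(** One constant for the displacement per mesh and for both scaled velocities [a_] and [b_]. *)
Definition lipK := growth_max * (1 + kap).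
Local Notation K := lipK.

Lemma lipK_ge1 : 1 <= K.
Proof.
have g1 := growth_max_ge1 0; have k1 := kap_ge1.
rewrite /lipK -[leLHS]mulr1; apply: ler_pM => //.
by rewrite lerDl (le_trans ler01).
Qed.

Let K0 : 0 < K. Proof. exact: lt_le_trans ltr01 lipK_ge1. Qed.
Let Mx_ge1 : 1 <= Mx. Proof. exact: growth_max_ge1 0. Qed.
Let Mx0 : 0 < Mx. Proof. exact: lt_le_trans ltr01 Mx_ge1. Qed.

Definition xbar n t := step_fun n (X n) t.

Lemma psi_clip t : psi (clip T t) = psi t.
Proof. by rewrite /psi (clip_id (clipP T0 t)). Qed.

Lemma idx_clip n t : idx n (clip T t) = idx n t.
Proof. by rewrite /idx /first_index /= psi_clip. Qed.

Lemma xbar_clip n t : xbar n (clip T t) = xbar n t.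
Proof. by rewrite /xbar /step_fun idx_clip. Qed.

Lemma mesh_small (e : R) : 0 < e -> exists N, forall n, (N <= n)%N -> h n < e.
Proof.
move=> e0; exists (Num.bound (psi T / e)) => n Nn; rewrite /mesh ltr_pdivrMr// mulrC -ltr_pdivrMr//.
apply: (lt_trans (archi_boundP _)); first by rewrite divr_ge0 ?(ltW e0)// (ltW (psiT_gt0 T0 w1 iw)).
by rewrite ltr_nat ltnS.
Qed.

Lemma idx0 n : idx n 0 = 0%N.
Proof.
have [_ h2] := idx_first T0 w1 iw n 0.
case: (idx n 0) h2 => // i /(_ 0%N (ltn0Sn i)); rewrite (psi0 _ T0) => h3.
by exfalso; apply: h3; rewrite mulr_ge0// (ltW (h_gt0 n)).
Qed.

Lemma idx_le n t : 0 <= t <= T -> (idx n t <= n)%N.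
Proof.
move=> /andP[]; rewrite le_eqVlt => /orP[/eqP <-|t0] tT; first by rewrite idx0.
have ht : 0 < t <= T by rewrite t0.
by have [] := idxP T0 w1 iw n ht.
Qed.

Lemma idx_node_ge n t : 0 <= t <= T -> tau n (idx n t) <= t.
Proof.
move=> /andP[]; rewrite le_eqVlt => /orP[/eqP <-|t0] tT; first by rewrite idx0 node0.
have ht : 0 < t <= T by rewrite t0.
by have [_ /andP[/ltW]] := idxP T0 w1 iw n ht.
Qed.

Lemma psi_idx n t : 0 <= t <= T ->
  (idx n t)%:R * h n <= psi t <= (idx n t).+1%:R * h n.
Proof.
move=> tT; have [-> _] := idx_first T0 w1 iw n t; rewrite andbT.
have := psi_nd T0 w1 iw (idx_node_ge n tT); rewrite psi_node//.
by rewrite (leq_trans (idx_le n tT)).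
Qed.

Lemma xbar_le n t : 0 <= t <= T -> `|xbar n t| <= Mx.
Proof.
move=> tT; have [X0 Xc] := XP n; rewrite /xbar /step_fun.
apply: (scheme_le X0 Xc); exact: leqW (idx_le n tT).
Qed.

Lemma itg_z_le s t : 0 <= s -> s <= t -> t <= T -> itg s t z <= psi t - psi s.
Proof.
move=> s0 st tT; rewrite (psiB_in T0 iw s0 st tT); apply: itg_le.
- exact: intb_sub iz.
- exact: intb_sub iw.
- by move=> r _; rewrite /weight lerDr addr_ge0// mulr_ge0// addr_ge0.
Qed.

(** For a positive cell number the witness is the preceding iterate: the current one lies in its set
    at the last node, and moving that set to time [t] costs at most one mesh. In the first cell [x0]
    serves itself. *)
Lemma xbar_near_C n t : 0 <= t <= T -> exists v,
  [/\ `|v| <= Mx, `|v - xbar n t| <= K * h n & dist (xbar n t) (C t v) <= h n].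
Proof.
move=> tT; have [X0 Xc] := XP n; have /andP[t0 tT'] := tT.
have it := idx_node_ge n tT; have pi := psi_idx n tT.
have in_ := idx_le n tT.
have hp := h_gt0 n.
have dC v : C (tau n (idx n t)) v (xbar n t) -> dist (xbar n t) (C t v) <= h n.
  move=> Cv; have /andP[n0 _] := nodeP T0 w1 iw n (idx n t).
  have := CLip v v (xbar n t) n0 it tT'.
  rewrite (dist_mem Cv) subr0 subrr normr0 mulr0 addr0 => /(le_trans (ler_norm _)).
  move=> /le_trans; apply; apply: (le_trans (itg_z_le n0 it tT')).
  rewrite psi_node ?(leqW in_)//; move: pi => /andP[_]; rewrite -natr1; lra.
move: dC pi in_ {it}; rewrite /xbar /step_fun; case: (idx n t) => [|i] dC pi in_.
  exists x0; rewrite X0; split.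
  - by have := scheme_le X0 Xc (leq0n _); rewrite X0.
  - by rewrite subrr normr0 mulr_ge0 ?(ltW K0)// ltW.
  - by have := dC x0; rewrite X0 node0; apply.
exists (X n i); split.
- exact: (scheme_le X0 Xc (leqW (ltnW in_))).
- rewrite distrC; exact: (scheme_increment_le X0 Xc (ltnW in_)).
- by apply: dC; have [] := Xc i (ltnW in_).
Qed.

Lemma scheme_chain_le n i k : (i + k <= n.+1)%N -> `|X n (i + k) - X n i| <= k%:R * (K * h n).
Proof.
have [X0 Xc] := XP n.
elim: k => [|k IH]; first by rewrite addn0 subrr normr0 mul0r.
rewrite addnS => ik; have := IH (ltnW ik).
have := scheme_increment_le X0 Xc ik; rewrite -/lipK -natr1.
have := ler_normD (X n (i + k).+1 - X n (i + k)) (X n (i + k) - X n i).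
rewrite addrA subrK mulrDl mul1r; lra.
Qed.

(** The mesh is added because a step function may jump between two times that are arbitrarily
    close. *)
Lemma xbar_modulus n s t : 0 <= s -> s <= t -> t <= T ->
  `|xbar n t - xbar n s| <= K * (psi t - psi s + h n).
Proof.
move=> s0 st tT.
have sI : 0 <= s <= T by rewrite s0 (le_trans st).
have tI : 0 <= t <= T by rewrite tT (le_trans s0).
have ij : (idx n s <= idx n t)%N.
  have [_ h2] := idx_first T0 w1 iw n s; have [h1 _] := idx_first T0 w1 iw n t.
  rewrite leqNgt; apply/negP => /h2; apply; exact: le_trans (psi_nd T0 w1 iw st) h1.
rewrite /xbar /step_fun -(subnKC ij).
apply: (le_trans (scheme_chain_le _)); first by rewrite subnKC// leqW// idx_le.
rewrite mulrCA ler_pM2l//.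
have /andP[p1 _] := psi_idx n tI; have /andP[_ p2] := psi_idx n sI.
move: p1 p2; rewrite natrB// -natr1.
rewrite mulrDl mulrBl mul1r.
by move=> p1 p2; rewrite lerBlDr -addrA (addrC (h n)) addrAC lerBrDr; exact: lerD p1 p2.
Qed.

(* (C3) puts all [xbar n t], up to [2 h n], in a relatively compact set; the uniform Lipschitz
   bound in the clock upgrades pointwise to uniform convergence. *)
Lemma ultrafilter_limit : exists x : R -> H,
  (forall s t, 0 <= s -> s <= t -> t <= T -> `|x t - x s| <= K * (psi t - psi s)) /\
  forall (e : R) N, 0 < e -> exists2 n, (N <= n)%N &
    forall t, 0 <= t <= T -> `|xbar n t - x t| <= e.
Proof.
have [U [UU sU]] := @ultraFilterLemma _ (\oo : set_system nat) _.
have UN N : U [set n | (N <= n)%N] by apply: sU; exists N.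
have Uh (e : R) : 0 < e -> U [set n | h n < e].
  by move=> e0; have [N NP] := mesh_small e0; apply: filterS (UN N) => n /=; exact: NP.
have : forall t, exists l, 0 <= t <= T -> forall e : R, 0 < e -> U [set n | `|xbar n t - l| < e].
  move=> t; have [tT|] := boolP (0 <= t <= T); last by exists 0.
  have /choice[y yP] n : exists y, `|xbar n t - y| < 2 * h n /\ mimage (C t) (rball Mx) y.
    have [v [v1 _ v3]] := xbar_near_C n tT.
    have [Cn0 _] := Cval v tT.
    have [y Cy yd] := dist_adherent (xbar n t) Cn0 (h_gt0 n).
    by exists y; split; [lra|exists v].
  pose r := Mx + 2 * h 0%N.
  have r0 : 0 < r by rewrite addr_gt0// mulr_gt0// h_gt0.
  have hn0 n : h n <= h 0%N.
    rewrite /mesh ler_pM2l; last exact: psiT_gt0 T0 w1 iw.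
    by rewrite lef_pV2 ?posrE// ler_nat.
  have kA := Ccomp tT r0 (_ : bounded_subset (rball Mx)).
  have {}kA : compact (closure (mimage (C t) (rball Mx) `&` rball r)).
    by apply: kA; exists Mx.
  set A := closure _ in kA.
  have yA n : A (y n).
    apply: subset_closure; split; first by case: (yP n).
    have [yn _] := yP n; rewrite /rball /= /r.
    have := ler_normB (xbar n t) (xbar n t - y n); rewrite opprB subrKC.
    have := xbar_le n tT; have := hn0 n; move: yn; lra.
  have yU : (y @ U) A.
    suff -> : (y @ U) A = U setT by exact: filterT.
    by congr U; apply/seteqP; split => // k _; exact: yA.
  have [l [_ lcl]] := kA (y @ U) _ yU.
  exists l => _ e e0.
  have e2 : 0 < e / 2 by rewrite divr_gt0.
  have e4 : 0 < e / 4 by rewrite divr_gt0.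
  have Ul : U [set n | `|y n - l| < e / 2].
    (* An ultrafilter contains this set or its complement, and the complement would contradict
       clustering at [l]: a cluster point is a limit. *)
    have [//|UC] := in_ultra_setVsetC [set n | `|y n - l| < e / 2] UU.
    have := lcl [set p | ~ (`|p - l| < e / 2)] (ball l (e / 2)) UC (nbhsx_ballx l _ e2).
    move=> [p [/= h1]]; rewrite -ball_normE /= distrC; by move/h1.
  apply: filterS2 Ul (Uh _ e4) => n /= h1 h2.
  have [h3 _] := yP n; have := ler_normD (xbar n t - y n) (y n - l).
  rewrite addrA subrK; lra.
move=> /choice[x xP]; exists x.
have UI : forall A B : set nat, U A -> U B -> U (A `&` B) by move=> A B; exact: filterI.
have Uex : forall A : set nat, U A -> A !=set0 by move=> A; exact: filter_ex.
have xmod s t : 0 <= s -> s <= t -> t <= T -> `|x t - x s| <= K * (psi t - psi s).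
  move=> s0 st tT.
  have sI : 0 <= s <= T by rewrite s0 (le_trans st).
  have tI : 0 <= t <= T by rewrite tT (le_trans s0).
  apply/ler_addgt0Pr => e e0; have e3 : 0 < e / 3 by rewrite divr_gt0.
  have e3K : 0 < e / 3 / K by rewrite divr_gt0.
  have [n [[/= n1 n2] n3]] := Uex _ (UI _ _ (UI _ _ (xP s sI _ e3) (xP t tI _ e3)) (Uh _ e3K)).
  rewrite /= distrC in n2.
  have := xbar_modulus n s0 st tT; rewrite mulrDr.
  have : K * h n < e / 3 by move: n3; rewrite /= ltr_pdivlMr// mulrC.
  have -> : x t - x s = x t - xbar n t + (xbar n t - xbar n s) + (xbar n s - x s).
    by rewrite !addrA !subrK.
  move=> Kn xm.
  exact: (three_eps_le n2 n1 Kn xm (ler_normD _ _) (ler_normD _ _)).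
split => // e N e0; have e4 : 0 < e / 4 by rewrite divr_gt0.
have e4K : 0 < e / 4 / K by rewrite divr_gt0.
(* A fixed coarse mesh [m] reduces the claim to its finitely many nodes. Of the four quarters of
   [e], two pay for the coarse mesh in the moduli of [xbar] and [x], one for the fine mesh, one for
   the error at the node. *)
have [m mP] := mesh_small e4K; have {mP} hm := mP m (leqnn m).
have Un k : U [set n | forall i, (i < k)%N -> `|xbar n (tau m i) - x (tau m i)| < e / 4].
  elim: k => [|k IH]; first by apply: filterS (UN 0%N) => n _ i.
  apply: filterS2 IH (xP (tau m k) (nodeP T0 w1 iw m k) _ e4) => n /= h1 h2 i.
  by rewrite ltnS leq_eqVlt => /orP[/eqP ->//|/h1].
have [n [[/= n1 n2] n3]] := Uex _ (UI _ _ (UI _ _ (UN N) (Un m.+1)) (Uh _ e4K)).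
exists n => // t tI.
have Kn : K * h n < e / 4 by move: n3; rewrite /= ltr_pdivlMr// mulrC.
have Km : K * h m < e / 4 by move: hm; rewrite /= ltr_pdivlMr// mulrC.
have im := idx_le m tI; have it := idx_node_ge m tI.
have /andP[i0 _] := nodeP T0 w1 iw m (idx m t); have /andP[t0 tT] := tI.
have pt : psi t - psi (tau m (idx m t)) <= h m.
  have /andP[_] := psi_idx m tI; rewrite psi_node ?(leqW im)// -natr1 mulrDl mul1r.
  by rewrite lerBlDl.
have d1 := xbar_modulus n i0 it tT.
have d2 := n2 (idx m t) im.
have d3 : `|x t - x (tau m (idx m t))| <= K * (psi t - psi (tau m (idx m t))) by exact: xmod.
have d4 : K * (psi t - psi (tau m (idx m t))) <= K * h m by rewrite ler_pM2l.
rewrite mulrDr in d1.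
have -> : xbar n t - x t = (xbar n t - xbar n (tau m (idx m t)))
    + (xbar n (tau m (idx m t)) - x (tau m (idx m t))) - (x t - x (tau m (idx m t))).
  by rewrite opprB !addrA !subrK.
apply: (le_trans (ler_normB _ _)).
have d5 := ler_normD (xbar n t - xbar n (tau m (idx m t)))
  (xbar n (tau m (idx m t)) - x (tau m (idx m t))).
lra.
Qed.

(** * Relaxed conditions on pairs of velocities *)

Hypothesis Hop_lip : forall r, 0 <= r -> exists m : R -> R,
  [/\ forall t, 0 <= m t, intb 0 T m &
   forall y y' (e : R), wmeas ip y -> wmeas ip y' -> 0 <= e ->
     (forall s, 0 < s <= T -> [/\ `|y s| <= r, `|y' s| <= r & `|y s - y' s| <= e]) ->
     forall t, 0 < t <= T -> `|Hop y t - Hop y' t| <= m t * e].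
Variable F : R -> H -> set H.
Hypothesis fsF : forall v, {ae mu, forall t, 0 < t <= T -> F t v (fs v t)}.

(** Subsmoothness with both parameters free, so that [approx_N] can speak of every pair that works
    and no modulus is chosen in advance. *)
Definition subsmooth_at (eta delta : R) :=
  forall t u x1 x2 v1 v2, Icc 0 T t -> C t u x1 -> C t u x2 -> `|x1 - x2| < delta ->
    clarke_normal ip (C t u) x1 v1 -> `|v1| <= 1 ->
    clarke_normal ip (C t u) x2 v2 -> `|v2| <= 1 ->
    - (eta * `|x1 - x2|) <= ip (v1 - v2) (x1 - x2).

(* The three conditions below are kept stable under midpoints in [a] and [b]; [approx_F] says
   that [w a] lies in the closed convex hull of [F t] on the [eps]-ball around [x t]. *)
Definition approx_F (x a : R -> H) (eps : R) :=
  {ae mu, forall t, 0 < t <= T -> forall e s,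
    (forall y, `|y - x t| <= eps -> forall v, F t y v -> ip v e <= s) ->
    ip (w t *: a t) e <= s}.

(** Dividing by [K] brings [b t] into the unit ball, whence [eta * K]; the terms in [eps] pay for
    reading at [x t] a vector normal at a nearby iterate. With [2 eps <= delta] the displaced points
    stay within [delta]. *)
Definition approx_N (x b : R -> H) (eps : R) :=
  forall t, 0 < t <= T -> forall eta delta, 0 < eta -> 0 < delta -> subsmooth_at eta delta ->
    2 * eps <= delta -> forall y, C t (x t) y -> `|y - x t| < delta / 2 ->
    ip (b t) (y - x t) <= eta * K * (`|y - x t| + eps) + K * eps.

Definition velocity (x a b : R -> H) (s : R) : H := w s *: a s - w s *: b s + Hop x s.

Definition approx_eq (x a b : R -> H) (eps : R) :=
  forall t e, 0 <= t <= T ->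
    `|ip (x t - x0) e - itg 0 t (fun s => ip (velocity x a b s) e)| <= eps * `|e|.

Let a_ n t := (w t)^-1 *: fs (X n (idx n t)) t.
(** The weight integrates to [h n] over a cell, so [w b_] integrates there to the whole projection
    residual. *)
Let b_ n t := (h n)^-1 *: (X n (idx n t) + forcing n (X n) (idx n t) - X n (idx n t).+1).

Let wpos t : 0 < w t. Proof. exact: lt_le_trans ltr01 (w1 t). Qed.

Lemma idx_le_n n t : (idx n t <= n)%N.
Proof. by rewrite -idx_clip idx_le// clipP. Qed.

Lemma wmeas_fs_idx n : wmeas ip (fun t => fs (X n (idx n t)) t).
Proof.
apply: (wmeas_glue (u := fun i => fs (X n i)) (idx := idx n)) => //.
by move=> i; exact: measurable_idx T0 w1 iw n i.
Qed.

Lemma measurable_winv : measurable_fun setT (fun t => (w t)^-1).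
Proof.
apply: measurable_fun_gt => y; have [y0|y0] := leP y 0.
  have -> : [set t | y < (w t)^-1] = setT; last exact: measurableT.
  by apply/seteqP; split => // t _ /=; rewrite (le_lt_trans y0)// invr_gt0.
have -> : [set t | y < (w t)^-1] = [set t | w t < y^-1].
  by apply/seteqP; split => t /=; rewrite -[y in y < _]invrK ltf_pV2 ?posrE ?invr_gt0.
by apply: measurable_lt_fun; [exact: measurable_weight|exact: measurable_cst].
Qed.

Lemma wmeas_a n : wmeas ip (a_ n).
Proof. by apply: (wmeasZ hip); [exact: measurable_winv|exact: wmeas_fs_idx]. Qed.

Lemma wmeas_b n : wmeas ip (b_ n).
Proof.
apply: (wmeas_glue (u := fun i _ => (h n)^-1 *: (X n i + forcing n (X n) i - X n i.+1))
  (idx := idx n)).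
  by move=> i; exact: measurable_idx T0 w1 iw n i.
by move=> i; exact: wmeas_cst.
Qed.

Lemma w_a n t : w t *: a_ n t = fs (X n (idx n t)) t.
Proof. by rewrite /a_ scalerA mulfV ?gt_eqF// scale1r. Qed.

(** [1 + r] is at most [2 Mx], and the factor 2 is absorbed by [2 (c0 + S) <= w]. *)
Lemma le_growth_w (c t r : R) : 0 <= r -> r <= Mx -> c <= (c0 t + S t) -> 0 <= c ->
  c * (1 + r) <= K * w t.
Proof.
move=> r0 rM cS c_0; apply: (@le_trans _ _ (Mx * w t)); last first.
  rewrite ler_pM2r// /lipK ler_peMr ?(ltW Mx0)// lerDl.
  exact: le_trans ler01 kap_ge1.
apply: (@le_trans _ _ (c * (2 * Mx))).
  apply: ler_wpM2l => //; have := Mx_ge1; move: rM; clear.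
  by move=> h1 h2; rewrite mulrDl mul1r lerD.
rewrite mulrA [leRHS]mulrC ler_pM2r//; apply: (@le_trans _ _ (2 * (c0 t + S t))).
  by rewrite mulrC ler_pM2l.
by rewrite /weight -addrA addrCA lerDl addr_ge0.
Qed.

Lemma a_le n t : `|a_ n t| <= K.
Proof.
rewrite /a_ normrZ gtr0_norm ?invr_gt0// mulrC ler_pdivrMr//.
apply: (le_trans (fs_le _ _)); apply: le_growth_w => //; last by rewrite lerDl.
have [X0 Xc] := XP n; apply: (scheme_le X0 Xc); exact: leqW (idx_le_n n t).
Qed.

Lemma b_le n t : `|b_ n t| <= K.
Proof.
have [X0 Xc] := XP n; rewrite /b_ normrZ gtr0_norm ?invr_gt0 ?h_gt0// mulrC ler_pdivrMr ?h_gt0//.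
by have [] := scheme_forcing X0 Xc (idx_le_n n t).
Qed.

Section WithLimit.
Variable x : R -> H.
Hypothesis x_clip : forall t, x (clip T t) = x t.
Hypothesis wx : wmeas ip x.
Hypothesis x_le : forall t, `|x t| <= Mx.

Lemma a_approx n (e eps : R) : (forall t, 0 <= t <= T -> `|xbar n t - x t| <= e) ->
  e <= eps -> approx_F x (a_ n) eps.
Proof.
move=> xe ee.
have : {ae mu, forall t, forall i, 0 < t <= T -> F t (X n i) (fs (X n i) t)}.
  by apply: ae_all => i; exact: fsF.
apply: ae_imp => t Ft tT f s; rewrite w_a => hs.
apply: (hs (X n (idx n t))); last exact: Ft.
apply: le_trans ee; apply: xe; have /andP[t0 ->] := tT; by rewrite ltW.
Qed.

Lemma b_normal n t : 0 < t <= T ->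
  clarke_normal ip (C (tau n (idx n t).+1) (X n (idx n t))) (X n (idx n t).+1)
    (K^-1 *: b_ n t) /\ `|K^-1 *: b_ n t| <= 1.
Proof.
move=> tT; have [X0 Xc] := XP n; split; last first.
  by rewrite normrZ gtr0_norm ?invr_gt0// mulrC ler_pdivrMr// mul1r b_le.
have [CX Nh] := scheme_normal Xc (idx_le_n n t); split => // d hd.
rewrite /b_ scalerA (ipZl hip) pmulr_rle0; first exact: Nh.
by rewrite mulr_gt0 ?invr_gt0// h_gt0.
Qed.

(** Taking 0 as the second normal vector makes the subsmooth inequality a one-sided estimate on the
    first. *)
Lemma normal_cone0 (A : set H) y : A y -> clarke_normal ip A y 0.
Proof. by move=> Ay; split => // d _; rewrite (ip0l hip). Qed.

(** A test point [y] of [C t (x t)] has a neighbour [y'] in the set used by the scheme, at distance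
    below [h + 2 e]. Subsmoothness compares the iterate with [y']; the remaining displacements, at
    most [eps] in all, are paired with a vector of norm at most [K]. *)
Lemma b_approx n (e eps : R) : (forall t, 0 <= t <= T -> `|xbar n t - x t| <= e) ->
  0 < e -> e <= eps / 8 -> K * h n <= eps / 8 -> approx_N x (b_ n) eps.
Proof.
move=> xe e0 ee he t tT eta delta eta0 delta0 ss ed y Cy yx.
have [X0 Xc] := XP n; have [it /andP[t1 t2]] := idxP T0 w1 iw n tT.
have /andP[t0 tT'] := tT; have tI : 0 <= t <= T by rewrite ltW.
set i := idx n t in it t1 t2 *.
have /andP[_ iT] := nodeP T0 w1 iw n i.+1.
have xit : `|X n i - x t| <= e by exact: xe.
have hK : h n <= K * h n by rewrite ler_peMl ?lipK_ge1// ltW// h_gt0.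
have [Cn0 _] := Cval (X n i) (nodeI n i.+1).
have dy : dist y (C (tau n i.+1) (X n i)) <= h n + e.
  have := CLip (X n i) (x t) y (ltW t0) t2 iT.
  rewrite (dist_mem Cy) subr0 => /(le_trans (ler_norm _)) /le_trans; apply; apply: lerD.
    apply: (le_trans (itg_z_le (ltW t0) t2 iT)).
    have hp := psi_nd T0 w1 iw (ltW t1); rewrite psi_node ?(leqW it)// in hp.
    rewrite psi_node// -natr1 mulrDl mul1r lerBlDr addrC lerD2l; exact: hp.
  apply: le_trans xit; rewrite ler_piMl// ltW//.
have [y' Cy' yy'] := dist_adherent y Cn0 e0.
have [Nb bn] := b_normal n tT; rewrite -/i in Nb.
have Xi := scheme_increment_le X0 Xc it; rewrite -/lipK in Xi.
have r1 : `|y - y'| <= eps / 2 by exact: (radius_le_half e0 yy' dy ee he hK).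
have r2 : `|X n i.+1 - x t| <= eps / 2.
  apply: le_trans (_ : e + K * h n <= _); last exact: (sum_eighths_le_half e0 ee he).
  rewrite -(subrK (X n i) (X n i.+1)) -addrA addrC; apply: (le_trans (ler_normD _ _)).
  exact: lerD.
have yX : `|X n i.+1 - y'| <= `|y - x t| + eps.
  have -> : X n i.+1 - y' = (X n i.+1 - x t) + (y - y') - (y - x t).
    by rewrite opprB [RHS]addrAC !addrA !subrK.
  apply: (le_trans (ler_normB _ _)); rewrite addrC lerD2l.
  apply: (le_trans (ler_normD _ _)); apply: (le_trans (lerD r2 r1)).
  by rewrite -splitr.
have dd : `|X n i.+1 - y'| < delta by exact: (lt_of_half_margin yX yx ed).
have [CX _] := Xc i it.
have := ss _ _ _ _ _ _ (nodeI n i.+1) CX Cy' dd Nb bn (normal_cone0 Cy') (_ : `|0| <= 1).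
rewrite subr0 normr0 ler01 => /(_ isT) key.
have key' : ip (b_ n t) (y' - X n i.+1) <= eta * K * (`|y - x t| + eps).
  have : ip (K^-1 *: b_ n t) (y' - X n i.+1) <= eta * `|X n i.+1 - y'|.
    by rewrite -lerN2 -(ipNr hip) opprB.
  rewrite (ipZl hip) mulrC ler_pdivrMr// => /le_trans; apply.
  rewrite [leLHS]mulrAC; apply: ler_wpM2l yX; apply: mulr_ge0; exact: ltW.
have yE : y - x t = (y' - X n i.+1) + ((y - y') + (X n i.+1 - x t)).
  by rewrite [RHS]addrC [RHS]addrAC !addrA !subrK.
rewrite [X in ip _ X]yE (ipDr hip); apply: lerD => //.
apply: (le_trans (ip_le_norm hip _ _)); apply: ler_pM => //; first exact: b_le.
apply: (le_trans (ler_normD _ _)); apply: (le_trans (lerD r1 r2)).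
by rewrite -splitr.
Qed.

Lemma wmeas_xbar n : wmeas ip (xbar n). Proof. exact: wmeas_step. Qed.

Lemma wmeas_velocity y a b : wmeas ip y -> wmeas ip a -> wmeas ip b ->
  wmeas ip (velocity y a b).
Proof.
move=> wy wa wb; apply: (wmeasD hip); last exact: mHop.
by apply: (wmeasB hip); apply: (wmeasZ hip) => //; exact: measurable_weight.
Qed.

Lemma velocity_le y a b s : wmeas ip y -> (forall t, `|y t| <= Mx) ->
  (forall t, `|a t| <= K) -> (forall t, `|b t| <= K) -> 0 < s <= T ->
  `|velocity y a b s| <= 3 * K * w s.
Proof.
move=> wy yM aK bK sT.
have hw v : `|v| <= K -> `|w s *: v| <= K * w s.
  by move=> vK; rewrite normrZ gtr0_norm// mulrC ler_pM2r.
have h3 : `|Hop y s| <= K * w s.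
  apply: (le_trans (Hop_le sT wy (ltW Mx0) (fun t _ => yM t))).
  by apply: le_growth_w => //; [exact: ltW|rewrite lerDr].
rewrite /velocity; apply: (le_trans (ler_normD _ _)).
have -> : 3 * K * w s = K * w s + K * w s + K * w s by ring.
by apply: lerD => //; apply: (le_trans (ler_normB _ _)); apply: lerD; exact: hw.
Qed.

Lemma intb_velocity y a b c d : 0 <= c -> d <= T -> wmeas ip y ->
  (forall t, `|y t| <= Mx) -> wmeas ip a -> wmeas ip b ->
  (forall t, `|a t| <= K) -> (forall t, `|b t| <= K) ->
  intb c d (fun s => `|velocity y a b s|).
Proof.
move=> c_0 dT wy yM wa wb aK bK.
apply: (@intb_le _ _ _ _ (fun s => 3 * K * w s)).
- by apply: (wmeas_norm hip dq); exact: wmeas_velocity.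
- move=> s /andP[s1 s2]; rewrite normr_id; apply: velocity_le => //.
  by rewrite (le_lt_trans c_0 s1) (le_trans s2).
- by apply: intbZ; exact: intb_sub iw.
Qed.

Lemma xbar_le_max n t : `|xbar n t| <= Mx.
Proof. by rewrite -xbar_clip xbar_le// clipP. Qed.

Lemma intb_ip_velocity y a b c d e : 0 <= c -> d <= T -> wmeas ip y ->
  (forall t, `|y t| <= Mx) -> wmeas ip a -> wmeas ip b ->
  (forall t, `|a t| <= K) -> (forall t, `|b t| <= K) ->
  intb c d (fun s => ip (velocity y a b s) e).
Proof.
move=> c_0 dT wy yM wa wb aK bK.
have := bint_ip hip (mu := mu) e (measurable_oc c d) (wmeas_velocity wy wa wb).
by apply; exact: intb_velocity.
Qed.

Lemma intb_velocity_step n c d e : 0 <= c -> d <= T ->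
  intb c d (fun s => ip (velocity (xbar n) (a_ n) (b_ n) s) e).
Proof.
move=> c_0 dT; apply: intb_ip_velocity => //; do ?[exact: wmeas_xbar|exact: xbar_le_max|
  exact: wmeas_a|exact: wmeas_b|exact: a_le|exact: b_le].
Qed.

(** The discrete equation is exact at the nodes: over each cell the drift minus the projection
    residual is the increment of [X], and the increments telescope. *)
Lemma itg_velocity_node n e j : (j <= n.+1)%N ->
  itg 0 (tau n j) (fun s => ip (velocity (xbar n) (a_ n) (b_ n) s) e) = ip (X n j - x0) e.
Proof.
have [X0 Xc] := XP n.
elim: j => [_|j IH jn]; first by rewrite node0 itg_xx X0 subrr (ip0l hip).
have jn' : (j <= n)%N by [].
have [t1 t2 t3] := tau_facts jn'.
rewrite (@itg_chasles _ (tau n j)) ?t1 ?t2//; last first.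
  by apply: intb_velocity_step; [exact: lexx|exact: t3].
rewrite (IH (ltnW jn)).
have [_ fE fi] := scheme_forcing X0 Xc jn'.
set p := X n j + forcing n (X n) j - X n j.+1.
have iD : intb (tau n j) (tau n j.+1) (fun s => ip (drift n (X n) j s) e).
  exact: (bint_ip hip e (measurable_oc _ _) (wmeas_drift n (X n) j) fi).
have iW : intb (tau n j) (tau n j.+1) (fun s => ip ((h n)^-1 *: p) e * w s).
  by apply: intbZ; exact: intb_sub iw.
have -> : itg (tau n j) (tau n j.+1) (fun s => ip (velocity (xbar n) (a_ n) (b_ n) s) e)
    = itg (tau n j) (tau n j.+1) (fun s => ip (drift n (X n) j s) e - ip ((h n)^-1 *: p) e * w s).
  apply: eq_itg => s sj; rewrite /velocity w_a (drift_step (X n) jn' sj) /b_ (idx_node jn' sj) -/p.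
  by rewrite !(ipDl hip) (ipNl hip) (ipZl hip (w s)) [w s * _]mulrC addrAC.
rewrite itgB// -fE itgZ; last exact: intb_sub iw.
rewrite itg_node// (ipZl hip) mulrAC mulVf ?gt_eqF ?h_gt0// mul1r /p.
rewrite -(ipBl hip) -(ipDl hip); congr (ip _ e).
have alg (A B f D : H) : A - B + (f - (A + f - D)) = D - B.
  have -> : f - (A + f - D) = D - A.
    by rewrite opprB addrCA; congr (_ + _); rewrite opprD addrCA subrr addr0.
  by rewrite addrC addrA subrK.
exact: alg.
Qed.

(** Error budget: one eighth for replacing [xbar] by [x] in the Volterra term, three for the piece
    from the last node to [t], where the velocity is at most [3 K w], and one for the position at
    that node. *)
Lemma velocity_approx n (e eps : R) (m : R -> R) :
  (forall t, 0 <= t <= T -> `|xbar n t - x t| <= e) -> 0 < e ->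
  (forall t, 0 <= m t) -> intb 0 T m ->
  (forall t, 0 < t <= T -> `|Hop (xbar n) t - Hop x t| <= m t * e) ->
  e <= eps / 8 -> e * itg 0 T m <= eps / 8 -> K * h n <= eps / 8 ->
  approx_eq x (a_ n) (b_ n) eps.
Proof.
move=> xe e0 m0 im Hm ee em he t f tI; have /andP[t0 tT] := tI.
have [X0 Xc] := XP n.
have wa := wmeas_a n; have wb := wmeas_b n.
have iv c d : 0 <= c -> d <= T -> intb c d (fun s => ip (velocity x (a_ n) (b_ n) s) f).
  by move=> c_0 dT; apply: intb_ip_velocity => //; [exact: a_le|exact: b_le].
have ith c d : 0 <= c -> d <= T ->
  intb c d (fun s => ip (velocity (xbar n) (a_ n) (b_ n) s) f) by exact: intb_velocity_step.
have it := idx_node_ge n tI; have in_ := idx_le n tI.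
have /andP[n0 _] := nodeP T0 w1 iw n (idx n t).
set i := idx n t in it in_ n0 *.
have d1 : `|itg 0 t (fun s => ip (velocity (xbar n) (a_ n) (b_ n) s) f)
    - itg 0 t (fun s => ip (velocity x (a_ n) (b_ n) s) f)| <= eps / 8 * `|f|.
  rewrite -itgB; [|exact: ith|exact: iv].
  apply: (le_trans (ler_norm_itg _)); first by apply: intbB; [exact: ith|exact: iv].
  have imt : intb 0 t m by exact: intb_sub im.
  apply: (@le_trans _ _ (itg 0 t (fun s => (e * `|f|) * m s))).
    apply: itg_le; [|exact: intbZ|].
      by apply: intb_norm; apply: intbB; [exact: ith|exact: iv].
    move=> s /andP[s1 s2]; rewrite -(ipBl hip) /velocity opprD addrACA subrr add0r.
    apply: (le_trans (normr_ip_le hip _ _)); rewrite mulrAC ler_wpM2r// mulrC.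
    by apply: Hm; rewrite s1 (le_trans s2).
  rewrite itgZ// mulrAC ler_wpM2r//; apply: le_trans em; rewrite ler_pM2l//.
  rewrite [leRHS](@itg_chasles _ t)// lerDl; exact: itg_ge0.
have d2 : `|itg (tau n i) t (fun s => ip (velocity (xbar n) (a_ n) (b_ n) s) f)|
    <= 3 * (eps / 8) * `|f|.
  apply: (le_trans (ler_norm_itg (ith _ _ n0 tT))).
  have iwt : intb (tau n i) t w by exact: intb_sub iw.
  apply: (@le_trans _ _ (itg (tau n i) t (fun s => (3 * K * `|f|) * w s))).
    apply: itg_le; [by apply: intb_norm; exact: ith|exact: intbZ|].
    move=> s /andP[s1 s2]; apply: (le_trans (normr_ip_le hip _ _)).
    rewrite mulrAC ler_wpM2r//; apply: velocity_le; [exact: wmeas_xbar|exact: xbar_le_max|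
      exact: a_le|exact: b_le|by rewrite (le_lt_trans n0 s1) (le_trans s2)].
  rewrite itgZ// mulrAC ler_wpM2r// -mulrA ler_pM2l//; apply: le_trans he.
  rewrite ler_pM2l// -(psiB_in T0 iw n0 it tT) psi_node ?(leqW in_)//.
  have /andP[_] := psi_idx n tI; rewrite -/i -natr1 mulrDl mul1r.
  by rewrite lerBlDl.
have d3 : `|ip (X n i - x t) f| <= eps / 8 * `|f|.
  apply: (le_trans (normr_ip_le hip _ _)); rewrite ler_wpM2r//.
  by apply: le_trans ee; exact: xe.
have hch : itg 0 t (fun s => ip (velocity (xbar n) (a_ n) (b_ n) s) f) =
    ip (X n i - x0) f + itg (tau n i) t (fun s => ip (velocity (xbar n) (a_ n) (b_ n) s) f).
  rewrite (@itg_chasles _ (tau n i))//; last exact: ith.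
  by rewrite itg_velocity_node// leqW.
have -> : ip (x t - x0) f = ip (X n i - x0) f - ip (X n i - x t) f.
  by rewrite -(ipBl hip) opprB [in RHS]addrC addrA subrK.
have eps0 : 0 <= eps * `|f|.
  by rewrite mulr_ge0//; move: (lt_le_trans e0 ee); rewrite pmulr_lgt0 ?invr_gt0// => /ltW.
exact: (residual_le hch d1 d2 d3 eps0).
Qed.

End WithLimit.

Lemma approximate_solutions : exists x : R -> H,
  [/\ [/\ wmeas ip x, forall t, `|x t| <= Mx & x 0 = x0],
    forall s t, 0 <= s -> s <= t -> t <= T -> `|x t - x s| <= K * (psi t - psi s),
    forall t, 0 <= t <= T -> C t (x t) (x t) &
    forall eps, 0 < eps -> exists a b : R -> H,
      [/\ wmeas ip a /\ wmeas ip b, forall t, `|a t| <= K /\ `|b t| <= K,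
         approx_F x a eps, approx_N x b eps & approx_eq x a b eps]].
Proof.
have [x' [xmod' xu']] := ultrafilter_limit.
pose x t := x' (clip T t).
have xin t : 0 <= t <= T -> x t = x' t by move=> tI; rewrite /x clip_id.
have xmod s t : 0 <= s -> s <= t -> t <= T -> `|x t - x s| <= K * (psi t - psi s).
  by move=> s0 st tT; rewrite !xin ?s0 ?tT ?(le_trans s0)//; [exact: xmod'|exact: le_trans tT].
have xu (e : R) N : 0 < e -> exists2 n, (N <= n)%N & forall t, `|xbar n t - x t| <= e.
  move=> e0; have [n Nn nP] := xu' e N e0; exists n => // t.
  by rewrite -xbar_clip /x; apply: nP; exact: clipP.
have x_le t : `|x t| <= Mx.
  apply/ler_addgt0Pr => e e0; have [n _ nP] := xu e 0%N e0.
  have := ler_normD (xbar n t) (x t - xbar n t); rewrite subrKC => /le_trans; apply.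
  by apply: lerD; [exact: xbar_le_max|rewrite distrC].
have wx : wmeas ip x.
  have /choice[k kP] m : exists n, forall t, `|xbar n t - x t| <= m.+1%:R^-1.
    have m0 : 0 < m.+1%:R^-1 :> R by rewrite invr_gt0.
    by have [n _ nP] := xu _ 0%N m0; exists n.
  apply: (wmeas_cvg hip (u := fun m => xbar (k m))) => [m|t]; first exact: wmeas_xbar.
  apply/cvgrPdist_le => e e0; near=> m; rewrite distrC (le_trans (kP m t))// ltW//.
  by near: m; exact: (near_infty_natSinv_lt (PosNum e0)).
have x00 : x 0 = x0.
  apply/eqP; rewrite eq_sym -subr_eq0 -normr_le0; apply/ler_addgt0Pr => e e0; rewrite add0r.
  have [n _ /(_ 0)] := xu e 0%N e0; rewrite /xbar /step_fun idx0.
  by have [-> _] := XP n.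
have small (e : R) : 0 < e -> exists N, forall n, (N <= n)%N -> K * h n <= e.
  move=> e0; have eK : 0 < e / K by rewrite divr_gt0.
  have [N NP] := mesh_small eK; exists N => n /NP; rewrite ltr_pdivlMr// mulrC; exact: ltW.
exists x; split => //.
(* The set [C t] is closed, so distance zero suffices; [xbar] is close to [C t v] with [v] close to
   [x t], and the distance is Lipschitz in both the point and the state. *)
- move=> t tI; have [Cn0 Cc] := Cval (x t) tI; apply: dist0_closed => //.
  apply/ler_addgt0Pr => e e0; rewrite add0r; have e4 : 0 < e / 4 by rewrite divr_gt0.
  have [N NP] := small _ e4; have [n Nn nP] := xu _ N e4; have Kh := NP n Nn.
  have [v [_ vx dv]] := xbar_near_C n tI; have /andP[t0 tT] := tI.
  have hK : h n <= K * h n by rewrite ler_peMl ?lipK_ge1// ltW// h_gt0.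
  have d1 := CLip (x t) v (xbar n t) t0 (lexx t) tT; rewrite itg_xx add0r in d1.
  have d2 : `|dist (x t) (C t (x t)) - dist (xbar n t) (C t (x t))| <= `|x t - xbar n t|.
    exact: dist_lip.
  have d3 : L * `|x t - v| <= `|x t - xbar n t| + `|v - xbar n t|.
    apply: (@le_trans _ _ `|x t - v|); first by rewrite ler_piMl// ltW.
    have -> : x t - v = (x t - xbar n t) - (v - xbar n t) by rewrite opprB addrA subrK.
    exact: ler_normB.
  have d4 := nP t; rewrite distrC in d4.
  exact: (distance_budget_le d1 d2 d3 d4 vx dv hK Kh).
move=> eps eps0.
have [m [m0 im Hm]] := Hop_lip (ltW Mx0).
have M0 : 0 <= itg 0 T m by exact: itg_ge0.
(* Small enough both by itself and after multiplication by the integral of the Lipschitz weight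
   [m]. *)
pose e := Num.min (eps / 8) (eps / 8 / (1 + itg 0 T m)).
have e8 : 0 < eps / 8 by rewrite divr_gt0.
have M1 : 0 < 1 + itg 0 T m by rewrite ltr_pwDl.
have e0 : 0 < e by rewrite lt_min e8 divr_gt0.
have ee : e <= eps / 8 by rewrite ge_min lexx.
have em : e * itg 0 T m <= eps / 8.
  apply: (@le_trans _ _ (e * (1 + itg 0 T m))); first by rewrite ler_pM2l// lerDr.
  by rewrite -ler_pdivlMr// ge_min lexx orbT.
have [N NP] := small _ e8; have [n Nn nP] := xu _ N e0; have Kh := NP n Nn.
exists (a_ n), (b_ n); split.
- by split; [exact: wmeas_a|exact: wmeas_b].
- by move=> t; split; [exact: a_le|exact: b_le].
- apply: (a_approx (e := e)) => //; apply: (le_trans ee).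
  by rewrite ler_pdivrMr// ler_peMr ?(ltW eps0)// ler1n.
- exact: (b_approx (e := e)).
- refine (velocity_approx wx x_le (fun t _ => nP t) e0 m0 im _ ee em Kh).
  move=> t tT; apply: (Hm (xbar n) x e) => //; [exact: wmeas_xbar|exact: ltW|].
  by move=> s _; split; [exact: xbar_le_max|exact: x_le|exact: nP].
Unshelve. all: by end_near. Qed.
Hypothesis Fval : forall t v, Icc 0 T t ->
  F t v !=set0 /\ closed (F t v) /\ convex_subset (F t v).
Hypothesis Fusc : {ae mu, forall t, 0 < t <= T -> usc_weak ip (F t)}.
Hypothesis Csub : forall eta, 0 < eta -> exists2 delta, 0 < delta & subsmooth_at eta delta.

(** * Strong limits of nearly minimal velocity pairs *)

Section Limit.
Variable x : R -> H.
Hypothesis wx : wmeas ip x.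
Hypothesis x_le : forall t, `|x t| <= Mx.

Lemma approx_F_le a e1 e2 : e1 <= e2 -> approx_F x a e1 -> approx_F x a e2.
Proof.
move=> e12; apply: ae_imp => t h tT f s hs; apply: (h tT) => y ye; apply: hs.
exact: le_trans e12.
Qed.

Lemma approx_N_le b e1 e2 : e1 <= e2 -> approx_N x b e1 -> approx_N x b e2.
Proof.
move=> e12 h t tT eta d eta0 d0 ss ed y Cy yx.
have ed1 : 2 * e1 <= d by apply: le_trans ed; rewrite ler_pM2l.
apply: (le_trans (h t tT eta d eta0 d0 ss ed1 y Cy yx)).
apply: lerD; last by rewrite ler_pM2l.
by apply: ler_wpM2l; rewrite ?lerD2l// mulr_ge0 ?ltW.
Qed.

Lemma approx_eq_le a b e1 e2 : e1 <= e2 -> approx_eq x a b e1 -> approx_eq x a b e2.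
Proof.
by move=> e12 h t f tI; apply: (le_trans (h t f tI)); rewrite ler_wpM2r.
Qed.

Definition admissible (eps : R) (ab : (R -> H) * (R -> H)) :=
  [/\ wmeas ip ab.1 /\ wmeas ip ab.2, forall t, `|ab.1 t| <= K /\ `|ab.2 t| <= K,
     approx_F x ab.1 eps, approx_N x ab.2 eps & approx_eq x ab.1 ab.2 eps].

Let half (u v : R -> H) t := 2^-1 *: (u t + v t).

Lemma half_le u v t : `|u t| <= K -> `|v t| <= K -> `|half u v t| <= K.
Proof.
move=> uK vK; rewrite /half normrZ ger0_norm ?invr_ge0// mulrC ler_pdivrMr//.
by apply: (le_trans (ler_normD _ _)); rewrite mulr_natr mulr2n lerD.
Qed.

Lemma wmeas_half u v : wmeas ip u -> wmeas ip v -> wmeas ip (half u v).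
Proof.
by move=> wu wv; apply: (wmeasZ hip); [exact: measurable_cst|exact: wmeasD].
Qed.

Lemma ip_half (c : R) u v e : ip (c *: (2^-1 *: (u + v))) e = (ip (c *: u) e + ip (c *: v) e) / 2.
Proof. by rewrite !(ipZl hip) (ipDl hip); ring. Qed.

Lemma admissible_half eps p r : admissible eps p -> admissible eps r ->
  admissible eps (half p.1 r.1, half p.2 r.2).
Proof.
move=> [[wa wb] K1 F1 N1 E1] [[wa' wb'] K2 F2 N2 E2]; split => /=.
- by split; exact: wmeas_half.
- by move=> t; have [h1 h2] := K1 t; have [h3 h4] := K2 t; split; exact: half_le.
- apply: ae_imp2 F1 F2 => t f1 f2 tT e s hs; rewrite /half ip_half ler_pdivrMr// mulr_natr mulr2n.
  by apply: lerD; [exact: f1|exact: f2].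
- move=> t tT eta d eta0 d0 ss ed y Cy yx.
  rewrite -[half _ _ t]scale1r /half ip_half !scale1r ler_pdivrMr// mulr_natr mulr2n.
  by apply: lerD; [exact: (N1 t tT eta d)|exact: (N2 t tT eta d)].
- move=> t e tI; have /andP[t0 tT] := tI.
  have i1 : intb 0 t (fun s => ip (velocity x p.1 p.2 s) e).
    by apply: intb_ip_velocity => // s; have [] := K1 s.
  have i2 : intb 0 t (fun s => ip (velocity x r.1 r.2 s) e).
    by apply: intb_ip_velocity => // s; have [] := K2 s.
  have -> : itg 0 t (fun s => ip (velocity x (half p.1 r.1) (half p.2 r.2) s) e) =
      2^-1 * (itg 0 t (fun s => ip (velocity x p.1 p.2 s) e) +
              itg 0 t (fun s => ip (velocity x r.1 r.2 s) e)).
    rewrite -itgD// -itgZ; last exact: intbD.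
    by apply: eq_itg => s _; rewrite /velocity /half !(ipDl hip) !(ipNl hip) !ip_half; field.
  have := E1 t e tI; have := E2 t e tI; exact: norm_midpoint_le.
Qed.

Let energy (p : (R -> H) * (R -> H)) := itg 0 T (fun t => `|p.1 t| ^+ 2 + `|p.2 t| ^+ 2).
Let gap (p r : (R -> H) * (R -> H)) :=
  itg 0 T (fun t => `|p.1 t - r.1 t| ^+ 2 + `|p.2 t - r.2 t| ^+ 2).

Lemma intb_normsq u : wmeas ip u -> (exists B, forall t, `|u t| <= B) ->
  intb 0 T (fun t => `|u t| ^+ 2).
Proof.
move=> wu [B uB]; apply: (@intb_le _ _ _ _ (fun=> B ^+ 2)); last exact: intb_const.
  by apply: measurable_funX; exact: (wmeas_norm hip dq wu).
by move=> t _; rewrite ger0_norm ?sqr_ge0// lerXn2r// nnegrE// (le_trans _ (uB t)).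
Qed.

Lemma admissible_intb eps p : admissible eps p ->
  intb 0 T (fun t => `|p.1 t| ^+ 2) /\ intb 0 T (fun t => `|p.2 t| ^+ 2).
Proof.
move=> [[wa wb] pK _ _ _].
by split; apply: intb_normsq => //; exists K => t; have [] := pK t.
Qed.

Lemma admissible_intb_diff eps p r : admissible eps p -> admissible eps r ->
  intb 0 T (fun t => `|p.1 t - r.1 t| ^+ 2) /\ intb 0 T (fun t => `|p.2 t - r.2 t| ^+ 2).
Proof.
move=> [[wa wb] pK _ _ _] [[wa' wb'] rK _ _ _].
split; apply: intb_normsq; try exact: (wmeasB hip); exists (K + K) => t;
  apply: (le_trans (ler_normB _ _)); have [? ?] := pK t; have [? ?] := rK t; exact: lerD.
Qed.

Let eps_ (m : nat) : R := m.+1%:R^-1.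

Lemma admissible_le m k p : (m <= k)%N -> admissible (eps_ k) p -> admissible (eps_ m) p.
Proof.
move=> mk [h1 h2 h3 h4 h5].
have e12 : eps_ k <= eps_ m by rewrite /eps_ lef_pV2 ?posrE// ler_nat.
split => //; [exact: approx_F_le h3|exact: approx_N_le h4|exact: approx_eq_le h5].
Qed.

(** [gap] and [energy] satisfy the parallelogram identity exactly, by integrating the pointwise one;
    the rate [8^-j] is the one required by [fast_cauchy_limit]. *)
Lemma admissible_cauchy : (forall m, exists p, admissible (eps_ m) p) ->
  exists p : nat -> (R -> H) * (R -> H),
    (forall j, admissible (eps_ j) (p j)) /\ forall j, gap (p j.+1) (p j) <= 8^-1 ^+ j.
Proof.
move=> ex.
have [|||||p [pE _ pC]] := near_minimal_cauchy (E := fun m => [set p | admissible (eps_ m) p])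
  (Q := energy) (mid := fun p r => (half p.1 r.1, half p.2 r.2)) (D := gap)
  (M := (K ^+ 2 + K ^+ 2) * T).
- by move=> m; have [p pm] := ex m; exists p.
- by move=> m k mk p; exact: admissible_le.
- by move=> m p r; exact: admissible_half.
- move=> p ap; have [i1 i2] := admissible_intb ap; have [_ pK _ _ _] := ap.
  rewrite itg_ge0/=; last by move=> t _; rewrite addr_ge0 ?sqr_ge0.
  rewrite -[T in _ * T]subr0 -itg_const ?(ltW T0)//; apply: itg_le; [exact: intbD|exact: intb_const|].
  move=> t _; have [h1 h2] := pK t; have K0' := ltW K0.
  by apply: lerD; rewrite lerXn2r// nnegrE.
- move=> p r ap ar; have [i1 i2] := admissible_intb ap; have [i3 i4] := admissible_intb ar.
  have [i5 i6] := admissible_intb (admissible_half ap ar).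
  rewrite /energy /gap -!itgZ; try exact: intbD.
  rewrite -itgD; [|by apply: intbZ; exact: intbD|by apply: intbZ; exact: intbD].
  rewrite -itgB; [|by apply: intbD; apply: intbZ; exact: intbD|by apply: intbZ; exact: intbD].
  rewrite le_eqVlt; apply/orP; left; apply/eqP; apply: eq_itg => t _ /=.
  rewrite (midpoint_normsq hip (p.1 t) (r.1 t) 0) (midpoint_normsq hip (p.2 t) (r.2 t) 0).
  by rewrite !sub0r !normrN /half; ring.
have /choice[N NP] j : exists N, forall m k, (N <= m)%N -> (N <= k)%N ->
    gap (p m) (p k) <= 8^-1 ^+ j.
  by apply: pC; rewrite exprn_gt0// invr_gt0.
(* The partial sums make the indices monotone and at least [N j]; the summand [j] makes the
   tolerance at least as fine as [eps_ j]. *)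
pose phi j := (j + \sum_(i < j.+1) N i)%N.
have phiN j : (N j <= phi j)%N.
  by rewrite /phi big_ord_recr /= addnA leq_addl.
have phiS j : (phi j <= phi j.+1)%N.
  by rewrite /phi [in X in (_ <= X)%N]big_ord_recr /= addnA; apply: leq_trans (leq_addr _ _); rewrite leq_add2r.
exists (fun j => p (phi j)); split => j.
  by apply: admissible_le (pE (phi j)); rewrite /phi leq_addr.
by apply: NP; rewrite ?phiN// (leq_trans (phiN j)).
Qed.

Hypothesis Cx : forall t, 0 <= t <= T -> C t (x t) (x t).

Lemma gap_fst p r e1 e2 : admissible e1 p -> admissible e1 r -> gap p r <= e2 ->
  itg 0 T (fun t => `|p.1 t - r.1 t| ^+ 2) <= e2 /\
  itg 0 T (fun t => `|p.2 t - r.2 t| ^+ 2) <= e2.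
Proof.
move=> ap ar /[dup] g1 g2; have [i1 i2] := admissible_intb_diff ap ar.
split; [apply: le_trans g1|apply: le_trans g2]; apply: itg_le => //; try exact: intbD;
  by move=> t _; rewrite ?lerDl ?lerDr sqr_ge0.
Qed.

(** Let [p] be the projection of [l] on [F t (x t)]. The half-space [W] normal to [l - p], shifted
    by [eta], is weakly open and contains that value, hence also [F t y] for [y] near [x t]. The
    support inequality puts [f j] in its closure, and the limit gives [|l - p|^2 <= eta]. *)
Lemma usc_limit_mem t (f : nat -> H) l (e : nat -> R) : 0 < t <= T -> usc_weak ip (F t) ->
  f @ \oo --> l -> e @ \oo --> 0 ->
  (forall j v s, (forall y, `|y - x t| <= e j -> forall z, F t y z -> ip z v <= s) ->
     ip (f j) v <= s) ->
  F t (x t) l.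
Proof.
move=> /andP[t0 tT] ut fl e0 hf.
have tI : Icc 0 T t by rewrite /Icc /= ltW.
have [Fn0 [Fc Fv]] := Fval (x t) tI.
have [p Fp pP] := proj_closed_convex hip l Fn0 Fc Fv.
suff : ip (l - p) (l - p) <= 0.
  rewrite (ipxx hip) => h; have : `|l - p| ^+ 2 == 0 by rewrite eq_le h sqr_ge0.
  by rewrite sqrf_eq0 normr_eq0 subr_eq0 => /eqP ->.
set v := l - p.
apply/ler_addgt0Pr => eta eta0; rewrite add0r.
pose W : set H := [set y | ip y v < ip p v + eta].
have oW : weakly_open ip W.
  move=> y Wy; exists [:: v], (ip p v + eta - ip y v); split; first by rewrite subr_gt0.
  move=> y' /= /(_ v); rewrite inE eqxx => /(_ isT).
  by rewrite (ipBl hip) => /(le_lt_trans (ler_norm _)); rewrite ltrBlDr subrK.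
have FW : F t (x t) `<=` W.
  move=> y Fy; have := pP y Fy; rewrite -/v (ipC hip) (ipBl hip) subr_le0 => h.
  by rewrite /W /= (le_lt_trans h)// ltrDl.
have [d d0 dW] := ut _ _ oW FW.
have /cvgrPdist_lt/(_ d d0)[N _ NP] := e0.
have fW j : (N <= j)%N -> ip (f j) v <= ip p v + eta.
  move=> Nj; apply: hf => y ye y' Fy'; apply: ltW; apply: (dW y) => //.
  apply: (le_lt_trans ye); have := NP j Nj; rewrite sub0r normrN; apply: le_lt_trans.
  exact: ler_norm.
have lv : ip (f j) v @[j --> \oo] --> ip l v by exact: cvg_ip.
have : ip l v <= ip p v + eta.
  apply: (closed_cvg (fun y => y <= ip p v + eta) (@closed_le R _) _ _ lv).
  by exists N => // j /= Nj; exact: fW.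
by rewrite {1}/v (ipBl hip) lerBlDl.
Qed.

(** As [e j] vanishes, only [eta * K * |y - x t|] remains; choosing [eta = eps / K] this is the
    Fréchet form of normality. *)
Lemma limit_normal t (bs : nat -> H) l (e : nat -> R) : 0 < t <= T ->
  bs @ \oo --> l -> e @ \oo --> 0 ->
  (forall j eta delta, 0 < eta -> 0 < delta -> subsmooth_at eta delta ->
    2 * e j <= delta -> forall y, C t (x t) y -> `|y - x t| < delta / 2 ->
    ip (bs j) (y - x t) <= eta * K * (`|y - x t| + e j) + K * e j) ->
  clarke_normal ip (C t (x t)) (x t) (w t *: l).
Proof.
move=> tT bl e0 hb; have /andP[t0 tT'] := tT.
have Cxt : C t (x t) (x t) by apply: Cx; rewrite ltW.
suff [_ h] : clarke_normal ip (C t (x t)) (x t) l.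
  by split => // d /h; rewrite (ipZl hip) => hd; rewrite pmulr_rle0.
apply: (frechet_clarke_normal hip) => // eps eps0.
have eta0 : 0 < eps / K by rewrite divr_gt0.
have [d d0 ss] := Csub eta0; exists (d / 2); first by rewrite divr_gt0.
move=> y Cy yx.
have l1 : ip (bs j) (y - x t) @[j --> \oo] --> ip l (y - x t) by exact: cvg_ip.
have l2 : eps / K * K * (`|y - x t| + e j) + K * e j @[j --> \oo] -->
    eps / K * K * (`|y - x t| + 0) + K * 0.
  apply: cvgD; last by apply: cvgM => //; exact: cvg_cst.
  by apply: cvgM; [exact: cvg_cst|apply: cvgD => //; exact: cvg_cst].
rewrite addr0 mulr0 addr0 divfK ?gt_eqF// in l2.
apply: (ler_cvg_to l1 l2).
have d20 : 0 < d / 2 by rewrite divr_gt0.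
have /cvgrPdist_lt/(_ _ d20) := e0; apply: filterS => j; rewrite sub0r normrN => ej.
have h := hb j _ _ eta0 d0 ss _ y Cy yx.
rewrite divfK ?gt_eqF// in h; apply: h.
rewrite mulrC -ler_pdivlMr//; apply: ltW; apply: le_lt_trans ej; exact: ler_norm.
Qed.

Lemma limit_pair : (forall eps, 0 < eps -> exists p, admissible eps p) ->
  exists a b : R -> H,
  [/\ wmeas ip a /\ wmeas ip b, forall t, `|a t| <= K /\ `|b t| <= K,
    {ae mu, forall t, 0 < t <= T -> F t (x t) (w t *: a t)},
    {ae mu, forall t, 0 < t <= T -> clarke_normal ip (C t (x t)) (x t) (w t *: b t)} &
    forall t e, 0 <= t <= T ->
      ip (x t - x0) e = itg 0 t (fun s => ip (velocity x a b s) e)].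
Proof.
move=> ex; have [|p [pE pgap]] := admissible_cauchy.
  by move=> m; apply: ex; rewrite /eps_ invr_gt0.
(* Consecutive pairs are put at a common tolerance so that their difference can be integrated. *)
have pE' j := admissible_le (leqnSn j) (pE j.+1).
have g j := gap_fst (pE' j) (pE j) (pgap j).
have i j := admissible_intb_diff (pE' j) (pE j).
have e_cvg : eps_ @ \oo --> 0 by exact: cvg_harmonic.
have [|||a [wa aP aK]] := fast_cauchy_limit hip (u := fun j => (p j).1) dq (T := T).
- by move=> j; have [[? ?] _ _ _ _] := pE j.
- by move=> j; have [] := i j.
- by move=> j; have [] := g j.
have [|||b [wb bP bK]] := fast_cauchy_limit hip (u := fun j => (p j).2) dq (T := T).
- by move=> j; have [[? ?] _ _ _ _] := pE j.
- by move=> j; have [] := i j.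
- by move=> j; have [] := g j.
have {}aK t : `|a t| <= K by apply: aK => [|j s]; [exact: ltW|have [_ /(_ s)[]] := pE j].
have {}bK t : `|b t| <= K by apply: bK => [|j s]; [exact: ltW|have [_ /(_ s)[]] := pE j].
exists a, b; split => //.
- have hF : {ae mu, forall t, forall j, 0 < t <= T -> forall e s,
    (forall y, `|y - x t| <= eps_ j -> forall v, F t y v -> ip v e <= s) ->
    ip (w t *: (p j).1 t) e <= s}.
    by apply: ae_all => j; have [_ _ + _ _] := pE j.
  have := ae_imp2 (fun t h1 h2 => conj h1 h2) hF aP.
  apply: ae_imp2 Fusc => t ut [hF' aP'] tT.
  apply: (usc_limit_mem tT (ut tT) (f := fun j => w t *: (p j).1 t) (e := eps_)) => //.
    by apply: cvgZ; [exact: cvg_cst|exact: aP'].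
  by move=> j v s; exact: hF'.
- apply: ae_imp bP => t bt tT.
  apply: (limit_normal tT (bt tT) e_cvg) => j eta d eta0 d0 ss ed y Cy yx.
  by have [_ _ _ /(_ t tT eta d) + _] := pE j; apply.
- move=> t e tI; have /andP[t0 tT] := tI.
  have wv j : wmeas ip (velocity x (p j).1 (p j).2).
    by have [[? ?] _ _ _ _] := pE j; exact: wmeas_velocity.
  (* The integral equation passes to the limit by domination: every velocity is at most [3 K w]. *)
  have [|||||_ il] := @itg_dominated_cvg R 0 t (fun j s => ip (velocity x (p j).1 (p j).2 s) e)
    (fun s => ip (velocity x a b s) e) (fun s => 3 * K * w s * `|e|).
  + by move=> j; exact: wv.
  + exact: (wmeas_velocity wx wa wb).
  + apply: eq_integrable (intbZ `|e| (intbZ (3 * K) (intb_sub (lexx 0) tT iw))) => //.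
    by move=> s _ /=; rewrite mulrC.
  + apply: ae_imp2 aP bP => s a1 b1 /andP[s0 st].
    have sT : 0 < s <= T by rewrite s0 (le_trans st).
    apply: (cvg_ip hip); rewrite /velocity; apply: cvgD; last exact: cvg_cst.
    by apply: cvgB; (apply: cvgZ; first exact: cvg_cst); [exact: a1|exact: b1].
  + apply: aeW => s /andP[s0 st] j; have [[? ?] pK _ _ _] := pE j.
    have sT : 0 < s <= T by rewrite s0 (le_trans st).
    apply: (le_trans (normr_ip_le hip _ _)); apply: ler_wpM2r => //.
    by apply: velocity_le => // r; have [] := pK r.
  apply/eqP; rewrite -subr_eq0 -normr_le0.
  have l1 : `|ip (x t - x0) e - itg 0 t (fun s => ip (velocity x (p j).1 (p j).2 s) e)|
     @[j --> \oo] --> `|ip (x t - x0) e - itg 0 t (fun s => ip (velocity x a b s) e)|.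
    by apply: cvg_norm; apply: cvgB => //; exact: cvg_cst.
  have l2 : eps_ j * `|e| @[j --> \oo] --> 0 * `|e| by apply: cvgM => //; exact: cvg_cst.
  rewrite mul0r in l2; apply: (ler_cvg_to l1 l2); apply: nearW => j.
  by have [_ _ _ _] := pE j; exact.
Qed.

End Limit.

Theorem scheme_solution : exists x : R -> H,
  [/\ abs_cont 0 T x, x 0 = x0, wmeas ip x, forall t, `|x t| <= Mx &
   {ae mu, forall t, 0 < t < T -> exists nv fv,
     [/\ clarke_normal ip (C t (x t)) (x t) nv, F t (x t) fv &
      k^-1 *: (x (k + t) - x t) @[k --> 0^'] --> - nv + fv + Hop x t]}].
Proof.
have [x [[wx x_le x00] xmod Cx xapp]] := approximate_solutions.
have [|a [b [[wa wb] abK aF bN xE]]] := limit_pair wx x_le Cx.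
  by move=> eps /xapp[a [b h]]; exists (a, b).
exists x; split => //.
- move=> eps eps0; have w0 t : 0 <= w t by exact: ltW.
  have eK : 0 < eps / K by rewrite divr_gt0.
  have [d d0 dP] := itg_family_small w0 iw eK; exists d => // n u v uv disj sd.
  apply: (@le_lt_trans _ _ (\sum_(i < n) K * itg (u i) (v i) w)).
    apply: ler_sum => i _; have [u0 [uvi vT]] := uv i (ltn_ord i).
    by rewrite -(psiB_in T0 iw u0 uvi vT); exact: xmod.
  by rewrite -mulr_sumr mulrC -ltr_pdivlMr//; exact: dP.
have iv : intb 0 T (fun t => `|velocity x a b t|).
  by apply: intb_velocity => // t; have [] := abK t.
have xu s t e : 0 <= s -> s <= t -> t <= T ->
    ip (x t - x s) e = itg s t (fun r => ip (velocity x a b r) e).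
  move=> s0 st tT.
  have sI : 0 <= s <= T by rewrite s0 (le_trans st).
  have tI : 0 <= t <= T by rewrite tT (le_trans s0).
  have -> : x t - x s = (x t - x0) - (x s - x0) by rewrite opprB addrA subrK.
  rewrite (ipBl hip) (xE t e tI) (xE s e sI) (@itg_chasles _ s)//.
    by rewrite addrC addKr.
  by apply: intb_ip_velocity => // r; have [] := abK r.
have wv := wmeas_velocity wx wa wb.
have := vector_primitive_derivable hip dq wv iv xu.
apply: ae_imp2 (ae_imp2 (fun t h1 h2 => conj h1 h2) aF bN) => t [Ft Nt] dt tT.
have tT' : 0 < t <= T by have /andP[-> /ltW] := tT.
exists (w t *: b t), (w t *: a t); split; [exact: Nt|exact: Ft|].
by have := dt tT; rewrite /velocity [w t *: a t - _]addrC.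
Qed.

End Scheme.

(** * From Lebesgue to Borel measurability *)

Lemma null_bigcup d (T : measurableType d) (R : realType) (mu : {measure set T -> \bar R})
    (I : countType) (N : I -> set T) :
  (forall i, measurable (N i) /\ mu (N i) = 0%E) ->
  measurable (\bigcup_i N i) /\ mu (\bigcup_i N i) = 0%E.
Proof.
move=> hN; pose M (n : nat) := if unpickle n is Some i then N i else set0.
have -> : \bigcup_i N i = \bigcup_n M n.
  apply/seteqP; split => t [i _ ti].
    by exists (pickle i) => //; rewrite /M pickleK.
  by move: ti; rewrite /M; case: unpickle => [j|//] tj; exists j.
have hM n : measurable (M n) /\ mu (M n) = 0%E.
  by rewrite /M; case: unpickle => [j|]; [exact: hN|rewrite measure0].
have mM : measurable (\bigcup_n M n) by apply: bigcupT_measurable => n; have [] := hM n.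
split => //; apply/eqP; rewrite eq_le measure_ge0 andbT.
have := measure_sigma_subadditive mu (fun n => (hM n).1) mM (@subset_refl _ _).
by rewrite eseries0// => n _ _; have [] := hM n.
Qed.

Section Completion.
Context {R : realType}.
Local Notation mu := (@lebesgue_measure R).
Local Notation cmu := (@completed_lebesgue_measure R).

Lemma borel_Lmeasurable (A : set R) : measurable (A : set (measurableTypeR R)) -> Lmeasurable A.
Proof. by move=> mA; exact: sub_caratheodory. Qed.

Lemma Lmeasurable_ae (A B N : set R) : measurable (B : set (measurableTypeR R)) ->
  measurable (N : set (measurableTypeR R)) -> mu N = 0%E ->
  (forall t, ~ N t -> (A t <-> B t)) -> Lmeasurable A.
Proof.
move=> mB mN N0 AB.
have -> : A = (B `\` N) `|` (A `&` N).
  apply/seteqP; split => t.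
    by move=> At; have [Nt|Nt] := pselect (N t); [right|left; split => //; apply/AB].
  by move=> [[Bt Nt]|[]//]; apply/AB.
rewrite /Lmeasurable; apply: measurableU.
  by apply: borel_Lmeasurable; exact: measurableD.
apply: negligible_sub_caratheodory; exists N.
by split; [exact: sub_caratheodory|exact: N0|move=> t []].
Qed.

Lemma Lmeasurable_borel (A : set R) : Lmeasurable A -> exists B N : set R,
  [/\ measurable (B : set (measurableTypeR R)), measurable (N : set (measurableTypeR R)),
   mu N = 0%E & forall t, ~ N t -> (A t <-> B t)].
Proof.
rewrite /Lmeasurable -completed_caratheodory_measurable g_sigma_completed_algebra_genE.
move=> [B mB [N' [N [mN N0 NN]] <-]]; exists B, N; split => // t Nt; split; last by left.
by move=> [//|/NN].
Qed.

(** The identity is measurable from the completed to the Borel structure and carries the completed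
    measure to [mu]. *)
Lemma completed_integralE (D : set R) (f : R -> \bar R) :
  measurable (D : set (measurableTypeR R)) ->
  measurable_fun (D : set (measurableTypeR R)) f -> (forall t, D t -> 0 <= f t)%E ->
  (\int[mu]_(t in D) f t = \int[cmu]_(t in D) f t)%E.
Proof.
move=> mD mf f0.
pose phi : caratheodory_type ((@wlength R idfun)^*)%mu -> measurableTypeR R := idfun.
have mphi : measurable_fun setT phi.
  by move=> _ A mA; rewrite setTI; exact: sub_caratheodory.
have f0' : {in D, forall y, (0 <= f y)%E} by move=> y; rewrite inE; exact: f0.
have := ge0_integral_pushforward mphi cmu mD mf f0'.
rewrite preimage_id; move=> <-.
by apply: eq_measure_integral => A mA _.
Qed.

Lemma borel_completed_measurable (D : set R) d (U : measurableType d) (f : R -> U) :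
  measurable (D : set (measurableTypeR R)) ->
  measurable_fun (D : set (measurableTypeR R)) f ->
  measurable_fun (D : set (caratheodory_type ((@wlength R idfun)^*)%mu)) f.
Proof. by move=> mD mf _ Y mY; apply: sub_caratheodory; exact: mf. Qed.

Lemma Icc_itv (a b : R) : Icc a b = `[a, b]%classic.
Proof. by apply/seteqP; split => t; rewrite /Icc /= in_itv. Qed.

Lemma measurable_Icc (a b : R) : measurable (Icc a b : set (measurableTypeR R)).
Proof. by rewrite Icc_itv; exact: measurable_itv. Qed.

(** The superlevel sets at rational heights are Borel up to null sets; off the union [N0] of these,
    all superlevel sets are countable unions of Borel ones, and on [N0] the function is set to
    zero. *)
Lemma Lintegrable_borel (a b : R) (f : R -> R) : Lintegrable (Icc a b) f ->
  (forall t, Icc a b t -> 0 <= f t) -> exists f' : R -> R,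
  [/\ measurable_fun setT f', forall t, 0 <= f' t, intb a b f' &
    {ae mu, forall t, a <= t <= b -> f t = f' t}].
Proof.
move=> lf f0; have [mf ioo] := integrableP _ _ _ lf.
have mD := measurable_Icc a b.
have Lr (r : rat) : Lmeasurable [set t | Icc a b t /\ ratr r < f t].
  have := mf (borel_Lmeasurable mD) _ (emeasurable_itv `](ratr r)%:E, +oo[%R).
  rewrite /Lmeasurable; congr measurable.
  by apply/seteqP; split => t /=; rewrite in_itv /= andbT lte_fin.
have /choice[B /choice[N BN]] r := Lmeasurable_borel (Lr r).
pose N0 := \bigcup_r N r.
have [mN0 N00] : measurable (N0 : set (measurableTypeR R)) /\ mu N0 = 0%E.
  by apply: null_bigcup => r; have [] := BN r.
pose G := Icc a b `\` N0.
have mG : measurable (G : set (measurableTypeR R)) by exact: measurableD.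
have mfG : measurable_fun setT (f \_ G).
  apply: measurable_fun_gt => y; have [y0|y0] := ltP y 0.
    have -> : [set t | y < (f \_ G) t] = setT; last exact: measurableT.
    apply/seteqP; split => // t _ /=; rewrite patchE; case: ifPn => // tG.
    by apply: (lt_le_trans y0); apply: f0; move: tG; rewrite inE => -[].
  have -> : [set t | y < (f \_ G) t] = \bigcup_(r in [set r : rat | y <= ratr r]) (B r `&` G).
    apply/seteqP; split => t /=.
      rewrite patchE; case: ifPn => [|_]; last by rewrite ltNge y0.
      rewrite inE => Gt yf; have [r] := rat_in_itvoo yf.
      rewrite in_itv /= => /andP[r1 r2]; exists r; first exact: ltW.
      split => //; have [_ _ _ h] := BN r; apply/(h t); last by case: Gt.
      by case: Gt => _ nN Nt; apply: nN; exists r.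
    move=> [r /= yr [Br Gt]]; rewrite patchE mem_set//.
    have [_ _ _ h] := BN r; have [|_ /(_ Br) [_]] := h t; last exact: le_lt_trans.
    by case: Gt => _ nN Nt; apply: nN; exists r.
  rewrite bigcup_mkcond; apply: bigcupT_measurable_rat => r; case: ifP => // _.
  by apply: measurableI => //; have [] := BN r.
exists (f \_ G); split => //.
- by move=> t; rewrite patchE; case: ifPn => //; rewrite inE => -[/f0].
- have icf : cmu.-integrable (`]a, b]%classic : set (caratheodory_type _)) (EFin \o f).
    apply: (integrableS (borel_Lmeasurable mD) (borel_Lmeasurable (measurable_oc a b))) => // t.
    by rewrite /Icc /= in_itv /= => /andP[/ltW -> ->].
  have mfG' : measurable_fun (`]a, b]%classic : set (measurableTypeR R)) (EFin \o (f \_ G)).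
    by apply/measurable_EFinP; exact: measurable_funS mfG.
  have cmfG := borel_completed_measurable (measurable_oc a b) mfG'.
  have icfG : cmu.-integrable (`]a, b]%classic : set (caratheodory_type _)) (EFin \o (f \_ G)).
    apply: le_integrable icf => //; first exact: borel_Lmeasurable.
    move=> t _ /=; rewrite lee_fin patchE; case: ifPn => // _; by rewrite normr0.
  apply/integrableP; split => //; rewrite completed_integralE//.
  - by have [_] := integrableP _ _ _ icfG.
  - exact: measurableT_comp.
- exists N0; split => // t /= h.
  have [//|Nt] := pselect (N0 t); exfalso; apply: h => tab.
  by rewrite patchE mem_set.
Qed.

(** The way back: a result computed with a Borel representative is restated for the original
    function and the completed measure. *)
Lemma completed_transfer (t : R) (f f' : R -> R) (N : set R) :
  measurable_fun setT f' -> intb 0 t f' -> measurable (N : set (measurableTypeR R)) ->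
  mu N = 0%E -> (forall s, Icc 0 t s -> ~ N s -> f s = f' s) ->
  cmu.-integrable (Icc 0 t) (EFin \o f) /\ Rintegral cmu (Icc 0 t) f = itg 0 t f'.
Proof.
move=> mf' if' mN N0 ff'; have mD := measurable_Icc 0 t.
have mfD : measurable_fun (Icc 0 t : set (measurableTypeR R)) (EFin \o f').
  by apply/measurable_EFinP; exact: measurable_funS mf'.
have cmf' := borel_completed_measurable mD mfD.
have aeff : ae_eq cmu (Icc 0 t) (EFin \o f') (EFin \o f).
  exists N; split; [exact: sub_caratheodory|exact: N0|move=> s /= h].
  by have [//|Ns] := pselect (N s); exfalso; apply: h => st; rewrite ff'.
have cmf : measurable_fun (Icc 0 t : set (caratheodory_type ((@wlength R idfun)^*)%mu)) (EFin \o f).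
  exact: (ae_measurable_fun completed_lebesgue_measure_is_complete aeff cmf').
have cmD := borel_Lmeasurable mD.
have ifD : mu.-integrable (Icc 0 t) (EFin \o f').
  rewrite Icc_itv; apply/integrableP; split; first by rewrite -Icc_itv.
  rewrite -integral_itv_obnd_cbnd; first by have [_] := integrableP _ _ _ if'.
  by apply: measurableT_comp => //; apply/measurable_EFinP; exact: measurable_funS mf'.
have icf' : cmu.-integrable (Icc 0 t) (EFin \o f').
  apply/integrableP; split => //; rewrite -completed_integralE//.
  - by have [_] := integrableP _ _ _ ifD.
  - exact: measurableT_comp.
split.
  apply/integrableP; split => //.
  have [_] := integrableP _ _ _ icf'; apply: le_lt_trans; rewrite le_eqVlt.
  apply/orP; left; apply/eqP.
  have m1 := measurableT_comp (@abse_measurable _ _) cmf.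
  have m2 := measurableT_comp (@abse_measurable _ _) cmf'.
  exact: (ae_eq_integral _ _ cmD m1 m2 (ae_eq_abse (ae_eq_sym aeff))).
rewrite /Rintegral -(ae_eq_integral _ _ cmD cmf' cmf aeff); congr fine.
rewrite [in LHS]integralE -completed_integralE//; last exact: measurable_funepos.
rewrite -completed_integralE//; last exact: measurable_funeneg.
rewrite -integralE Icc_itv -integral_itv_obnd_cbnd//.
by apply/measurable_EFinP; exact: measurable_funS mf'.
Qed.

End Completion.

(** * Measurable selection of minimal norm *)

Section Selection.
Context {R : realType} {H : completeNormedModType R}.
Variable ip : H -> H -> R.
Hypothesis hip : inner_product ip.
Variable q : nat -> H.
Hypothesis dq : dense_seq q.
Local Notation mu := (@lebesgue_measure R).

(* The obtuse angle at [p] gives [|y|^2 >= |p|^2 + |y - p|^2]. *)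
Lemma near_min_norm (p y : H) (rho : R) : ip (0 - p) (y - p) <= 0 ->
  0 <= rho -> `|y| <= `|p| + rho -> `|y - p| ^+ 2 <= rho * (2 * `|p| + rho).
Proof.
rewrite sub0r (ipNl hip) (ipBr hip) (ipxx hip) => h r0 yr.
have y2 : `|y| ^+ 2 <= (`|p| + rho) ^+ 2 by rewrite lerXn2r ?nnegrE ?addr_ge0.
rewrite (normsqB hip) (ipC hip); move: y2 h; rewrite sqrrD !expr2; nra.
Qed.

Lemma min_norm_selection (T : R) (Phi : R -> set H) :
  (forall t, Icc 0 T t -> Phi t !=set0 /\ closed (Phi t) /\ convex_subset (Phi t)) ->
  mf_measurable (Icc 0 T) Phi ->
  exists (f : R -> H) (N : set R),
  [/\ wmeas ip f, measurable (N : set (measurableTypeR R)), mu N = 0%E,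
   forall t, Icc 0 T t -> ~ N t -> Phi t (f t) /\ forall y, Phi t y -> `|f t| <= `|y| &
   forall t, (~ Icc 0 T t \/ N t) -> f t = 0].
Proof.
move=> Phi_val mPhi.
pose hit (c : H) (r : R) := [set t | Icc 0 T t /\ Phi t `&` [set y | `|c - y| < r] !=set0].
have Lhit c r : Lmeasurable (hit c r).
  have -> : hit c r = [set t | Icc 0 T t /\ Phi t `&` ball c r !=set0].
    by rewrite /hit -ball_normE.
  by apply: mPhi; exact: ball_open.
pose e_ (k : nat) : R := k.+1%:R^-1.
(* The Boolean separates two tests on [Phi t]: meeting a small ball around [q j], or a ball around 0
   whose radius falls short of [|q j|] by [e_ k]. *)
pose hits (i : nat * nat * bool) :=
  if i.2 then hit (q i.1.1) (e_ i.1.2) else hit 0 (`|q i.1.1| - e_ i.1.2).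
have Lhits i : Lmeasurable (hits i) by rewrite /hits; case: ifP.
have /choice[BN hBN] i : exists p : set R * set R,
    [/\ measurable (p.1 : set (measurableTypeR R)),
        measurable (p.2 : set (measurableTypeR R)), mu p.2 = 0%E &
        forall t, ~ p.2 t -> (hits i t <-> p.1 t)].
  by have [B [N [h1 h2 h3 h4]]] := Lmeasurable_borel (Lhits i); exists (B, N).
pose N := \bigcup_i (BN i).2.
have [mN N0] : measurable (N : set (measurableTypeR R)) /\ mu N = 0%E.
  by apply: null_bigcup => i; have [] := hBN i.
pose G := Icc 0 T `\` N.
have mG : measurable (G : set (measurableTypeR R)).
  by apply: measurableD => //; exact: measurable_Icc.
(* [q j] is within [e_ k] of [Phi t], and its norm exceeds the distance from [0] to [Phi t] by
   at most [e_ k]: so [q (first_index (P k) t)] converges to the element of minimal norm. *)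
pose P k j := ~` G `|` ((BN (j, k, true)).1 `\` (BN (j, k, false)).1).
have mP k j : measurable (P k j : set (measurableTypeR R)).
  apply: measurableU; first exact: measurableC.
  by apply: measurableD; [have [] := hBN (j, k, true)|have [] := hBN (j, k, false)].
have e0 k : 0 < e_ k by rewrite /e_ invr_gt0.
have PG k j t : G t -> P k j t <-> hit (q j) (e_ k) t /\ ~ hit 0 (`|q j| - e_ k) t.
  move=> Gt; have [_ nN] := Gt.
  have [_ _ _ /(_ t) h1] := hBN (j, k, true); have [_ _ _ /(_ t) h2] := hBN (j, k, false).
  have {}h1 := h1 (fun h => nN (ex_intro2 _ _ (j, k, true) I h)).
  have {}h2 := h2 (fun h => nN (ex_intro2 _ _ (j, k, false) I h)).
  rewrite /hits /= in h1 h2; split; first by move=> [//|[/h1 ? b2]]; split => // /h2.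
  by move=> [/h1 ? b2]; right; split => // /h2.
have proj t : Icc 0 T t -> exists p, Phi t p /\ forall y, Phi t y -> ip (0 - p) (y - p) <= 0.
  move=> tI; have [h1 [h2 h3]] := Phi_val t tI.
  by have [p Pp pP] := proj_closed_convex hip 0 h1 h2 h3; exists p.
have pmin t p y : (forall y, Phi t y -> ip (0 - p) (y - p) <= 0) -> Phi t y -> `|p| <= `|y|.
  move=> pP /pP; rewrite sub0r (ipNl hip) (ipBr hip) (ipxx hip) oppr_le0 subr_ge0 => h.
  have [->|p0] := eqVneq p 0; first by rewrite normr0.
  have := le_trans h (ip_le_norm hip p y).
  by rewrite expr2 ler_pM2l// normr_gt0.
have Pex k t : exists j, P k j t.
  have [Gt|Gt] := pselect (G t); last by exists 0%N; left.
  have [tI _] := Gt; have [p [Pp pP]] := proj t tI.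
  have [j pj] := dq p (e0 k); exists j; apply/(PG k j t Gt); split.
    by split => //; exists p; split => //=; rewrite distrC.
  move=> [_ [y [Py /=]]]; rewrite sub0r normrN => yq.
  have := pmin t p y pP Py; have := ler_normB p (p - q j); rewrite opprB subrKC; lra.
have /choice[p0 p0P] t : exists p, Icc 0 T t ->
    Phi t p /\ forall y, Phi t y -> ip (0 - p) (y - p) <= 0.
  by have [/proj[p pP]|nt] := pselect (Icc 0 T t); [exists p|exists 0].
pose f t := \1_G t *: p0 t.
pose fk k t := \1_G t *: q (first_index (P k) t).
have wfk k : wmeas ip (fk k).
  apply: (wmeasZ hip); first exact: measurable_indic.
  apply: (wmeas_glue (u := fun j _ => q j) (idx := first_index (P k))).
    by move=> i; apply: measurable_first_index => [n|t]; [exact: mP|exact: Pex].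
  by move=> i; exact: wmeas_cst.
have fG t : G t -> f t = p0 t by move=> Gt; rewrite /f indicE mem_set// scale1r.
have fnG t : ~ G t -> f t = 0 by move=> Gt; rewrite /f indicE memNset// scale0r.
have fkf t : fk k t @[k --> \oo] --> f t.
  have [Gt|nG] := pselect (G t); last first.
    rewrite fnG// (_ : (fun k => fk k t) = fun=> 0); first exact: cvg_cst.
    by apply/funext => k; rewrite /fk indicE memNset// scale0r.
  have [tI _] := Gt; have [Pp pP] := p0P t tI; rewrite fG//; set p := p0 t in Pp pP *.
  apply/cvgrPdist_lt => eps eps0.
  have r1 : 0 < eps / 2 by rewrite divr_gt0.
  have p1 : 0 < 4 * (`|p| + 1) by rewrite mulr_gt0// ltr_wpDl.
  (* [near_min_norm] is used with [rho = 2 e_ k]; for [e_ k <= 1] its bound is at most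
     [4 e_ k (|p| + 1)]. *)
  have r2 : 0 < (eps / 2) ^+ 2 / (4 * (`|p| + 1)).
    by rewrite divr_gt0 ?exprn_gt0.
  near=> k.
  have k1 : e_ k < eps / 2 by near: k; exact: (near_infty_natSinv_lt (PosNum r1)).
  have k2 : e_ k < (eps / 2) ^+ 2 / (4 * (`|p| + 1)).
    by near: k; exact: (near_infty_natSinv_lt (PosNum r2)).
  have k3 : e_ k <= 1 by rewrite /e_ invf_le1// ler1n.
  rewrite /fk indicE mem_set// scale1r; set j := first_index (P k) t.
  have [/(PG k j t Gt)[[_ [y [Py /= yq]]] nh] _] := first_indexP (Pex k t).
  have qj : `|q j| <= `|p| + e_ k.
    rewrite leNgt; apply/negP => h; apply: nh; split => //; exists p; split => //=.
    by rewrite sub0r normrN ltrBrDr.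
  have yp : `|y| <= `|p| + 2 * e_ k.
    have := ler_normB (q j) (q j - y); rewrite opprB subrKC.
    by move: qj yq; lra.
  have e2 : 0 <= 2 * e_ k by rewrite mulr_ge0// ltW.
  have d2 := near_min_norm (pP y Py) e2 yp.
  have d1 : `|y - p| < eps / 2.
    rewrite -ltr_sqr ?nnegrE ?(ltW r1)//; apply: (le_lt_trans d2).
    move: k2; rewrite ltr_pdivlMr//; apply: le_lt_trans.
    have := normr_ge0 p; move: (e0 k) k3; clear; nra.
  rewrite -(subrK y p) -addrA; apply: (le_lt_trans (ler_normD _ _)).
  rewrite [ltRHS]splitr ltrD//; first by rewrite distrC.
  by rewrite distrC (lt_trans yq).
exists f, N; split => //.
- exact: (wmeas_cvg hip wfk).
- move=> t tI nN; have [Pp pP] := p0P t tI.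
  have Gt : G t by [].
  by rewrite fG//; split => // y Py; exact: (pmin t).
- by move=> t h; apply: fnG => -[tI nN]; case: h.
Unshelve. all: by end_near. Qed.

End Selection.

(** * The Volterra term *)

Section VolterraOperator.
Context {R : realType} {H : completeNormedModType R}.
Variable ip : H -> H -> R.
Hypothesis hip : inner_product ip.
Variable q : nat -> H.
Hypothesis dq : dense_seq q.
Local Notation mu := (@lebesgue_measure R).
Implicit Types (y : R -> H) (t s r m e : R).
Variables (T : R) (g : R -> R -> H -> H) (sigma : R * R -> R).
Hypothesis T0 : 0 < T.
Hypothesis wg : forall y : R -> H, wmeas ip y ->
  wmeas ip (fun ts : measurableTypeR R * measurableTypeR R => g ts.1 ts.2 (y ts.2)).
Hypothesis g_le : forall t s x, `|g t s x| <= sigma (t, s) * (1 + `|x|).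
Hypothesis g_off : forall t s x, ~ (0 < s <= t) -> g t s x = 0.
Hypothesis sigma0 : forall ts, 0 <= sigma ts.
Hypothesis isigma : forall t, mu.-integrable setT (EFin \o (fun s => sigma (t, s))).

(** The value 0 on rows that are not integrable lets [wmeas_volterra] hold for every measurable [y],
    bounded or not. *)
Definition volterra (y : R -> H) (t : R) : H :=
  if `[< bint mu setT (fun s => g t s (y s)) >] then vint ip mu setT (fun s => g t s (y s))
  else 0.

Definition row_mass t := Rintegral mu setT (fun s => sigma (t, s)).

Lemma wmeas_row y t : wmeas ip y -> wmeas ip (fun s => g t s (y s)).
Proof.
by move=> wy e; exact: (measurableT_comp (wg wy e) (pair1_measurable (T2 := measurableTypeR R) t)).
Qed.

(** Joint integrability is not known, so Tonelli is applied to the positive and negative parts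
    separately, and the result is kept only on the measurable set [B] of integrable rows. *)
Lemma wmeas_volterra y : wmeas ip y -> wmeas ip (volterra y).
Proof.
move=> wy e.
pose h (ts : measurableTypeR R * measurableTypeR R) := ip (g ts.1 ts.2 (y ts.2)) e.
pose n (ts : measurableTypeR R * measurableTypeR R) := `|g ts.1 ts.2 (y ts.2)|.
have mh : measurable_fun setT (EFin \o h) by apply/measurable_EFinP; exact: wg.
have mn : measurable_fun setT (EFin \o n).
  by apply/measurable_EFinP; apply: (wmeas_norm hip dq); exact: wg.
have mN : measurable_fun setT (fubini_F mu (EFin \o n)).
  by apply: measurable_fun_fubini_tonelli_F => // ts; rewrite /= lee_fin /n.
pose B := [set t | fubini_F mu (EFin \o n) t < +oo]%E.
have mB : measurable (B : set (measurableTypeR R)).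
  have := mN measurableT _ (emeasurable_itv (Interval -oo%O (BLeft +oo%E))).
  by rewrite setTI; congr measurable; apply/seteqP; split => t /=; rewrite /B /= in_itv.
have BP t : B t <-> bint mu setT (fun s => g t s (y s)).
  split => [Bt|/integrableP[_]].
    apply/integrableP; split.
      by apply/measurable_EFinP; apply: (wmeas_norm hip dq); exact: wmeas_row.
    by under eq_integral do rewrite /= normr_id.
  by under eq_integral do rewrite /= normr_id.
have -> : (fun t => ip (volterra y t) e) =
    (fun t => \1_B t * fine (fubini_F mu (EFin \o h)^\+ t - fubini_F mu (EFin \o h)^\- t)%E).
  apply/funext => t; rewrite /volterra indicE; case: ifPn => [/asboolP bt|/asboolPn nb].
    rewrite mem_set; last exact/BP.
    rewrite mul1r vintP//; last exact: wmeas_row.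
    by rewrite /Rintegral integralE /fubini_F; congr (fine (_ - _)%E); apply: eq_integral => s _; rewrite ?funeposE ?funenegE.
  by rewrite memNset ?mul0r ?(ip0l hip)// => /BP.
apply: measurable_funM; first exact: measurable_indic.
apply: (measurableT_comp (fine_measurable measurableT)).
apply: emeasurable_funB; apply: measurable_fun_fubini_tonelli_F.
- exact: measurable_funepos.
- by move=> x; exact: funepos_ge0.
- exact: measurable_funeneg.
- by move=> x; exact: funeneg_ge0.
Qed.

Lemma volterra_causal y (y' : R -> H) t : (forall s, 0 < s <= t -> y s = y' s) ->
  volterra y t = volterra y' t.
Proof.
move=> yy'; rewrite /volterra.
have -> // : (fun s => g t s (y s)) = (fun s => g t s (y' s)).
apply/funext => s; have [h|/negP h] := boolP (0 < s <= t); first by rewrite yy'.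
by rewrite !g_off.
Qed.

Lemma row_le y t r : wmeas ip y -> 0 <= r -> (forall s, 0 < s <= t -> `|y s| <= r) ->
  forall s, `|g t s (y s)| <= sigma (t, s) * (1 + r).
Proof.
move=> wy r0 yr s; have [h|/negP h] := boolP (0 < s <= t).
  by rewrite (le_trans (g_le _ _ _))// ler_wpM2l// lerD2l yr.
by rewrite g_off// normr0 mulr_ge0// addr_ge0.
Qed.

Lemma bint_row y t r : wmeas ip y -> 0 <= r -> (forall s, 0 < s <= t -> `|y s| <= r) ->
  bint mu setT (fun s => g t s (y s)).
Proof.
move=> wy r0 yr.
apply: (bint_le hip dq (mu := mu) (g := fun s => sigma (t, s) * (1 + r)) measurableT
  (wmeas_row t wy)) => [s _|]; first exact: row_le.
by have := integrableZr measurableT (1 + r) (isigma t); apply: eq_integrable.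
Qed.

Lemma volterraE y t r : wmeas ip y -> 0 <= r -> (forall s, 0 < s <= t -> `|y s| <= r) ->
  volterra y t = vint ip mu setT (fun s => g t s (y s)).
Proof. by move=> wy r0 yr; rewrite /volterra asboolT//; exact: bint_row r0 yr. Qed.

Lemma volterra_le y t r : wmeas ip y -> 0 <= r -> (forall s, 0 < s <= t -> `|y s| <= r) ->
  `|volterra y t| <= row_mass t * (1 + r).
Proof.
move=> wy r0 yr; rewrite (volterraE wy r0 yr).
have br := bint_row wy r0 yr; apply: (le_trans (ler_norm_vint hip (mu := mu) measurableT (wmeas_row t wy) br)).
rewrite -RintegralZr//; apply: le_Rintegral => //.
- by have := integrableZr measurableT (1 + r) (isigma t); apply: eq_integrable.
- by move=> s _; exact: row_le.
Qed.

(** The Lipschitz weight depends on [t] only, so integrating over [s] costs a factor [T]. *)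
Lemma volterra_lip y (y' : R -> H) t r m e : 0 < t <= T -> wmeas ip y -> wmeas ip y' -> 0 <= r -> 0 <= e ->
  (forall s, 0 < s <= T -> [/\ `|y s| <= r, `|y' s| <= r & `|y s - y' s| <= e]) -> 0 <= m ->
  (forall s x x', `|x| <= r -> `|x'| <= r -> `|g t s x - g t s x'| <= m * `|x - x'|) ->
  `|volterra y t - volterra y' t| <= T * m * e.
Proof.
move=> /andP[t0 tT] wy wy' r0 e0 h m0 gm.
have hT s : 0 < s <= t -> 0 < s <= T by move=> /andP[-> st]; exact: le_trans tT.
have yr s : 0 < s <= t -> `|y s| <= r by move=> /hT /h[].
have yr' s : 0 < s <= t -> `|y' s| <= r by move=> /hT /h[].
rewrite (volterraE wy r0 yr) (volterraE wy' r0 yr').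
have w := wmeas_row t wy; have w' := wmeas_row t wy'.
have b := bint_row wy r0 yr; have b' := bint_row wy' r0 yr'.
have wB : wmeas ip (fun s => g t s (y s) - g t s (y' s)) by exact: (wmeasB hip).
have gle s : `|g t s (y s) - g t s (y' s)| <= m * e * \1_(`]0, T]%classic) s.
  rewrite indicE; have [s0|/negP s0] := boolP (0 < s <= T).
    rewrite mem_set /= ?in_itv//= mulr1; have [h1 h2 h3] := h s s0.
    by rewrite (le_trans (gm _ _ _ h1 h2))// ler_wpM2l.
  rewrite !g_off ?subrr ?normr0 ?mulr_ge0//; by move=> /hT.
have i1 : mu.-integrable setT (EFin \o (fun s => m * e * \1_(`]0, T]%classic) s)).
  have := integrableZl measurableT (m * e) (integrable_indic_itv 0 T false false).
  by apply: eq_integrable.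
have bB : bint mu setT (fun s => g t s (y s) - g t s (y' s)).
  exact: (bint_le hip dq (mu := mu) measurableT wB (fun s _ => gle s)).
have -> : vint ip mu setT (fun s => g t s (y s)) - vint ip mu setT (fun s => g t s (y' s)) =
    vint ip mu setT (fun s => g t s (y s) - g t s (y' s)).
  apply: (ip_inj hip) => x; rewrite (ipBl hip) !vintP// -RintegralB//.
  - by apply: eq_Rintegral => s _; rewrite (ipBl hip).
  - exact: bint_ip.
  - exact: bint_ip.
apply: (le_trans (ler_norm_vint hip (mu := mu) measurableT wB bB)).
apply: (@le_trans _ _ (Rintegral mu setT (fun s => m * e * \1_(`]0, T]%classic) s))).
  by apply: le_Rintegral.
rewrite RintegralZl//; last exact: integrable_indic_itv.
have -> : Rintegral mu setT (\1_(`]0, T]%classic) : R -> R) = T.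
  rewrite /Rintegral integral_indic// setIT /= lebesgue_measure_itv /= lte_fin T0.
  by rewrite oppr0 addr0.
by rewrite mulrC mulrA.
Qed.

End VolterraOperator.

Lemma ae_null_set d (T : measurableType d) (R : realType) (mu : {measure set T -> \bar R})
    (P : T -> Prop) : {ae mu, forall t, P t} ->
  exists N, [/\ measurable N, mu N = 0%E & forall t, ~ N t -> P t].
Proof.
move=> [N [mN N0 NP]]; exists N; split => // t nN.
by apply: contrapT => nP; apply: nN; apply: NP.
Qed.

(** * A Borel version of the kernel *)

Section KernelMeasurability.
Context {R : realType} {H : completeNormedModType R}.
Variable ip : H -> H -> R.
Hypothesis hip : inner_product ip.
Variable q : nat -> H.
Hypothesis dq : dense_seq q.

Lemma cvg_natSinv (u : nat -> H) (l : H) : (forall k, `|l - u k| < k.+1%:R^-1) ->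
  u k @[k --> \oo] --> l.
Proof.
move=> h; apply/cvgrPdist_lt => e e0; near=> k; apply: (lt_trans (h k)).
by near: k; exact: (near_infty_natSinv_lt (PosNum e0)).
Unshelve. all: by end_near. Qed.

Lemma wmeas_of_balls d (T : measurableType d) (u : T -> H) :
  (forall k l, measurable [set t | `|u t - q k| < l.+1%:R^-1]) -> wmeas ip u.
Proof.
move=> mB; pose P l k := [set t | `|u t - q k| < l.+1%:R^-1].
have Pex l t : exists k, P l k t by apply: dq; rewrite invr_gt0.
apply: (wmeas_cvg hip (u := fun l t => q (first_index (P l) t))) => [l|t].
  apply: (wmeas_glue (u := fun k _ => q k)) => i; last exact: wmeas_cst.
  by apply: measurable_first_index => [k|t]; [exact: mB|exact: Pex].
by apply: cvg_natSinv => l; have [] := first_indexP (Pex l t).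
Qed.

(** Approximate [y] by functions with countably many values [q k], for which composition is gluing;
    local Lipschitz continuity in the state carries the limit. *)
Lemma wmeas_caratheodory d (T : measurableType d) (h : T -> H -> H) (y : T -> H) :
  (forall k, wmeas ip (fun t => h t (q k))) ->
  (forall t r, 0 <= r -> exists m, forall x x', `|x| <= r -> `|x'| <= r ->
     `|h t x - h t x'| <= m * `|x - x'|) ->
  wmeas ip y -> wmeas ip (fun t => h t (y t)).
Proof.
move=> mh lh wy; pose P l k := [set t | `|y t - q k| < l.+1%:R^-1].
have Pex l t : exists k, P l k t by apply: dq; rewrite invr_gt0.
apply: (wmeas_cvg hip (u := fun l t => h t (q (first_index (P l) t)))) => [l|t].
  apply: (wmeas_glue (u := fun k t => h t (q k))) => // i.
  apply: measurable_first_index => [k|t]; last exact: Pex.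
  apply: measurable_lt_fun; last exact: measurable_cst.
  by apply: (wmeas_norm hip dq); apply: (wmeasB hip) => //; exact: wmeas_cst.
have hP l : `|y t - q (first_index (P l) t)| < l.+1%:R^-1.
  by have [] := first_indexP (Pex l t).
have r0 : 0 <= `|y t| + 1 by rewrite addr_ge0.
have [m hm] := lh t _ r0.
apply/cvgrPdist_lt => e e0.
have m1 : 0 < `|m| + 1 by rewrite ltr_wpDl.
have em : 0 < e / (`|m| + 1) by rewrite divr_gt0.
near=> l.
have l1 : l.+1%:R^-1 < e / (`|m| + 1) :> R.
  by near: l; exact: (near_infty_natSinv_lt (PosNum em)).
set z := q _; have yz := hP l; rewrite -/z in yz.
have zr : `|z| <= `|y t| + 1.
  have := ler_normB (y t) (y t - z); rewrite opprB subrKC => /le_trans; apply.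
  by rewrite lerD2l (le_trans (ltW yz))// invf_le1// ler1n.
have yr : `|y t| <= `|y t| + 1 by rewrite lerDl.
apply: (le_lt_trans (hm _ _ yr zr)).
have h1 := lt_trans yz l1; rewrite ltr_pdivlMr// in h1.
apply: le_lt_trans h1; rewrite mulrC ler_wpM2l//.
by rewrite (le_trans (ler_norm _))// lerDl.
Unshelve. all: by end_near. Qed.

End KernelMeasurability.

Section PlaneSets.
Context {R : realType}.
Local Notation mu := (@lebesgue_measure R).
Local Notation plane := (measurableTypeR R * measurableTypeR R)%type.

(** A planar null set may meet individual rows in large sets, but by Tonelli only for a null set of
    times. *)
Lemma null_sections (N : set plane) : measurable N -> leb2 N = 0%E ->
  {ae mu, forall t, mu (xsection N t) = 0%E}.
Proof.
move=> mN N0.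
have mphi := measurable_fun_xsection mu mN.
have : (\int[mu]_t `|(mu \o xsection N) t| = 0)%E.
  by rewrite -[RHS]N0; apply: eq_integral => t _; rewrite /= gee0_abs.
move/(ae_eq_integral_abs mu measurableT mphi); apply: ae_imp => t; exact.
Qed.

Lemma measurable_triangle (T : R) : measurable (triangle T : set plane).
Proof.
have -> : triangle T = [set ts : plane | 0 <= ts.2] `&`
    ([set ts : plane | ts.2 <= ts.1] `&` [set ts : plane | ts.1 <= T]).
  by apply/seteqP; split => ts.
have m1 : measurable_fun setT (fst : plane -> R) by exact: measurable_fst.
have m2 : measurable_fun setT (snd : plane -> R) by exact: measurable_snd.
by apply: measurableI; [|apply: measurableI]; apply: measurable_le_fun => //;
  exact: measurable_cst.
Qed.

End PlaneSets.

Section BorelKernel.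
Context {R : realType} {H : completeNormedModType R}.
Variable ip : H -> H -> R.
Hypothesis hip : inner_product ip.
Variable q : nat -> H.
Hypothesis dq : dense_seq q.
Local Notation mu := (@lebesgue_measure R).
Local Notation plane := (measurableTypeR R * measurableTypeR R)%type.
Variables (T : R) (g : R -> R -> H -> H).
Hypothesis T0 : 0 < T.
Hypothesis g_meas : forall v,
  Hmeasurable2 (Icc 0 T `*` Icc 0 T) (fun ts => g ts.1 ts.2 v).
Hypothesis g_lip : forall r : R, 0 < r -> exists mu : R -> R,
  [/\ forall t, Icc 0 T t -> 0 <= mu t, Lintegrable (Icc 0 T) mu &
    forall t s x y, triangle T (t, s) -> `|x| <= r -> `|y| <= r ->
      `|g t s x - g t s y| <= mu t * `|x - y|].
Hypothesis g_growth : exists sigma : R * R -> R,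
  [/\ forall ts, triangle T ts -> 0 <= sigma ts, Lintegrable2 (triangle T) sigma &
    forall t s x, triangle T (t, s) -> `|g t s x| <= sigma (t, s) * (1 + `|x|)].

Lemma kernel_balls : exists (N : set plane) (B : nat -> nat -> nat -> set plane),
  [/\ measurable N, leb2 N = 0%E, forall j k l, measurable (B j k l) &
   forall j k l (ts : plane), triangle T ts -> ~ N ts ->
     `|g ts.1 ts.2 (q j) - q k| < l.+1%:R^-1 <-> B j k l ts].
Proof.
pose hit (i : nat * nat * nat) (ts : plane) :=
  ball (q i.1.2) (i.2.+1%:R^-1 : R) (g ts.1 ts.2 (q i.1.1)).
have /choice[BN hBN] i : exists p : set plane * set plane,
    [/\ measurable p.1, measurable p.2, leb2 p.2 = 0%E &
      forall ts, triangle T ts -> ~ p.2 ts -> (hit i ts <-> p.1 ts)].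
  have [B [N [mB mN N0 BN]]] :=
    g_meas (q i.1.1) (ball_open (q i.1.2) (i.2.+1%:R^-1 : R)).
  exists (B, N); split => // -[t s] [/= s0 [st tT]] nN.
  have D : (Icc 0 T `*` Icc 0 T) (t, s).
    by split; rewrite /Icc /= ?s0 ?tT ?(le_trans s0 st) ?(le_trans st tT).
  split => h; apply: contrapT => nh; apply: nN; apply: BN; first by left.
  by right; split => // -[_ ?]; apply: nh.
have [mN N0] : measurable (\bigcup_i (BN i).2) /\ leb2 (\bigcup_i (BN i).2) = 0%E.
  by apply: (@null_bigcup _ _ _ (mu \x mu)%E) => i; have [] := hBN i.
exists (\bigcup_i (BN i).2), (fun j k l => (BN (j, k, l)).1); split => // [j k l|j k l ts tri nN].
  by have [] := hBN (j, k, l).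
have [_ _ _ h] := hBN (j, k, l).
rewrite -h//; last by move=> b; apply: nN; exists (j, k, l).
by rewrite /hit -ball_normE /= distrC.
Qed.

Lemma local_lipschitz_weights : exists m : nat -> R -> R,
  [/\ forall n t, 0 <= m n t, forall n, intb 0 T (m n) &
   {ae mu, forall t, forall n s x y, triangle T (t, s) -> `|x| <= n.+1%:R -> `|y| <= n.+1%:R ->
      `|g t s x - g t s y| <= m n t * `|x - y|}].
Proof.
have /choice[m hm] n : exists m : R -> R, [/\ forall t, 0 <= m t, intb 0 T m &
    {ae mu, forall t, forall s x y, triangle T (t, s) -> `|x| <= n.+1%:R -> `|y| <= n.+1%:R ->
      `|g t s x - g t s y| <= m t * `|x - y|}].
  have [w [w0 iw gw]] := g_lip (ltr0Sn R n).
  have [m [_ m0 im wm]] := Lintegrable_borel iw w0.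
  exists m; split => //; apply: ae_imp wm => t h s x y tri xr yr.
  rewrite -h; first exact: gw.
  by have [/= s0 [st tT]] := tri; rewrite tT (le_trans s0 st).
exists m; split => [n t|n|]; [by have [] := hm n|by have [] := hm n|].
have : {ae mu, forall t, forall n, forall s x y, triangle T (t, s) ->
    `|x| <= n.+1%:R -> `|y| <= n.+1%:R -> `|g t s x - g t s y| <= m n t * `|x - y|}.
  by apply: ae_all => n; have [] := hm n.
by apply: ae_imp.
Qed.

Lemma growth_weight : exists (sigma : plane -> R) (N : set plane),
  [/\ forall ts, 0 <= sigma ts, (mu \x mu)%E.-integrable setT (EFin \o sigma),
      measurable N, leb2 N = 0%E &
    forall t s x, triangle T (t, s) -> ~ N (t, s) -> `|g t s x| <= sigma (t, s) * (1 + `|x|)].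
Proof.
have [sigma [sigma0 [f [iff [N [mN N0 sf]]]] gs]] := g_growth.
have mtri := measurable_triangle T.
have i1 : (mu \x mu)%E.-integrable setT ((EFin \o f) \_ (triangle T)).
  by apply/integrable_restrict => //; rewrite setTI.
exists (fun ts => `|(f \_ (triangle T)) ts|), N; split => //.
  have := integrable_abse i1; apply: eq_integrable => // ts _ /=.
  by rewrite restrict_EFin.
move=> t s x tri nN; apply: (le_trans (gs _ _ _ tri)); rewrite ler_wpM2r ?addr_ge0//.
rewrite patchE mem_set//.
have -> : sigma (t, s) = f (t, s); last exact: ler_norm.
by apply: contrapT => h; apply: nN; apply: sf.
Qed.

Lemma borel_kernel : exists (h : R -> R -> H -> H) (sigma : R * R -> R),
  [/\ [/\ forall y : R -> H, wmeas ip y -> wmeas ip (fun ts : plane => h ts.1 ts.2 (y ts.2)),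
          forall t s x, `|h t s x| <= sigma (t, s) * (1 + `|x|) &
          forall t s x, ~ (0 < s <= t) -> h t s x = 0],
      [/\ forall ts, 0 <= sigma ts,
          forall t, mu.-integrable setT (EFin \o (fun s => sigma (t, s))),
          measurable_fun setT (row_mass sigma) & intb 0 T (row_mass sigma)],
      forall r, 0 <= r -> exists m : R -> R, [/\ forall t, 0 <= m t, intb 0 T m &
        forall t s x y, `|x| <= r -> `|y| <= r ->
          `|h t s x - h t s y| <= m t * `|x - y|] &
      {ae mu, forall t, Icc 0 T t -> exists N, [/\ measurable (N : set (measurableTypeR R)),
         mu N = 0%E & forall s x, Icc 0 t s -> ~ N s -> g t s x = h t s x]}].
Proof.
have [N1 [B [mN1 N10 mB hB]]] := kernel_balls.
have [m [m0 im aem]] := local_lipschitz_weights.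
have [sg [N2 [sg0 isg mN2 N20 gsg]]] := growth_weight.
pose N0 := N1 `|` N2.
have mN0 : measurable N0 by exact: measurableU.
have N00 : leb2 N0 = 0%E by exact: (null_set_setU (mu := (mu \x mu)%E)).
have [E1 [mE1 E10 hE1]] := ae_null_set aem.
have [E2 [mE2 E20 hE2]] := ae_null_set (null_sections mN0 N00).
have [E3 [mE3 E30 hE3]] := ae_null_set (ae_integrable1 isg).
(* Times to discard: the Lipschitz weights may fail there, the section of [N0] may not be null, or
   the row of [sg] may not be integrable. *)
pose E := E1 `|` E2 `|` E3.
have mE : measurable (E : set (measurableTypeR R)) by do 2?apply: measurableU.
have E0 : mu E = 0%E.
  by apply: null_set_setU => //; [exact: measurableU|exact: null_set_setU].
(* The good part of the triangle, where [g] is kept. Excluding [s = 0] supports the kernel in []0,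
   t]], in line with the half-open integrals. *)
pose G : set plane := [set ts | [/\ triangle T ts, 0 < ts.2, ~ E ts.1 & ~ N0 ts]].
have mG : measurable G.
  have -> : G = triangle T `&` ([set ts | 0 < ts.2] `&` (~` (fst @^-1` E) `&` ~` N0)).
    by apply/seteqP; split => [ts []|ts [? [? []]]].
  apply: measurableI; first exact: measurable_triangle.
  apply: measurableI.
    by apply: measurable_lt_fun; [exact: measurable_cst|exact: measurable_snd].
  apply: measurableI; last exact: measurableC.
  apply: measurableC; rewrite -[X in measurable X]setTI; exact: measurable_fst.
pose h t s x : H := if `[< G (t, s) >] then g t s x else 0.
have hG t s x : G (t, s) -> h t s x = g t s x by move=> Gts; rewrite /h asboolT.
have hnG t s x : ~ G (t, s) -> h t s x = 0 by move=> Gts; rewrite /h asboolF.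
(* Killing the times in [E] makes every row integrable, not just almost every one. *)
pose sigma (ts : R * R) := sg ts * \1_(~` E) ts.1.
have h_lip n t s x y : `|x| <= n.+1%:R -> `|y| <= n.+1%:R ->
    `|h t s x - h t s y| <= m n t * `|x - y|.
  have [Gts|nG] := pselect (G (t, s)); last first.
    by rewrite !hnG// subrr normr0 mulr_ge0.
  have [tri _ nE _] := Gts; rewrite !hG//; apply: hE1 => // e; apply: nE.
  by left; left.
have sigma0 ts : 0 <= sigma ts by rewrite mulr_ge0// indicE.
have isigma t : mu.-integrable setT (EFin \o (fun s => sigma (t, s))).
  have [Et|nE] := pselect (E t).
    have -> : (fun s => sigma (t, s)) = cst 0.
      by apply/funext => s; rewrite /sigma indicE /= memNset ?mulr0// => /(_ Et).
    exact: integrable0.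
  have -> : (fun s => sigma (t, s)) = (fun s => sg (t, s)).
    by apply/funext => s; rewrite /sigma indicE /= mem_set ?mulr1.
  by apply: hE3 => e; apply: nE; right.
have msg : measurable_fun setT sg by apply/measurable_EFinP; exact: measurable_int isg.
have msigma : measurable_fun setT (sigma : plane -> R).
  apply: measurable_funM => //.
  apply: (measurableT_comp (f := \1_(~` E) : measurableTypeR R -> R)); last exact: measurable_fst.
  by apply: measurable_indic; exact: measurableC.
have isig2 : (mu \x mu)%E.-integrable setT (EFin \o sigma).
  apply: le_integrable isg => //; first exact/measurable_EFinP.
  move=> ts _ /=; rewrite lee_fin !ger0_norm// /sigma indicE.
  by case: (_ \in _); rewrite ?mulr1 ?mulr0.
have rowE : EFin \o row_mass sigma = fubini_F mu (EFin \o sigma).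
  apply/funext => t; rewrite /row_mass /Rintegral /fubini_F /= fineK//.
  by apply: integrable_fin_num => //; exact: isigma.
have irow : mu.-integrable setT (EFin \o row_mass sigma).
  by rewrite rowE; exact: integrable_fubini_F.
exists h, sigma; split.
- split.
  + move=> y wy.
    apply: (wmeas_caratheodory hip dq (h := fun (ts : plane) x => h ts.1 ts.2 x)
      (y := fun ts : plane => y ts.2)).
    * move=> j; apply: (wmeas_of_balls hip dq) => k l.
      have -> : [set ts : plane | `|h ts.1 ts.2 (q j) - q k| < l.+1%:R^-1] =
          (G `&` B j k l) `|` (~` G `&` [set ts | `|0 - q k| < l.+1%:R^-1]).
        apply/seteqP; split => -[t s] /=; have [Gts|nG] := pselect (G (t, s)).
        - have [tri _ _ nN] := Gts; rewrite hG// => w; left; split => //.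
          by apply/(hB j k l (t, s) tri) => // n; apply: nN; left.
        - by rewrite hnG// => w; right.
        - have [tri _ _ nN] := Gts; rewrite hG// => -[[_ w]|[]//].
          by apply/(hB j k l (t, s) tri) => // n; apply: nN; left.
        - by rewrite hnG// => -[[]//|[]].
      apply: measurableU; apply: measurableI => //; first exact: measurableC.
      by apply: measurable_lt_fun; exact: measurable_cst.
    * move=> ts r r0; exists (m (Num.truncn r) ts.1) => x x' xr xr'.
      by apply: h_lip; rewrite (le_trans _ (ltW (truncnS_gt r))).
    * exact: (wmeas_comp measurable_snd wy).
  + move=> t s x; have [Gts|nG] := pselect (G (t, s)); last first.
      by rewrite hnG// normr0 mulr_ge0// addr_ge0.
    have [tri _ nE nN] := Gts; rewrite hG// /sigma indicE mem_set// mulr1.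
    by apply: gsg => // n; apply: nN; right.
  + move=> t s x nst; apply: hnG => -[[_ [st _]] s0 _ _].
    by apply: nst; rewrite s0.
- split => //; first by apply/measurable_EFinP; exact: measurable_int irow.
  by apply: (integrableS measurableT (measurable_oc 0 T) _ irow).
- move=> r r0; exists (m (Num.truncn r)); split => // t s x y xr yr.
  by apply: h_lip; rewrite (le_trans _ (ltW (truncnS_gt r))).
- exists E; split => // t /= nP; apply: contrapT => nE; apply: nP => /andP[t0 tT].
  exists (xsection N0 t `|` [set 0]).
  have mX : measurable (xsection N0 t : set (measurableTypeR R)) by exact: measurable_xsection.
  split; first by apply: measurableU => //; exact: measurable_set1.
    apply: null_set_setU => //; last exact: lebesgue_measure_set1.
    by apply: hE2 => e; apply: nE; left; right.
  move=> s x /andP[s0 st] nN; rewrite hG//; split => //=.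
    by rewrite lt_neqAle s0 andbT; apply/eqP => e; apply: nN; right.
  by move=> n; apply: nN; left; rewrite /xsection /= inE.
Qed.

End BorelKernel.

(** * Existence of a solution *)

Section GrowthSelection.
Context {R : realType} {H : completeNormedModType R}.
Variable ip : H -> H -> R.
Hypothesis hip : inner_product ip.
Variable q : nat -> H.
Hypothesis dq : dense_seq q.
Local Notation mu := (@lebesgue_measure R).

(** The least norm in [F t v] is the infimum in the growth condition, and
    [c |v| + d <= (c + d) (1 + |v|)] leaves the single weight [c0 = c' + d']. *)
Lemma linear_growth_selection (T : R) (F : R -> H -> set H) (c d : R -> R) :
  (forall t v, Icc 0 T t -> F t v !=set0 /\ closed (F t v) /\ convex_subset (F t v)) ->
  (forall v, mf_measurable (Icc 0 T) (fun t => F t v)) ->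
  (forall t, Icc 0 T t -> 0 <= c t /\ 0 <= d t) ->
  Lintegrable (Icc 0 T) c -> Lintegrable (Icc 0 T) d ->
  {ae mu, forall t, Icc 0 T t ->
     forall v, inf [set `|w| | w in F t v] <= c t * `|v| + d t} ->
  exists (fs : H -> R -> H) (c0 : R -> R),
  [/\ [/\ forall t, 0 <= c0 t, measurable_fun setT c0 & intb 0 T c0],
   forall v, wmeas ip (fs v),
   forall v t, `|fs v t| <= c0 t * (1 + `|v|) &
   forall v, {ae mu, forall t, 0 < t <= T -> F t v (fs v t)}].
Proof.
move=> Fval mF cd ic id Fgrowth.
have [c' [mc c0 ic' cE]] := Lintegrable_borel ic (fun t tI => (cd t tI).1).
have [d' [md d0 id' dE]] := Lintegrable_borel id (fun t tI => (cd t tI).2).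
have cdE : {ae mu, forall t, Icc 0 T t -> c t = c' t /\ d t = d' t}.
  by apply: ae_imp2 cE dE => t h1 h2 tI; split; [exact: h1|exact: h2].
have [N [mN N0 hN]] : exists N, [/\ measurable (N : set (measurableTypeR R)), mu N = 0%E &
    forall t, ~ N t -> Icc 0 T t -> [/\ c t = c' t, d t = d' t &
      forall v, inf [set `|w| | w in F t v] <= c t * `|v| + d t]].
  apply: ae_null_set; apply: ae_imp2 cdE Fgrowth => t h1 h2 tI.
  by have [] := h1 tI; split => //; exact: h2.
have /choice[f hf] v : exists f : R -> H, wmeas ip f /\ exists M : set R,
    [/\ measurable (M : set (measurableTypeR R)), mu M = 0%E,
     forall t, Icc 0 T t -> ~ M t -> F t v (f t) /\ forall y, F t v y -> `|f t| <= `|y| &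
     forall t, (~ Icc 0 T t \/ M t) -> f t = 0].
  have [f [M [? ? ? ? ?]]] := min_norm_selection hip dq (fun t => Fval t v) (mF v).
  by exists f; split => //; exists M.
(* Zero on the exceptional times, so that the growth bound holds for every [t], while membership in
   [F t v] is lost only on a null set. *)
exists (fun v t => \1_(~` N) t *: f v t), (fun t => c' t + d' t); split.
- split; [by move=> t; rewrite addr_ge0|exact: measurable_funD|exact: intbD].
- move=> v; apply: (wmeasZ hip); last by have [] := hf v.
  by apply: measurable_indic; exact: measurableC.
- move=> v t; have pos : 0 <= (c' t + d' t) * (1 + `|v|) by rewrite mulr_ge0 ?addr_ge0.
  rewrite indicE; have [Nt|nN] := pselect (N t).
    by rewrite memNset ?scale0r ?normr0// => /(_ Nt).
  rewrite mem_set// scale1r; have [_ [M [_ _ hM hM0]]] := hf v.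
  have [tI|nI] := pselect (Icc 0 T t); last by rewrite hM0 ?normr0//; left.
  have [Mt|nM] := pselect (M t); first by rewrite hM0 ?normr0//; right.
  have [_ fmin] := hM t tI nM.
  have [ce de growth] := hN t nN tI.
  have [Fne _] := Fval t v tI.
  apply: (@le_trans _ _ (c t * `|v| + d t)).
    apply: le_trans (growth v); apply: lb_le_inf; first by case: Fne => y Fy; exists `|y|, y.
    by move=> _ [y Fy <-]; exact: fmin.
  rewrite ce de; move: (c0 t) (d0 t) (normr_ge0 v); clear; nra.
- move=> v; have [_ [M [mM M0 hM _]]] := hf v.
  exists (N `|` M); split; first exact: measurableU.
    exact: null_set_setU.
  move=> t /= h; apply: contrapT => nNM; apply: h => /andP[t0 tT].
  rewrite indicE mem_set; last by move=> Nt; apply: nNM; left.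
  rewrite scale1r; apply: (hM t _ _).1; first by rewrite /Icc /= tT ltW.
  by move=> Mt; apply: nNM; right.
Qed.

End GrowthSelection.

(** An open set is a countable union of balls centred in the dense sequence, and [wmeas_norm] makes
    the preimage of each ball Borel; the null set [N] is absorbed by completeness. *)
Lemma wmeas_Hmeasurable (R : realType) (H : completeNormedModType R) (ip : H -> H -> R)
    (hip : inner_product ip) (q : nat -> H) (dq : dense_seq q)
    (u f : R -> H) (A N : set R) :
  wmeas ip u -> measurable (A : set (measurableTypeR R)) ->
  measurable (N : set (measurableTypeR R)) -> lebesgue_measure N = 0%E ->
  (forall s, A s -> ~ N s -> f s = u s) -> Hmeasurable A f.
Proof.
move=> wu mA mN N0 fu U oU.
pose I := [set p : nat * nat | ball (q p.1) (p.2.+1%:R^-1) `<=` U].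
have mB (p : nat * nat) :
    measurable ([set s | `|u s - q p.1| < p.2.+1%:R^-1] : set (measurableTypeR R)).
  apply: measurable_lt_fun; last exact: measurable_cst.
  by apply: (wmeas_norm hip dq); apply: (wmeasB hip) => //; exact: wmeas_cst.
have mU : measurable (u @^-1` U : set (measurableTypeR R)).
  have -> : u @^-1` U = \bigcup_(p in I) [set s | `|u s - q p.1| < p.2.+1%:R^-1].
    apply/seteqP; split => s /=; last first.
      by move=> [p Ip up]; apply: Ip; rewrite -ball_normE /= distrC.
    move=> Us; have /nbhs_ballP[e /= e0 eU] : nbhs (u s) U by exact: open_nbhs_nbhs.
    have e20 : 0 < e / 2 by rewrite divr_gt0.
    have [l le] : exists l : nat, l.+1%:R^-1 < e / 2.
      by have [l _ hl] := near_infty_natSinv_lt (PosNum e20); exists l; apply: hl => /=.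
    have l0 : (0 : R) < l.+1%:R^-1 by rewrite invr_gt0.
    have [k uk] := dq (u s) _ l0; exists (k, l) => //.
    move=> y; rewrite -ball_normE /= => qy; apply: eU; rewrite -ball_normE /=.
    rewrite -(subrK (q k) (u s)) -addrA (le_lt_trans (ler_normD _ _))//.
    by rewrite [e]splitr ltrD// (lt_trans _ le).
  rewrite bigcup_mkcond; apply: countable_bigcupT_measurable => // p.
  by case: ifP => _; [exact: mB|exact: measurable0].
apply: (@Lmeasurable_ae _ _ (A `&` u @^-1` U) N) => //; first exact: measurableI.
by move=> s nN; split => -[As]; rewrite /= fu.
Qed.

Theorem theorem5p2 (R : realType) (H : completeNormedModType R)
  (ip : H -> H -> R) (T : R)
  (F : R -> H -> set H) (g : R -> R -> H -> H) (C : R -> H -> set H) (x0 : H) :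
  (* H is a separable Hilbert space with inner product ip *)
  inner_product ip -> separable_space (H := H) ->
  0 < T ->
  (* F has nonempty, closed, convex values *)
  (forall t v, Icc 0 T t -> F t v !=set0 /\ closed (F t v) /\ convex_subset (F t v)) ->
  (* (F1) *)
  (forall v, mf_measurable (Icc 0 T) (fun t => F t v)) ->
  (* (F2) *)
  {ae @lebesgue_measure R, forall t, Icc 0 T t -> usc_weak ip (F t)} ->
  (* (F3) *)
  (exists c d : R -> R,
     [/\ forall t, Icc 0 T t -> 0 <= c t /\ 0 <= d t,
         Lintegrable (Icc 0 T) c, Lintegrable (Icc 0 T) d &
         {ae @lebesgue_measure R, forall t, Icc 0 T t ->
            forall v, inf [set `|w| | w in F t v] <= c t * `|v| + d t}]) ->
  (* (F4), with gamma the Kuratowski or the Hausdorff measure *)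
  (exists k : R -> R,
     [/\ forall t, Icc 0 T t -> 0 <= k t,
         Lintegrable (Icc 0 T) k &
         {ae @lebesgue_measure R, forall t, Icc 0 T t ->
            forall A, bounded_subset A ->
              (kuratowski (mimage (F t) A) <= (k t)%:E * kuratowski A)%E}
       \/
         {ae @lebesgue_measure R, forall t, Icc 0 T t ->
            forall A, bounded_subset A ->
              (hausdorff_mnc (mimage (F t) A) <= (k t)%:E * hausdorff_mnc A)%E}]) ->
  (* (g1) *)
  (forall v, Hmeasurable2 (Icc 0 T `*` Icc 0 T) (fun ts => g ts.1 ts.2 v)) ->
  (* (g2) *)
  (forall r : R, 0 < r -> exists mu : R -> R,
     [/\ forall t, Icc 0 T t -> 0 <= mu t,
         Lintegrable (Icc 0 T) mu &
         forall t s x y, triangle T (t, s) -> `|x| <= r -> `|y| <= r ->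
           `|g t s x - g t s y| <= mu t * `|x - y|]) ->
  (* (g3) *)
  (exists sigma : R * R -> R,
     [/\ forall ts, triangle T ts -> 0 <= sigma ts,
         Lintegrable2 (triangle T) sigma &
         forall t s x, triangle T (t, s) -> `|g t s x| <= sigma (t, s) * (1 + `|x|)]) ->
  (* C has nonempty closed values *)
  (forall t x, Icc 0 T t -> C t x !=set0 /\ closed (C t x)) ->
  (* (C1) *)
  (exists (zeta : R -> R) (L : R),
     [/\ abs_cont 0 T zeta, forall t, Icc 0 T t -> 0 <= zeta t,
         0 <= L, L < 1 &
         forall s t x y z, Icc 0 T s -> Icc 0 T t ->
           `|dist z (C t x) - dist z (C s y)| <= `|zeta t - zeta s| + L * `|x - y|]) ->
  (* (C2) *)
  equi_uniformly_subsmooth ip [set tx : R * H | Icc 0 T tx.1] (fun tx => C tx.1 tx.2) ->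
  (* (C3) *)
  (forall t (r : R) (A : set H), Icc 0 T t -> 0 < r -> bounded_subset A ->
     compact (closure (mimage (C t) A `&` rball r))) ->
  C 0 x0 x0 ->
  exists x : R -> H,
    [/\ abs_cont 0 T x, x 0 = x0 &
        {ae @lebesgue_measure R, forall t, Icc 0 T t ->
           derivable x t 1 /\
           exists (nv fv I : H),
             [/\ clarke_normal ip (C t (x t)) (x t) nv,
                 F t (x t) fv,
                 bochner_integral ip (Icc 0 t) (fun s => g t s (x s)) I &
                 'D_1 x t = - nv + fv + I]}].

Proof.
move=> hip Hsep T0 Fval mF Fusc [c [d [cd ic id Fgrowth]]] _ mg g_lip g_growth Cval
  [zeta [L [acz _ L0 L1 CLip]]] Csub Ccomp Cx0.
have [q dq] := separable_dense_seq Hsep.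
have [z [z0 iz zP]] := abs_cont_density T0 acz.
have [fs [c0 [[c00 mc0 ic0] wfs fs_le fsF]]] :=
  linear_growth_selection hip dq Fval mF cd ic id Fgrowth.
have [h [sg [[wh h_le h_off] [sg0 isg mS iS] h_lip hg]]] := borel_kernel hip dq mg g_lip g_growth.
have mz : measurable_fun setT z by apply/measurable_EFinP; exact: measurable_int iz.
have iz' : intb 0 T z by apply: (integrableS measurableT (measurable_oc 0 T) _ iz).
have S0 t : 0 <= row_mass sg t by apply: Rintegral_ge0.
have CLip' s t x y v : 0 <= s -> s <= t -> t <= T ->
    `|dist v (C t x) - dist v (C s y)| <= itg s t z + L * `|x - y|.
  move=> s0 st tT; apply: le_trans (CLip s t x y v _ _) _.
  - by rewrite /Icc /= s0 (le_trans st).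
  - by rewrite /Icc /= tT (le_trans s0).
  rewrite lerD2r /itg Rintegral_itv_obnd_cbnd; first exact: zP.
  exact: intb_sub s0 tT iz'.
have Fusc' : {ae (@lebesgue_measure R), forall t, 0 < t <= T -> usc_weak ip (F t)}.
  by apply: ae_imp Fusc => t ut /andP[t0 tT]; apply: ut; rewrite /Icc /= tT ltW.
have Csub' eta : 0 < eta -> exists2 delta, 0 < delta & subsmooth_at ip T C eta delta.
  move=> /Csub[delta d0 hd]; exists delta => // t u x1 x2 v1 v2 tI.
  by have := hd (t, u) x1 x2 v1 v2 tI.
have [X XP] := scheme_family ip x0 T0 Cval Ccomp z0 iz' c00 ic0 S0 iS fs (volterra ip h).
have [x [acx x00 wx xle xeq]] : exists x : R -> H, [/\ abs_cont 0 T x, x 0 = x0, wmeas ip x,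
   (exists M, 0 <= M /\ forall t, `|x t| <= M) &
   {ae (@lebesgue_measure R), forall t, 0 < t < T -> exists nv fv,
     [/\ clarke_normal ip (C t (x t)) (x t) nv, F t (x t) fv &
      k^-1 *: (x (k + t) - x t) @[k --> 0^'] --> - nv + fv + volterra ip h x t]}].
  have [||||x [h1 h2 h3 h4 h5]] := scheme_solution hip dq Cval CLip' Ccomp Cx0 L0 L1 mz mc0 mS
    wfs fs_le _ _ _ XP _ fsF Fval Fusc' Csub'.
  - by move=> y wy; exact: (wmeas_volterra hip dq wh).
  - by move=> y y' t _; exact: volterra_causal.
  - by move=> y t r _; exact: (volterra_le hip dq).
  - move=> r r0; have [m [m0 im hm]] := h_lip r r0.
    (* The factor [T] is the one produced by [volterra_lip]. *)
    exists (fun t => T * m t); split; [by move=> t; rewrite mulr_ge0// ltW|exact: intbZ|].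
    move=> y y' e wy wy' e0 yy' t tT.
    by apply: (volterra_lip hip dq T0 wh h_le h_off sg0 isg tT wy wy' r0 e0 yy' (m0 t)); exact: hm.
  exists x; split => //; eexists; split; last exact: h4.
  exact: le_trans (normr_ge0 _) (h4 0).
exists x; split => //.
have [M [M0 xM]] := xle.
(* The two-sided derivative is only available inside []0, T[]; the endpoints form a null set. *)
have ne (a : R) : {ae (@lebesgue_measure R), forall t, t <> a}.
  exists [set a]; split; [exact: measurable_set1|exact: lebesgue_measure_set1|].
  by move=> t /= /contrapT.
apply: ae_imp2 (ae_imp2 (fun t h1 h2 => conj h1 h2) (ne 0) (ne T))
  (ae_imp2 (fun t h1 h2 => conj h1 h2) xeq hg) => t [t0 tT] [{}xeq {}hg] tI.
have [t0' tT'] := andP tI.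
have tin : 0 < t < T.
  by rewrite !lt_neqAle t0' tT' !andbT; apply/andP; split; apply/eqP => // /esym.
have [nv [fv [hnv hfv lim_x]]] := xeq tin.
have [N [mN N0 gh]] := hg tI.
have {}lim_x : k^-1 *: ((x \o shift t) (k *: (1 : R)) - x t) @[k --> 0^'] -->
    - nv + fv + volterra ip h x t.
  rewrite (_ : (fun k => _) = fun k => k^-1 *: (x (k + t) - x t))//.
  by apply/funext => k /=; rewrite /GRing.scale /= mulr1.
split; first by apply/cvg_ex; eexists; exact: lim_x.
exists nv, fv, (volterra ip h x t); split => //; last exact: cvg_lim lim_x.
have wr := wmeas_row wh t wx.
have br := bint_row hip dq wh h_le h_off sg0 isg wx M0 (fun s (_ : 0 < s <= t) => xM s).
split.
- exact: (wmeas_Hmeasurable hip dq wr (measurable_Icc 0 t) mN N0 (fun s => gh s _)).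
- have ib : intb 0 t (fun s => `|h t s (x s)|).
    exact: (integrableS measurableT (measurable_oc 0 t) _ br).
  have [] := completed_transfer (f := fun s => `|g t s (x s)|) (wmeas_norm hip dq wr) ib mN N0 => //.
  by move=> s sI nN; rewrite gh.
move=> e; rewrite (volterraE hip dq wh h_le h_off sg0 isg wx M0 (fun s (_ : 0 < s <= t) => xM s)).
rewrite (vintP hip)//.
have ib : intb 0 t (fun s => ip (h t s (x s)) e).
  exact: (integrableS measurableT (measurable_oc 0 t) _ 
    (bint_ip hip (mu := @lebesgue_measure R) e measurableT wr br)).
have [_ ->] := completed_transfer (f := fun s => ip (g t s (x s)) e) (wr e) ib mN N0
  (fun s sI nN => congr1 (ip ^~ e) (gh s (x s) sI nN)).
(* The Volterra value is an integral over the whole line; the kernel vanishes outside []0, t]], so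
   it agrees with the one over that interval. *)
rewrite /itg [RHS]Rintegral_mkcond; apply: eq_Rintegral => s _.
rewrite patchE; case: ifPn => // /negP; rewrite inE /= in_itv /= => ns.
by rewrite h_off// (ip0l hip).
Qed.
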